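(* Let $s\in(0,1/2)$ and $\alpha\in(0,1-2s)$. There exist a time $T>0$ and a smooth function $\theta_0$ on $\mathbb{R}^2$ with $\|\theta_0\|_{C^2(\mathbb{R}^2)}\le 1$ such that for every modulus of continuity $\rho$ there exists a smooth, divergence-free, time-independent vector field $u:\mathbb{R}^2\to\mathbb{R}^2$ with $\|u\|_{C^\alpha(\mathbb{R}^2)}\le 1$ such that the smooth solution $\theta$ of $$\partial_t\theta+u\cdot\nabla\theta+(-\Delta)^s\theta=0,\qquad \theta(0,\cdot)=\theta_0,$$ breaks the modulus $\rho$ at some time $t\le T$.
   Context: A modulus of continuity is a continuous non-decreasing function $\rho:[0,\infty)\to[0,\infty)$ with $\rho(0)=0$. A function $\theta:(t_0,t_1)\times\mathbb{R}^2\to\mathbb{R}$ breaks $\rho$ at time $t$ if there exist $x,y\in\mathbb{R}^2$ with $|\theta(t,x)-\theta(t,y)|>\rho(|x-y|)$. $(-\Delta)^s$ denotes the fractional Laplacian, $(-\Delta)^s f(x)=c_s\,\mathrm{P.V.}\int_{\mathbb{R}^2}\frac{f(x)-f(y)}{|x-y|^{2+2s}}\,dy$. *)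

(* Defs.v *)
From Stdlib Require Import Reals Lra List.
Open Scope R_scope.

Definition R2 : Type := (R * R)%type.

Definition norm2 (p : R2) : R := sqrt (fst p ^ 2 + snd p ^ 2).
Definition dist2 (p q : R2) : R := norm2 (fst p - fst q, snd p - snd q).
Definition dist3 (p q : R * R2) : R :=
  sqrt ((fst p - fst q) ^ 2 + (fst (snd p) - fst (snd q)) ^ 2
        + (snd (snd p) - snd (snd q)) ^ 2).

Definition dirs2 : list (R2 -> R -> R2) :=
  (fun x h => (fst x + h, snd x)) :: (fun x h => (fst x, snd x + h)) :: nil.
Definition dirs3 : list (R * R2 -> R -> R * R2) :=
  (fun p h => (fst p + h, snd p))
  :: (fun p h => (fst p, (fst (snd p) + h, snd (snd p))))
  :: (fun p h => (fst p, (fst (snd p), snd (snd p) + h))) :: nil.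

Definition cont_on {X : Type} (d : X -> X -> R) (U : X -> Prop) (f : X -> R) : Prop :=
  forall x, U x -> forall eps, 0 < eps -> exists delta, 0 < delta /\
    forall y, U y -> d x y < delta -> Rabs (f y - f x) < eps.

Fixpoint Ck {X : Type} (d : X -> X -> R) (dirs : list (X -> R -> X))
  (U : X -> Prop) (k : nat) (f : X -> R) : Prop :=
  match k with
  | O => cont_on d U f
  | S k' => cont_on d U f /\
      Forall (fun e => exists g : X -> R,
                 (forall x, U x -> derivable_pt_lim (fun h => f (e x h)) 0 (g x))
                 /\ Ck d dirs U k' g) dirs
  end.

Definition smooth_on {X : Type} (d : X -> X -> R) (dirs : list (X -> R -> X))
  (U : X -> Prop) (f : X -> R) : Prop := forall k, Ck d dirs U k f.

Definition smooth2 (f : R2 -> R) : Prop := smooth_on dist2 dirs2 (fun _ => True) f.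

Definition is_d1 (f g : R2 -> R) : Prop :=
  forall x, derivable_pt_lim (fun h => f (fst x + h, snd x)) 0 (g x).
Definition is_d2 (f g : R2 -> R) : Prop :=
  forall x, derivable_pt_lim (fun h => f (fst x, snd x + h)) 0 (g x).

Definition sup_le (f : R2 -> R) (M : R) : Prop := forall x, Rabs (f x) <= M.

Definition C2_norm_le1 (f : R2 -> R) : Prop :=
  exists g1 g2 g11 g12 g22 : R2 -> R,
    is_d1 f g1 /\ is_d2 f g2 /\ is_d1 g1 g11 /\ is_d2 g1 g12 /\ is_d2 g2 g22 /\
    exists M0 M1 M2 M11 M12 M22,
      sup_le f M0 /\ sup_le g1 M1 /\ sup_le g2 M2 /\
      sup_le g11 M11 /\ sup_le g12 M12 /\ sup_le g22 M22 /\
      M0 + M1 + M2 + M11 + M12 + M22 <= 1.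

Definition Calpha_norm_le1 (alpha : R) (u : R2 -> R2) : Prop :=
  exists M H,
    (forall x, norm2 (u x) <= M) /\
    (forall x y, x <> y ->
       dist2 (u x) (u y) <= H * Rpower (dist2 x y) alpha) /\
    M + H <= 1.

Definition smooth_field (u : R2 -> R2) : Prop :=
  smooth2 (fun x => fst (u x)) /\ smooth2 (fun x => snd (u x)).

Definition div_free (u : R2 -> R2) : Prop :=
  forall x, exists a b,
    derivable_pt_lim (fun h => fst (u (fst x + h, snd x))) 0 a /\
    derivable_pt_lim (fun h => snd (u (fst x, snd x + h))) 0 b /\
    a + b = 0.

Definition modulus (rho : R -> R) : Prop :=
  (forall r, 0 <= r -> 0 <= rho r) /\
  (forall r1 r2, 0 <= r1 -> r1 <= r2 -> rho r1 <= rho r2) /\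
  (forall r, 0 <= r -> forall eps, 0 < eps -> exists delta, 0 < delta /\
      forall r', 0 <= r' -> Rabs (r' - r) < delta -> Rabs (rho r' - rho r) < eps) /\
  rho 0 = 0.

Definition breaks_at (theta : R -> R2 -> R) (rho : R -> R) (t : R) : Prop :=
  exists x y, Rabs (theta t x - theta t y) > rho (dist2 x y).

Definition is_RInt (f : R -> R) (a b v : R) : Prop :=
  exists pr : Riemann_integrable f a b, RiemannInt pr = v.

Definition is_improper_int_0_inf (f : R -> R) (v : R) : Prop :=
  forall eta, 0 < eta -> exists a0 b0, 0 < a0 /\
    forall a b, 0 < a -> a < a0 -> b0 < b ->
      exists pr : Riemann_integrable f a b, Rabs (RiemannInt pr - v) < eta.

Definition is_Gamma (z g : R) : Prop :=
  is_improper_int_0_inf (fun t => Rpower t (z - 1) * exp (- t)) g.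

(** Principal-value integral
      L = P.V. int_{R^2} (f(x) - f(y)) / |x-y|^(2+2s) dy
        = lim_{eps->0, R->oo} int_{eps < |x-y| < R} ...,
    written in polar coordinates y = x + r (cos phi, sin phi):
      lim int_eps^R ( int_0^{2 pi} (f x - f(x + r w(phi))) dphi ) r^(-1-2s) dr. *)
Definition pv_frac_integral (s : R) (f : R2 -> R) (x : R2) (L : R) : Prop :=
  exists G : R -> R,
    (forall r, 0 < r ->
       is_RInt (fun phi => f x - f (fst x + r * cos phi, snd x + r * sin phi))
               0 (2 * PI) (G r)) /\
    is_improper_int_0_inf (fun r => G r * Rpower r (- 1 - 2 * s)) L.

(** Normalising constant of the fractional Laplacian in dimension 2:
    c_s = 4^s Gamma(1+s) / (pi |Gamma(-s)|), with |Gamma(-s)| = Gamma(1-s)/s. *)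
Definition frac_const (s g1 g2 : R) : R := Rpower 4 s * g1 * s / (PI * g2).

Definition is_solution (s c : R) (u : R2 -> R2) (theta0 : R2 -> R)
  (theta : R -> R2 -> R) : Prop :=
  smooth_on dist3 dirs3 (fun p => 0 < fst p) (fun p => theta (fst p) (snd p)) /\
  cont_on dist3 (fun p => 0 <= fst p) (fun p => theta (fst p) (snd p)) /\
  (exists M, forall t x, 0 <= t -> Rabs (theta t x) <= M) /\
  (forall x, theta 0 x = theta0 x) /\
  (forall t x, 0 < t -> exists dt d1 d2 L,
     derivable_pt_lim (fun tau => theta tau x) t dt /\
     derivable_pt_lim (fun h => theta t (fst x + h, snd x)) 0 d1 /\
     derivable_pt_lim (fun h => theta t (fst x, snd x + h)) 0 d2 /\
     pv_frac_integral s (theta t) x L /\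
     dt + fst (u x) * d1 + snd (u x) * d2 + c * L = 0).

(* Main.v *)
From Coquelicot Require Import Coquelicot.
Require Import Defs.
From Stdlib Require Import Reals Lra Lia Psatz List ZArith ClassicalEpsilon.
Open Scope R_scope.

(* The velocity is [u = A (- d_y psi, d_x psi)] with
   [psi = sin x sin y S_N ((cos^2 x + cos^2 y) / 2)], where [S_N] is the [N]-th partial sum of the
   binomial series of [(1 - v)^(-p)] and [p = (1 - alpha) / 2].  Every partial sum gives a
   trigonometric polynomial; positivity of the coefficients bounds the [C^alpha] norm uniformly in
   [N], and as [N] grows the field approaches one which on the [x]-axis points to the origin with
   speed of order [|x|^alpha], so that the origin is reached in finite time.

   The datum is a small multiple of [sin (K x)], with crest at [X0 = PI / (2 K)] and trough at [-X0].  A bump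
   of width proportional to [X], centred at [(X, 0)] and carried by the flow, is a subsolution up to
   a loss of height at the rate [X^(-2s)]; since [dX / dt] is of order [- X^alpha] the total loss is
   of order [X0^(1 - 2s - alpha)], small for [K] large.  Hence the solution is close to its maximum
   at [(eps, 0)] and, by the mirror barrier, to its minimum at [(-eps, 0)], for [eps] as small as
   [rho] requires.  The maximum principle makes this valid for every bounded solution.

   Existence: on coefficients of [sin (k . x)], transport by a divergence free odd trigonometric
   polynomial is an antisymmetric matrix of finite range, so Galerkin approximations satisfy
   weighted energy estimates of every order, uniformly in the truncation. *)

(* Coquelicot goals are equations in canonical structures over [R]; [ring] needs the carrier. *)
Ltac eqR := match goal with |- ?a = ?b => change (@eq R a b) end.

(** The order of the quantifiers shapes the proof: [T] and the datum are fixed before [rho], so the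
    amplitude, the frequency and the bounds on travel time and total loss must not depend on the
    truncation [N]; only [eps] and [N] are chosen after [rho]. Since [1 - (cos^2 x + cos^2 y) / 2 =
    (sin^2 x + sin^2 y) / 2], the limiting stream function behaves near the origin like a multiple
    of [x y |(x, y)|^(alpha - 1)], a saddle of homogeneity [1 + alpha]; truncation smooths it and,
    for [N] large, keeps a fixed fraction of the inflow speed down to distance [eps]. The position
    of the centre of the bump serves as time variable, so no trajectory has to be constructed: in
    this variable the dissipative rate [X^(-2s)] is divided by a speed of order [X^alpha], and
    [alpha < 1 - 2s] is exactly integrability of the quotient at [X = 0]. The bump is never
    transported exactly: monotonicity of the speed along the axis, monotonicity of its ratio to the
    distance, and the sign of the transverse velocity make it a subsolution. *)

Lemma defs_is_RInt_iff (f : R -> R) (a b v : R) :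
  Defs.is_RInt f a b v <-> (ex_RInt f a b /\ RInt f a b = v).
Proof.
  split.
  - intros [pr H]. split.
    + now apply ex_RInt_Reals_1.
    + rewrite <- H. apply RInt_Reals.
  - intros [H1 H2]. exists (ex_RInt_Reals_0 _ _ _ H1).
    now rewrite <- RInt_Reals.
Qed.

Lemma improper_iff (f : R -> R) (v : R) :
  is_improper_int_0_inf f v <->
  (forall eta, 0 < eta -> exists a0 b0, 0 < a0 /\
    forall a b, 0 < a -> a < a0 -> b0 < b ->
      ex_RInt f a b /\ Rabs (RInt f a b - v) < eta).
Proof.
  split; intros H eta He; destruct (H eta He) as (a0 & b0 & Ha & Hb);
    exists a0, b0; split; auto; intros a b H1 H2 H3;
    specialize (Hb a b H1 H2 H3).
  - destruct Hb as [pr Hpr]. split.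
    + now apply ex_RInt_Reals_1.
    + now rewrite (RInt_Reals _ _ _ pr).
  - destruct Hb as [H4 H5]. exists (ex_RInt_Reals_0 _ _ _ H4).
    now rewrite <- RInt_Reals.
Qed.

Lemma RInt_plusR (f g : R -> R) (a b : R) : ex_RInt f a b -> ex_RInt g a b ->
  ex_RInt (fun x => f x + g x) a b /\
  RInt (fun x => f x + g x) a b = RInt f a b + RInt g a b.
Proof.
  intros Hf Hg. split.
  - now apply (ex_RInt_plus (V := R_NormedModule)).
  - now apply (RInt_plus (V := R_CompleteNormedModule)).
Qed.

Lemma RInt_scalR (f : R -> R) (l a b : R) : ex_RInt f a b ->
  ex_RInt (fun x => l * f x) a b /\ RInt (fun x => l * f x) a b = l * RInt f a b.
Proof.
  intros Hf. split.
  - now apply (ex_RInt_scal (V := R_NormedModule)).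
  - now apply (RInt_scal (V := R_CompleteNormedModule)).
Qed.

Lemma RInt_minusR (f g : R -> R) (a b : R) : ex_RInt f a b -> ex_RInt g a b ->
  ex_RInt (fun x => f x - g x) a b /\
  RInt (fun x => f x - g x) a b = RInt f a b - RInt g a b.
Proof.
  intros Hf Hg. split.
  - now apply (ex_RInt_minus (V := R_NormedModule)).
  - now apply (RInt_minus (V := R_CompleteNormedModule)).
Qed.

Lemma RInt_constR (c a b : R) : RInt (fun _ => c) a b = (b - a) * c.
Proof. apply (RInt_const (V := R_CompleteNormedModule)). Qed.

(** * Principal values in polar coordinates *)

Definition kern (s r : R) : R := Rpower r (- 1 - 2 * s).

Lemma kern_pos s r : 0 < kern s r.
Proof. apply exp_pos. Qed.

Lemma Rpower_derive (e r : R) : 0 < r ->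
  is_derive (fun r => Rpower r e) r (e * Rpower r (e - 1)).
Proof.
  intros Hr. apply is_derive_Reals. apply derivable_pt_lim_power. exact Hr.
Qed.

Lemma Rpower_continuous (e r : R) : 0 < r -> continuous (fun r => Rpower r e) r.
Proof.
  intros Hr. apply (ex_derive_continuous (fun r => Rpower r e)).
  eexists. now apply Rpower_derive.
Qed.

Lemma kern_mult s r : 0 < r -> r * kern s r = Rpower r (- (2 * s)).
Proof.
  intros Hr. unfold kern. rewrite <- (Rpower_1 r) at 1 by easy.
  rewrite <- Rpower_plus. f_equal. ring.
Qed.

Lemma RInt_power (e a b : R) : e <> 0 -> 0 < a -> a <= b ->
  RInt.is_RInt (fun r => Rpower r (e - 1)) a b ((Rpower b e - Rpower a e) / e).
Proof.
  intros He Ha Hab.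
  replace ((Rpower b e - Rpower a e) / e)
    with (minus (Rpower b e / e) (Rpower a e / e))
    by (change (@eq R (Rpower b e / e + - (Rpower a e / e)) ((Rpower b e - Rpower a e) / e));
        field; auto).
  apply (is_RInt_derive (fun r => Rpower r e / e)).
  - intros x Hx. rewrite Rmin_left, Rmax_right in Hx by lra.
    replace (Rpower x (e - 1)) with (/ e * (e * Rpower x (e - 1))) by (field; auto).
    apply (is_derive_ext (fun r => / e * Rpower r e)).
    { intros; eqR; unfold Rdiv; ring. }
    apply (is_derive_scal (fun r => Rpower r e)). apply Rpower_derive. lra.
  - intros x Hx. rewrite Rmin_left, Rmax_right in Hx by lra.
    apply Rpower_continuous. lra.
Qed.

(* [2 PI] times the integral over [r > 0] of [Rmin A (B r) r^(-1-2s)]. *)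
Definition Kc (s A B : R) : R :=
  2 * PI * (A * Rpower (B / A) (2 * s) * (/ (1 - 2 * s) + / (2 * s))).

Lemma Rmin_kern_continuous s A B r : 0 < r ->
  continuous (fun r => Rmin A (B * r) * kern s r) r.
Proof.
  intros Hr.
  apply (continuous_mult (fun r => Rmin A (B * r)) (kern s)).
  - apply (continuous_ext (fun r => (A + B * r - Rabs (A - B * r)) / 2)).
    { intros t. unfold Rmin, Rabs. destruct Rle_dec, Rcase_abs; simpl; lra. }
    apply (continuous_mult (fun r => A + B * r - Rabs (A - B * r)) (fun _ => / 2));
      [| apply continuous_const].
    apply (continuous_minus (fun r => A + B * r) (fun r => Rabs (A - B * r))).
    + apply (ex_derive_continuous (fun r => A + B * r)). auto_derive; auto.
    + apply (continuous_comp (fun r => A - B * r) Rabs).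
      * apply (ex_derive_continuous (fun r => A - B * r)). auto_derive; auto.
      * apply (continuous_Rabs (A - B * r)).
  - now apply Rpower_continuous.
Qed.

Lemma ex_RInt_pos (f : R -> R) (a b : R) :
  0 < a -> 0 < b -> (forall r, 0 < r -> continuous f r) -> ex_RInt f a b.
Proof.
  intros Ha Hb Hc. apply (ex_RInt_continuous f). intros z Hz. apply Hc.
  apply Rlt_le_trans with (2 := proj1 Hz). now apply Rmin_pos.
Qed.

(* The integral is split at [r = A / B], where the two bounds coincide. *)
Lemma RInt_min_kern s A B a b : 0 < s -> s < 1 / 2 -> 0 < A -> 0 < B ->
  0 < a -> a < A / B -> A / B < b ->
  2 * PI * RInt (fun r => Rmin A (B * r) * kern s r) a b <= Kc s A B.
Proof.
  intros Hs Hs' HA HB Ha Hab Hb. unfold Kc.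
  assert (Hq : 0 < A / B) by (apply Rdiv_lt_0_compat; auto).
  apply Rmult_le_compat_l. { generalize PI_RGT_0; lra. }
  rewrite <- (RInt_Chasles _ a (A / B) b);
    try (apply ex_RInt_pos; try lra; intros; now apply Rmin_kern_continuous).
  change plus with Rplus.
  set (q := A / B) in *.
  assert (HBq : B = A / q) by (unfold q; field; lra).
  assert (H1 : RInt (fun r => Rmin A (B * r) * kern s r) a q
     <= B * ((Rpower q (1 - 2 * s) - Rpower a (1 - 2 * s)) / (1 - 2 * s))).
  { pose proof (RInt_power (1 - 2 * s) a q ltac:(lra) Ha ltac:(lra)) as HI.
    apply (is_RInt_scal _ _ _ B) in HI.
    eapply Rle_trans; [|right; exact (is_RInt_unique _ _ _ _ HI)].
    apply RInt_le; try lra.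
    - apply ex_RInt_pos; try lra; intros; now apply Rmin_kern_continuous.
    - eexists; exact HI.
    - intros r Hr. unfold scal; simpl; unfold mult; simpl.
      replace (1 - 2 * s - 1) with (- (2 * s)) by ring.
      rewrite <- (kern_mult s r) by lra. rewrite <- Rmult_assoc.
      apply Rmult_le_compat_r. apply Rlt_le, kern_pos. apply Rmin_r. }
  assert (H2 : RInt (fun r => Rmin A (B * r) * kern s r) q b
     <= A * ((Rpower b (- (2 * s)) - Rpower q (- (2 * s))) / (- (2 * s)))).
  { pose proof (RInt_power (- (2 * s)) q b ltac:(lra) ltac:(lra) ltac:(lra)) as HI.
    apply (is_RInt_scal _ _ _ A) in HI.
    eapply Rle_trans; [|right; exact (is_RInt_unique _ _ _ _ HI)].
    apply RInt_le; try lra.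
    - apply ex_RInt_pos; try lra; intros; now apply Rmin_kern_continuous.
    - eexists; exact HI.
    - intros r Hr. unfold scal; simpl; unfold mult; simpl.
      replace (- (2 * s) - 1) with (- 1 - 2 * s) by ring. fold (kern s r).
      apply Rmult_le_compat_r. apply Rlt_le, kern_pos. apply Rmin_l. }
  assert (Hqi : Rpower (B / A) (2 * s) = Rpower q (- (2 * s))).
  { rewrite Rpower_Ropp. unfold Rpower. replace (B / A) with (/ q).
    - rewrite ln_Rinv by auto. rewrite <- exp_Ropp. f_equal. ring.
    - unfold q. field. lra. }
  rewrite Hqi.
  assert (Hq1 : B * Rpower q (1 - 2 * s) = A * Rpower q (- (2 * s))).
  { replace (1 - 2 * s) with (1 + - (2 * s)) by ring.
    rewrite Rpower_plus, Rpower_1 by auto. rewrite HBq. field. lra. }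
  assert (P1 : 0 < Rpower a (1 - 2 * s)) by apply exp_pos.
  assert (P2 : 0 < Rpower b (- (2 * s))) by apply exp_pos.
  replace (A * Rpower q (- (2 * s)) * (/ (1 - 2 * s) + / (2 * s)))
    with (B * Rpower q (1 - 2 * s) / (1 - 2 * s) + A * Rpower q (- (2 * s)) / (2 * s))
    by (rewrite Hq1; field; lra).
  apply Rplus_le_compat.
  - apply Rle_trans with (1 := H1).
    unfold Rdiv. rewrite <- Rmult_assoc. apply Rmult_le_compat_r.
    + apply Rlt_le, Rinv_0_lt_compat; lra.
    + apply Rmult_le_compat_l; lra.
  - apply Rle_trans with (1 := H2).
    replace (A * ((Rpower b (- (2 * s)) - Rpower q (- (2 * s))) / - (2 * s)))
      with (A * (Rpower q (- (2 * s)) - Rpower b (- (2 * s))) / (2 * s)) by (field; lra).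
    unfold Rdiv. apply Rmult_le_compat_r.
    + apply Rlt_le, Rinv_0_lt_compat; lra.
    + apply Rmult_le_compat_l; lra.
Qed.

Definition circ (x : R2) (r phi : R) : R2 := (fst x + r * cos phi, snd x + r * sin phi).

Lemma dist2_circ x r phi : 0 <= r -> dist2 x (circ x r phi) = r.
Proof.
  intros Hr. unfold dist2, norm2, circ; simpl.
  replace (_ + _) with (r * r).
  - now apply sqrt_square.
  - generalize (sin2_cos2 phi). unfold Rsqr. intros H.
    transitivity (r * r * (sin phi * sin phi + cos phi * cos phi)); [rewrite H; ring | ring].
Qed.

Lemma pv_iff s f x L :
  pv_frac_integral s f x L <->
  exists G : R -> R,
    (forall r, 0 < r -> ex_RInt (fun phi => f x - f (circ x r phi)) 0 (2 * PI) /\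
       RInt (fun phi => f x - f (circ x r phi)) 0 (2 * PI) = G r) /\
    (forall eta, 0 < eta -> exists a0 b0, 0 < a0 /\
      forall a b, 0 < a -> a < a0 -> b0 < b ->
        ex_RInt (fun r => G r * kern s r) a b /\
        Rabs (RInt (fun r => G r * kern s r) a b - L) < eta).
Proof.
  split; intros [G [H1 H2]]; exists G; split.
  - intros r Hr. apply defs_is_RInt_iff. exact (H1 r Hr).
  - apply improper_iff. exact H2.
  - intros r Hr. apply defs_is_RInt_iff. exact (H1 r Hr).
  - apply improper_iff. exact H2.
Qed.

(** The principal value is monotone in the increments [f x - f y], so a bound of the form
    [Rmin A (B r)] integrates against the kernel to [Kc]. Two profiles are allowed because at a
    contact point the barrier and the penalty oscillate on different scales. *)
Lemma pv_compare2 s f g x L L' A B A' B' : 0 < s -> s < 1 / 2 ->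
  0 < A -> 0 < B -> 0 < A' -> 0 < B' ->
  pv_frac_integral s f x L -> pv_frac_integral s g x L' ->
  (forall y, (f x - f y) - (g x - g y) <=
     Rmin A (B * dist2 x y) + Rmin A' (B' * dist2 x y)) ->
  L - L' <= Kc s A B + Kc s A' B'.
Proof.
  intros Hs Hs' HA HB HA' HB' Hf Hg Hd.
  apply pv_iff in Hf. apply pv_iff in Hg.
  destruct Hf as [G [HG HI]]. destruct Hg as [G' [HG' HI']].
  apply le_epsilon. intros eps He.
  destruct (HI (eps / 2)) as (a0 & b0 & Ha0 & Hab); [lra|].
  destruct (HI' (eps / 2)) as (a1 & b1 & Ha1 & Hab'); [lra|].
  assert (Hq : 0 < A / B) by (apply Rdiv_lt_0_compat; auto).
  assert (Hq' : 0 < A' / B') by (apply Rdiv_lt_0_compat; auto).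
  set (a := Rmin (Rmin a0 a1) (Rmin (A / B) (A' / B')) / 2).
  set (b := Rmax (Rmax b0 b1) (Rmax (A / B) (A' / B')) + 1).
  pose proof (Rmin_l a0 a1). pose proof (Rmin_r a0 a1).
  pose proof (Rmin_l (A / B) (A' / B')). pose proof (Rmin_r (A / B) (A' / B')).
  pose proof (Rmin_l (Rmin a0 a1) (Rmin (A / B) (A' / B'))).
  pose proof (Rmin_r (Rmin a0 a1) (Rmin (A / B) (A' / B'))).
  pose proof (Rmax_l b0 b1). pose proof (Rmax_r b0 b1).
  pose proof (Rmax_l (A / B) (A' / B')). pose proof (Rmax_r (A / B) (A' / B')).
  pose proof (Rmax_l (Rmax b0 b1) (Rmax (A / B) (A' / B'))).
  pose proof (Rmax_r (Rmax b0 b1) (Rmax (A / B) (A' / B'))).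
  assert (0 < Rmin (Rmin a0 a1) (Rmin (A / B) (A' / B'))) by (repeat apply Rmin_pos; auto).
  assert (Ha : 0 < a) by (unfold a; lra).
  assert (a < a0 /\ a < a1 /\ a < A / B /\ a < A' / B') as (?&?&?&?) by (unfold a; lra).
  assert (b0 < b /\ b1 < b /\ A / B < b /\ A' / B' < b) as (?&?&?&?) by (unfold b; lra).
  destruct (Hab a b) as [E1 E2]; auto. destruct (Hab' a b) as [E3 E4]; auto.
  pose proof (RInt_min_kern s A B a b) as K1.
  pose proof (RInt_min_kern s A' B' a b) as K2.
  specialize (K1 Hs Hs' HA HB Ha ltac:(auto) ltac:(auto)).
  specialize (K2 Hs Hs' HA' HB' Ha ltac:(auto) ltac:(auto)).
  assert (Hb : 0 < b) by lra.
  assert (X1 : forall A B, ex_RInt (fun r => Rmin A (B * r) * kern s r) a b).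
  { intros; apply ex_RInt_pos; auto; intros; now apply Rmin_kern_continuous. }
  assert (Key : RInt (fun r => G r * kern s r) a b - RInt (fun r => G' r * kern s r) a b
      <= 2 * PI * RInt (fun r => Rmin A (B * r) * kern s r) a b
       + 2 * PI * RInt (fun r => Rmin A' (B' * r) * kern s r) a b).
  { destruct (RInt_minusR _ _ _ _ E1 E3) as [M1 M2]. rewrite <- M2.
    destruct (RInt_scalR _ (2 * PI) _ _ (X1 A B)) as [S1 S2]. rewrite <- S2.
    destruct (RInt_scalR _ (2 * PI) _ _ (X1 A' B')) as [S3 S4]. rewrite <- S4.
    destruct (RInt_plusR _ _ _ _ S1 S3) as [P1 P2]. rewrite <- P2.
    apply RInt_le; auto; try lra.
    intros r Hr.
    replace (G r * kern s r - G' r * kern s r) with ((G r - G' r) * kern s r) by ring.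
    replace (2 * PI * (Rmin A (B * r) * kern s r) + 2 * PI * (Rmin A' (B' * r) * kern s r))
      with (2 * PI * (Rmin A (B * r) + Rmin A' (B' * r)) * kern s r) by ring.
    apply Rmult_le_compat_r; [apply Rlt_le, kern_pos|].
    destruct (HG r) as [F1 F2]; [lra|]. destruct (HG' r) as [F3 F4]; [lra|].
    rewrite <- F2, <- F4.
    destruct (RInt_minusR _ _ _ _ F1 F3) as [N1 N2]. rewrite <- N2.
    replace (2 * PI * (Rmin A (B * r) + Rmin A' (B' * r)))
      with (RInt (fun _ => Rmin A (B * r) + Rmin A' (B' * r)) 0 (2 * PI))
      by (rewrite RInt_constR; eqR; ring).
    apply RInt_le; auto.
    - generalize PI_RGT_0; lra.
    - apply ex_RInt_const.
    - intros phi _.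
      specialize (Hd (circ x r phi)). rewrite dist2_circ in Hd by lra. lra. }
  apply Rabs_def2 in E2. apply Rabs_def2 in E4. lra.
Qed.

Lemma Kc_pos s A B : 0 < s -> s < 1 / 2 -> 0 < A -> 0 < B -> 0 < Kc s A B.
Proof.
  intros. unfold Kc. pose proof PI_RGT_0.
  assert (0 < / (1 - 2 * s)) by (apply Rinv_0_lt_compat; lra).
  assert (0 < / (2 * s)) by (apply Rinv_0_lt_compat; lra).
  assert (0 < Rpower (B / A) (2 * s)) by apply exp_pos.
  apply Rmult_lt_0_compat; [lra|]. apply Rmult_lt_0_compat; [|lra].
  now apply Rmult_lt_0_compat.
Qed.

Lemma Kc_diag s A : 0 < A -> Kc s A A = A * Kc s 1 1.
Proof.
  intros. unfold Kc. replace (A / A) with (1 / 1) by (field; lra). ring.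
Qed.

Lemma Kc_small s eps : 0 < s -> s < 1 / 2 -> 0 < eps -> exists e, 0 < e /\ Kc s e e < eps.
Proof.
  intros. pose proof (Kc_pos s 1 1 ltac:(auto) ltac:(auto) Rlt_0_1 Rlt_0_1).
  exists (eps / Kc s 1 1 / 2). assert (0 < eps / Kc s 1 1) by (apply Rdiv_lt_0_compat; auto).
  split; [lra|]. rewrite Kc_diag by lra.
  replace (eps / Kc s 1 1 / 2 * Kc s 1 1) with (eps / 2) by (field; lra). lra.
Qed.

Lemma dist2_nonneg x y : 0 <= dist2 x y.
Proof. apply sqrt_pos. Qed.

(** A second profile of arbitrarily small cost fills the slot left free in [pv_compare2]. *)
Lemma pv_compare s f g x L L' A B : 0 < s -> s < 1 / 2 -> 0 < A -> 0 < B ->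
  pv_frac_integral s f x L -> pv_frac_integral s g x L' ->
  (forall y, (f x - f y) - (g x - g y) <= Rmin A (B * dist2 x y)) ->
  L - L' <= Kc s A B.
Proof.
  intros Hs Hs' HA HB Hf Hg Hd. apply le_epsilon. intros eps He.
  destruct (Kc_small s eps Hs Hs' He) as (e & He' & HK).
  apply Rle_trans with (Kc s A B + Kc s e e); [|lra].
  apply (pv_compare2 s f g x); auto. intros y.
  assert (0 <= Rmin e (e * dist2 x y)).
  { apply Rmin_glb; [lra|]. apply Rmult_le_pos; [lra|apply dist2_nonneg]. }
  specialize (Hd y). lra.
Qed.

Lemma pv_lin s f g x L L' lam :
  pv_frac_integral s f x L -> pv_frac_integral s g x L' ->
  pv_frac_integral s (fun y => f y + lam * g y) x (L + lam * L').
Proof.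
  intros Hf Hg. apply pv_iff in Hf. apply pv_iff in Hg. apply pv_iff.
  destruct Hf as [G [HG HI]]. destruct Hg as [G' [HG' HI']].
  exists (fun r => G r + lam * G' r). split.
  - intros r Hr. destruct (HG r Hr) as [E1 E2]. destruct (HG' r Hr) as [E3 E4].
    assert (RInt.is_RInt (fun phi => f x + lam * g x
       - (f (circ x r phi) + lam * g (circ x r phi))) 0 (2 * PI) (G r + lam * G' r)).
    { apply (is_RInt_ext (fun phi => f x - f (circ x r phi)
                + lam * (g x - g (circ x r phi)))).
      { intros; eqR; ring. }
      destruct (RInt_scalR _ lam _ _ E3) as [S1 S2].
      destruct (RInt_plusR _ _ _ _ E1 S1) as [P1 P2].
      rewrite <- E2, <- E4, <- S2, <- P2. now apply (RInt_correct (V := R_CompleteNormedModule)). }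
    split; [eexists; eassumption | now apply is_RInt_unique].
  - intros eta He.
    destruct (HI (eta / 2)) as (a0 & b0 & Ha0 & Hab); [lra|].
    set (l := Rabs lam + 1). assert (Hl : 0 < l) by (unfold l; generalize (Rabs_pos lam); lra).
    destruct (HI' (eta / 2 / l)) as (a1 & b1 & Ha1 & Hab').
    { apply Rdiv_lt_0_compat; lra. }
    exists (Rmin a0 a1), (Rmax b0 b1). split; [now apply Rmin_pos|].
    intros a b H1 H2 H3.
    pose proof (Rmin_l a0 a1). pose proof (Rmin_r a0 a1).
    pose proof (Rmax_l b0 b1). pose proof (Rmax_r b0 b1).
    destruct (Hab a b) as [E1 E2]; try lra. destruct (Hab' a b) as [E3 E4]; try lra.
    assert (HH : RInt.is_RInt (fun r => (G r + lam * G' r) * kern s r) a b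
       (RInt (fun r => G r * kern s r) a b + lam * RInt (fun r => G' r * kern s r) a b)).
    { apply (is_RInt_ext (fun r => G r * kern s r + lam * (G' r * kern s r))).
      { intros; eqR; ring. }
      destruct (RInt_scalR _ lam _ _ E3) as [S1 S2].
      destruct (RInt_plusR _ _ _ _ E1 S1) as [P1 P2].
      rewrite <- S2, <- P2. now apply (RInt_correct (V := R_CompleteNormedModule)). }
    split; [eexists; exact HH|]. rewrite (is_RInt_unique _ _ _ _ HH).
    replace (_ - _) with ((RInt (fun r => G r * kern s r) a b - L)
       + lam * (RInt (fun r => G' r * kern s r) a b - L')) by ring.
    apply Rle_lt_trans with (1 := Rabs_triang _ _). rewrite Rabs_mult.
    assert (Rabs lam * Rabs (RInt (fun r => G' r * kern s r) a b - L') <= l * (eta / 2 / l)).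
    { apply Rmult_le_compat; try apply Rabs_pos; unfold l in *; lra. }
    replace (l * (eta / 2 / l)) with (eta / 2) in H6 by (field; lra). lra.
Qed.

Lemma pv_ext s f g x L : (forall y, f y = g y) ->
  pv_frac_integral s f x L -> pv_frac_integral s g x L.
Proof.
  intros E Hf. apply pv_iff in Hf. apply pv_iff. destruct Hf as [G [H1 H2]].
  exists G. split; auto. intros r Hr. destruct (H1 r Hr) as [E1 E2]. split.
  - revert E1. apply ex_RInt_ext. intros; now rewrite !E.
  - rewrite <- E2. apply RInt_ext. intros; now rewrite !E.
Qed.

Lemma dist2_circ_radius x r r' phi : dist2 (circ x r phi) (circ x r' phi) = Rabs (r - r').
Proof.
  unfold dist2, norm2, circ; simpl. rewrite <- sqrt_Rsqr_abs. f_equal. unfold Rsqr.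
  generalize (sin2_cos2 phi). unfold Rsqr. intros H.
  transitivity ((r - r') * (r - r') * (sin phi * sin phi + cos phi * cos phi));
    [ring | rewrite H; ring].
Qed.

(** Bounding the cosine and sine increments separately by the angle gives [sqrt 2]; the constant 2
    avoids the root. *)
Lemma dist2_circ_angle x r phi phi' : 0 <= r ->
  dist2 (circ x r phi) (circ x r phi') <= 2 * r * Rabs (phi - phi').
Proof.
  intros Hr. unfold dist2, norm2, circ; simpl.
  assert (Hc : Rabs (cos phi - cos phi') <= Rabs (phi - phi')).
  { destruct (MVT_abs cos (fun z => - sin z) phi' phi) as [c [E _]].
    { intros; apply derivable_pt_lim_cos. }
    rewrite E, Rabs_Ropp.
    rewrite <- (Rmult_1_l (Rabs (phi - phi'))) at 2.
    apply Rmult_le_compat_r; [apply Rabs_pos|]. apply Rabs_le, SIN_bound. }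
  assert (Hn : Rabs (sin phi - sin phi') <= Rabs (phi - phi')).
  { destruct (MVT_abs sin cos phi' phi) as [c [E _]].
    { intros; apply derivable_pt_lim_sin. }
    rewrite E.
    rewrite <- (Rmult_1_l (Rabs (phi - phi'))) at 2.
    apply Rmult_le_compat_r; [apply Rabs_pos|]. apply Rabs_le, COS_bound. }
  apply Rsqr_incr_0_var.
  2: { apply Rmult_le_pos; [lra|apply Rabs_pos]. }
  rewrite Rsqr_sqrt. 2: apply Rplus_le_le_0_compat; apply pow2_ge_0.
  apply Rsqr_le_abs_1 in Hc. apply Rsqr_le_abs_1 in Hn.
  unfold Rsqr in *.
  assert (E : Rabs (phi - phi') * Rabs (phi - phi') = (phi - phi') * (phi - phi'))
    by (rewrite <- Rabs_mult; apply Rabs_pos_eq, Rle_0_sqr).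
  replace (2 * r * Rabs (phi - phi') * (2 * r * Rabs (phi - phi')))
    with (4 * r * r * (Rabs (phi - phi') * Rabs (phi - phi'))) by ring. rewrite E.
  replace (_ + _) with (r * r * ((cos phi - cos phi') * (cos phi - cos phi'))
     + r * r * ((sin phi - sin phi') * (sin phi - sin phi'))) by ring.
  nra.
Qed.

Lemma lip_continuous (f : R -> R) (K x : R) :
  (forall y, Rabs (f y - f x) <= K * Rabs (y - x)) -> continuous f x.
Proof.
  intros H. apply continuity_pt_filterlim. intros eps He.
  (* The [+ 1] keeps the divisor positive whatever [K] is; the same device recurs below. *)
  set (k := Rabs K + 1). assert (0 < k) by (unfold k; generalize (Rabs_pos K); lra).
  exists (eps / k). split; [apply Rdiv_lt_0_compat; lra|].
  intros y [_ Hy]. simpl in *. unfold R_dist in *.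
  apply Rle_lt_trans with (1 := H y).
  apply Rle_lt_trans with (k * Rabs (y - x)).
  - apply Rmult_le_compat_r; [apply Rabs_pos|]. unfold k. generalize (Rle_abs K); lra.
  - apply Rmult_lt_compat_l with (r := k) in Hy; auto.
    replace (k * (eps / k)) with eps in Hy by (field; lra). exact Hy.
Qed.

(** * Existence of the principal value for bounded Lipschitz functions *)

Section PVExists.
Variables (s A B : R) (f : R2 -> R) (x : R2).
Hypotheses (Hs : 0 < s) (Hs' : s < 1 / 2).
Hypothesis HA : forall y, Rabs (f x - f y) <= A.
Hypothesis HB : forall y z, Rabs (f y - f z) <= B * dist2 y z.

Let G r : R := RInt (fun phi => f x - f (circ x r phi)) 0 (2 * PI).

Lemma lip_const_nonneg : 0 <= B.
Proof.
  specialize (HB (0, 0) (circ (0, 0) 1 0)). rewrite dist2_circ in HB by lra.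
  generalize (Rabs_pos (f (0, 0) - f (circ (0, 0) 1 0))). lra.
Qed.

Lemma circ_integrable r : 0 <= r -> ex_RInt (fun phi => f x - f (circ x r phi)) 0 (2 * PI).
Proof.
  intros Hr. apply (ex_RInt_continuous (fun phi => f x - f (circ x r phi))).
  intros phi _. apply lip_continuous with (B * (2 * r)). intros phi'.
  replace (_ - _) with (f (circ x r phi) - f (circ x r phi')) by ring.
  apply Rle_trans with (1 := HB _ _).
  rewrite (Rabs_minus_sym phi' phi), Rmult_assoc.
  apply Rmult_le_compat_l; [apply lip_const_nonneg|]. now apply dist2_circ_angle.
Qed.

Lemma circ_bound r : 0 < r -> Rabs (G r) <= 2 * PI * A /\ Rabs (G r) <= 2 * PI * (B * r).
Proof.
  intros Hr.
  assert (H0 : 0 <= 2 * PI) by (generalize PI_RGT_0; lra).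
  assert (E : forall c, (2 * PI) * c = (2 * PI - 0) * c) by (intros; ring).
  split; rewrite E; apply abs_RInt_le_const; auto using circ_integrable, Rlt_le.
  intros phi _. apply Rle_trans with (1 := HB _ _). right. now rewrite dist2_circ by lra.
Qed.

Lemma circ_continuous r : 0 < r -> continuous (fun r => G r * kern s r) r.
Proof.
  intros Hr. apply (continuous_mult G (kern s)).
  2: now apply Rpower_continuous.
  (* [G] is controlled for nonnegative radii only. [G (Rmax r 0)] is Lipschitz on the whole line and
     agrees with [G] near a positive radius. *)
  apply continuity_pt_filterlim. apply continuity_pt_locally_ext with
    (f := fun r => G (Rmax r 0)) (a := r); auto.
  { intros y Hy. unfold R_dist in Hy. rewrite Rmax_left; auto.
    apply Rabs_def2 in Hy. lra. }
  apply continuity_pt_filterlim.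
  apply (lip_continuous (fun r => G (Rmax r 0)) (2 * PI * B)). intros y.
  unfold G.
  destruct (RInt_minusR _ _ _ _ (circ_integrable (Rmax y 0) (Rmax_r _ _))
    (circ_integrable (Rmax r 0) (Rmax_r _ _))) as [E1 E2].
  rewrite <- E2.
  replace (2 * PI * B * Rabs (y - r)) with ((2 * PI - 0) * (B * Rabs (y - r))) by ring.
  apply abs_RInt_le_const; auto.
  { generalize PI_RGT_0; lra. }
  intros phi _.
  replace (_ - _) with (f (circ x (Rmax r 0) phi) - f (circ x (Rmax y 0) phi)) by ring.
  apply Rle_trans with (1 := HB _ _). rewrite dist2_circ_radius.
  apply Rmult_le_compat_l; [apply lip_const_nonneg|].
  unfold Rmax. repeat destruct Rle_dec; unfold Rabs; repeat destruct Rcase_abs; lra.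
Qed.

Let F r := G r * kern s r.

Lemma circ_ex a b : 0 < a -> 0 < b -> ex_RInt F a b.
Proof. intros; apply ex_RInt_pos; auto. exact circ_continuous. Qed.

Lemma Rpower_small e eps : 0 < e -> 0 < eps ->
  exists d, 0 < d /\ forall r, 0 < r -> r < d -> Rpower r e < eps.
Proof.
  intros He Heps. exists (Rpower eps (/ e)). split; [apply exp_pos|].
  intros r Hr H.
  replace eps with (Rpower (Rpower eps (/ e)) e).
  - apply Rlt_Rpower_l; auto.
  - rewrite Rpower_mult. replace (/ e * e) with 1 by (field; lra). now apply Rpower_1.
Qed.

Lemma Rpower_inv_base r e : 0 < r -> Rpower r (- e) = Rpower (/ r) e.
Proof. intros. unfold Rpower. rewrite ln_Rinv by auto. f_equal. ring. Qed.

(** The Lipschitz bound turns the integrand into a multiple of [r^(-2s)], integrable at 0 because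
    [s < 1/2]. *)
Lemma circ_tail0 eps : 0 < eps -> exists d, 0 < d /\
  forall a b, 0 < a -> 0 < b -> a < d -> b < d -> Rabs (RInt F a b) < eps.
Proof.
  intros He. pose proof lip_const_nonneg. pose proof PI_RGT_0 as HPI.
  set (k := 2 * PI * B / (1 - 2 * s) + 1).
  assert (Hk : 0 < k).
  { unfold k. assert (0 <= 2 * PI * B / (1 - 2 * s)); [|lra].
    apply Rmult_le_pos; [nra|]. apply Rlt_le, Rinv_0_lt_compat; lra. }
  destruct (Rpower_small (1 - 2 * s) (eps / k)) as (d & Hd & Hsm); [lra| |].
  { apply Rdiv_lt_0_compat; auto. }
  exists d. split; auto.
  assert (Main : forall a b, 0 < a -> a <= b -> b < d -> Rabs (RInt F a b) < eps).
  { intros a b Ha Hab Hb.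
    pose proof (RInt_power (1 - 2 * s) a b ltac:(lra) Ha Hab) as HI.
    apply (is_RInt_scal (V := R_NormedModule) _ _ _ (2 * PI * B)) in HI.
    apply Rle_lt_trans with (RInt (fun r => 2 * PI * B * Rpower r (1 - 2 * s - 1)) a b).
    - apply Rle_trans with (1 := abs_RInt_le F a b Hab (circ_ex a b Ha ltac:(lra))).
      apply RInt_le; auto.
      + apply ex_RInt_norm. apply circ_ex; lra.
      + eexists; exact HI.
      + intros r Hr. unfold F. rewrite Rabs_mult, (Rabs_pos_eq (kern s r)) by apply Rlt_le, kern_pos.
        replace (1 - 2 * s - 1) with (- (2 * s)) by ring. rewrite <- kern_mult by lra.
        rewrite <- Rmult_assoc. apply Rmult_le_compat_r; [apply Rlt_le, kern_pos|].
        replace (2 * PI * B * r) with (2 * PI * (B * r)) by ring. apply circ_bound; lra.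
    - eapply Rle_lt_trans; [right; exact (is_RInt_unique _ _ _ _ HI)|].
      unfold scal; simpl; unfold mult; simpl.
      apply Rle_lt_trans with (k * Rpower b (1 - 2 * s)).
      2: { replace eps with (k * (eps / k)) by (field; lra).
           apply Rmult_lt_compat_l; auto. apply Hsm; lra. }
      assert (0 < Rpower a (1 - 2 * s)) by apply exp_pos.
      assert (0 < Rpower b (1 - 2 * s)) by apply exp_pos.
      replace (2 * PI * B * ((Rpower b (1 - 2 * s) - Rpower a (1 - 2 * s)) / (1 - 2 * s)))
        with (2 * PI * B / (1 - 2 * s) * (Rpower b (1 - 2 * s) - Rpower a (1 - 2 * s)))
        by (field; lra).
      assert (Hk1 : 0 <= 2 * PI * B / (1 - 2 * s)).
      { apply Rmult_le_pos; [nra|]. apply Rlt_le, Rinv_0_lt_compat; lra. }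
      unfold k. nra. }
  intros a b Ha Hb Had Hbd. destruct (Rle_dec a b).
  - now apply Main.
  - rewrite <- opp_RInt_swap by (apply circ_ex; auto).
    unfold opp; simpl. rewrite Rabs_Ropp. apply Main; lra.
Qed.

(** Far away the bound [A] on the increments leaves a multiple of [r^(-1 - 2s)], integrable at
    infinity because [s > 0]. *)
Lemma circ_tailinf eps : 0 < eps -> exists d, 0 < d /\
  forall a b, d < a -> d < b -> Rabs (RInt F a b) < eps.
Proof.
  intros He. pose proof PI_RGT_0 as HPI.
  assert (HA0 : 0 <= A) by (apply Rle_trans with (2 := HA x); apply Rabs_pos).
  set (k := 2 * PI * A / (2 * s) + 1).
  assert (Hk1 : 0 <= 2 * PI * A / (2 * s)).
  { apply Rmult_le_pos; [nra|]. apply Rlt_le, Rinv_0_lt_compat; lra. }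
  assert (Hk : 0 < k) by (unfold k; lra).
  destruct (Rpower_small (2 * s) (eps / k)) as (d & Hd & Hsm); [lra| |].
  { apply Rdiv_lt_0_compat; auto. }
  exists (/ d). pose proof (Rinv_0_lt_compat d Hd). split; auto.
  assert (Main : forall a b, / d < a -> a <= b -> Rabs (RInt F a b) < eps).
  { intros a b Ha Hab. assert (Ha0 : 0 < a) by lra.
    pose proof (RInt_power (- (2 * s)) a b ltac:(lra) Ha0 Hab) as HI.
    apply (is_RInt_scal (V := R_NormedModule) _ _ _ (2 * PI * A)) in HI.
    apply Rle_lt_trans with (RInt (fun r => 2 * PI * A * Rpower r (- (2 * s) - 1)) a b).
    - apply Rle_trans with (1 := abs_RInt_le F a b Hab (circ_ex a b Ha0 ltac:(lra))).
      apply RInt_le; auto.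
      + apply ex_RInt_norm. apply circ_ex; lra.
      + eexists; exact HI.
      + intros r Hr. unfold F. rewrite Rabs_mult, (Rabs_pos_eq (kern s r)) by apply Rlt_le, kern_pos.
        replace (- (2 * s) - 1) with (- 1 - 2 * s) by ring. fold (kern s r).
        apply Rmult_le_compat_r; [apply Rlt_le, kern_pos|]. apply circ_bound; lra.
    - eapply Rle_lt_trans; [right; exact (is_RInt_unique _ _ _ _ HI)|].
      unfold scal; simpl; unfold mult; simpl.
      apply Rle_lt_trans with (k * Rpower a (- (2 * s))).
      2: { replace eps with (k * (eps / k)) by (field; lra).
           apply Rmult_lt_compat_l; auto. rewrite Rpower_inv_base by auto. apply Hsm.
           - now apply Rinv_0_lt_compat.
           - rewrite <- (Rinv_inv d). apply Rinv_lt_contravar; auto. nra. }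
      assert (0 < Rpower a (- (2 * s))) by apply exp_pos.
      assert (0 < Rpower b (- (2 * s))) by apply exp_pos.
      replace (2 * PI * A * ((Rpower b (- (2 * s)) - Rpower a (- (2 * s))) / - (2 * s)))
        with (2 * PI * A / (2 * s) * (Rpower a (- (2 * s)) - Rpower b (- (2 * s))))
        by (field; lra).
      unfold k. nra. }
  intros a b Ha Hb. destruct (Rle_dec a b).
  - now apply Main.
  - rewrite <- opp_RInt_swap by (apply circ_ex; lra).
    unfold opp; simpl. rewrite Rabs_Ropp. apply Main; lra.
Qed.

(** Both ends satisfy the Cauchy criterion by the two tail estimates; the integral is split at
    [r = 1] so that the limits are taken independently. *)
Lemma pv_exists : exists L, pv_frac_integral s f x L.
Proof.
  assert (Hpq : forall p q : R, p + q + - q = p) by (intros; ring).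
  assert (Hpq' : forall p q : R, p + q + - p = q) by (intros; ring).
  assert (I0 : exists l, filterlim (fun a => RInt F a 1) (at_right 0) (locally l)).
  { apply (filterlim_locally_cauchy (U := R_CompleteSpace) (F := at_right 0)). intros eps.
    destruct (circ_tail0 eps (cond_pos eps)) as (d & Hd & H).
    exists (fun a => 0 < a /\ a < d). split.
    - exists (mkposreal d Hd). intros y Hy H0. split; auto.
      unfold ball in Hy; simpl in Hy; unfold AbsRing_ball, abs, minus, plus, opp in Hy; simpl in Hy.
      apply Rabs_def2 in Hy. lra.
    - intros u v [Hu Hu'] [Hv Hv']. unfold ball; simpl; unfold AbsRing_ball, abs, minus, plus, opp; simpl.
      assert (E : RInt F v u + RInt F u 1 = RInt F v 1).
      { apply (RInt_Chasles (V := R_CompleteNormedModule)); apply circ_ex; lra. }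
      rewrite <- E. rewrite (Hpq (RInt F v u)). apply H; auto. }
  assert (I1 : exists l, filterlim (fun b => RInt F 1 b) (Rbar_locally p_infty) (locally l)).
  { apply (filterlim_locally_cauchy (U := R_CompleteSpace) (F := Rbar_locally p_infty)). intros eps.
    destruct (circ_tailinf eps (cond_pos eps)) as (d & Hd & H).
    exists (fun a => d < a). split.
    - exists d. auto.
    - intros u v Hu Hv. unfold ball; simpl; unfold AbsRing_ball, abs, minus, plus, opp; simpl.
      assert (E : RInt F 1 u + RInt F u v = RInt F 1 v).
      { apply (RInt_Chasles (V := R_CompleteNormedModule)); apply circ_ex; lra. }
      rewrite <- E. rewrite (Hpq' (RInt F 1 u)). apply H; auto. }
  destruct I0 as [l0 H0]. destruct I1 as [l1 H1].
  exists (l0 + l1). apply pv_iff. exists G. split.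
  { intros r Hr. split; auto. apply circ_integrable; lra. }
  intros eta He.
  assert (He2 : 0 < eta / 2) by lra.
  pose proof (proj1 (filterlim_locally (U := R_UniformSpace) (F := at_right 0) _ l0) H0) as H0'.
  clear H0; rename H0' into H0.
  specialize (H0 (mkposreal _ He2)). destruct H0 as [d Hd].
  pose proof (proj1 (filterlim_locally (U := R_UniformSpace) (F := Rbar_locally p_infty) _ l1) H1) as H1'.
  specialize (H1' (mkposreal _ He2)). clear H1; rename H1' into H1.
  destruct H1 as [m Hm].
  exists (pos d), (Rmax m 0). split; [apply cond_pos|].
  intros a b Ha Hb Hb'. pose proof (Rmax_l m 0). pose proof (Rmax_r m 0).
  split; [apply circ_ex; lra|].
  fold F. change (fun r : R => G r * kern s r) with F.
  assert (E : RInt F a 1 + RInt F 1 b = RInt F a b).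
  { apply (RInt_Chasles (V := R_CompleteNormedModule)); apply circ_ex; lra. }
  rewrite <- E.
  assert (X0 : Rabs (RInt F a 1 - l0) < eta / 2).
  { apply Hd; auto. unfold ball; simpl; unfold AbsRing_ball, abs, minus, plus, opp; simpl.
    rewrite Rabs_pos_eq; lra. }
  assert (X1 : Rabs (RInt F 1 b - l1) < eta / 2) by (apply Hm; lra).
  replace (_ - _) with ((RInt F a 1 - l0) + (RInt F 1 b - l1)) by ring.
  apply Rle_lt_trans with (1 := Rabs_triang _ _). lra.
Qed.

End PVExists.

(** * Comparison principle *)

(** Increments are measured coordinate by coordinate, which is the shape of the neighbourhoods in
    [compactness_value]. *)
Definition cont3 (S : R) (f : R -> R2 -> R) : Prop :=
  forall t x, 0 <= t <= S -> forall eps, 0 < eps -> exists delta, 0 < delta /\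
    forall t' x', 0 <= t' <= S -> Rabs (t' - t) < delta ->
      Rabs (fst x' - fst x) < delta -> Rabs (snd x' - snd x) < delta ->
      Rabs (f t' x' - f t x) < eps.

Lemma cont3_plus S f g : cont3 S f -> cont3 S g -> cont3 S (fun t x => f t x + g t x).
Proof.
  intros Hf Hg t x Ht eps He.
  destruct (Hf t x Ht (eps / 2)) as (d1 & Hd1 & H1); [lra|].
  destruct (Hg t x Ht (eps / 2)) as (d2 & Hd2 & H2); [lra|].
  exists (Rmin d1 d2). split; [now apply Rmin_pos|].
  intros t' x' Ht' Ha Hb Hc.
  pose proof (Rmin_l d1 d2). pose proof (Rmin_r d1 d2).
  specialize (H1 t' x' Ht' ltac:(lra) ltac:(lra) ltac:(lra)).
  specialize (H2 t' x' Ht' ltac:(lra) ltac:(lra) ltac:(lra)).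
  replace (_ - _) with ((f t' x' - f t x) + (g t' x' - g t x)) by ring.
  apply Rle_lt_trans with (1 := Rabs_triang _ _). lra.
Qed.

Lemma cont3_opp S f : cont3 S f -> cont3 S (fun t x => - f t x).
Proof.
  intros Hf t x Ht eps He. destruct (Hf t x Ht eps He) as (d & Hd & H).
  exists d. split; auto. intros t' x' H1 H2 H3 H4.
  replace (- f t' x' - - f t x) with (- (f t' x' - f t x)) by ring.
  rewrite Rabs_Ropp. auto.
Qed.

Lemma cont3_lip S f K :
  (forall t x t' x', 0 <= t <= S -> 0 <= t' <= S ->
    Rabs (f t' x' - f t x) <= K * (Rabs (t' - t) + Rabs (fst x' - fst x) + Rabs (snd x' - snd x))) ->
  cont3 S f.
Proof.
  intros H t x Ht eps He. set (k := Rabs K + 1).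
  assert (Hk : 0 < k) by (unfold k; generalize (Rabs_pos K); lra).
  assert (0 < eps / (3 * k)) by (apply Rdiv_lt_0_compat; lra).
  exists (eps / (3 * k)). split; auto. intros t' x' Ht' H1 H2 H3.
  apply Rle_lt_trans with (1 := H t x t' x' Ht Ht').
  set (A := Rabs (t' - t) + Rabs (fst x' - fst x) + Rabs (snd x' - snd x)).
  assert (HA : A < eps / k).
  { unfold A. replace (eps / k) with (3 * (eps / (3 * k))) by (field; lra). lra. }
  assert (0 <= A).
  { unfold A. repeat apply Rplus_le_le_0_compat; apply Rabs_pos. }
  apply Rle_lt_trans with (k * A).
  - apply Rmult_le_compat_r; auto. unfold k. generalize (Rle_abs K); lra.
  - replace eps with (k * (eps / k)) by (field; lra). now apply Rmult_lt_compat_l.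
Qed.

(** Extreme values by contradiction: if the infimum [- l] is not attained, every point has a
    neighbourhood on which [f] exceeds [- l] by a definite amount, and compactness makes the excess
    uniform. *)
Lemma box_min (S Q m : R) (f : R -> R2 -> R) : 0 <= S -> 0 <= Q -> cont3 S f ->
  (forall t x, 0 <= t <= S -> m <= f t x) ->
  exists t x, 0 <= t <= S /\ - Q <= fst x <= Q /\ - Q <= snd x <= Q /\
    forall t' x', 0 <= t' <= S -> - Q <= fst x' <= Q -> - Q <= snd x' <= Q ->
      f t x <= f t' x'.
Proof.
  intros HS HQ Hc Hm.
  set (E := fun v => exists t x, 0 <= t <= S /\ - Q <= fst x <= Q /\ - Q <= snd x <= Q /\ v = - f t x).
  destruct (completeness E) as [l [Hub Hlub]].
  { exists (- m). intros v (t & x & H1 & _ & _ & ->). specialize (Hm t x H1). lra. }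
  { exists (- f 0 (0, 0)), 0, (0, 0). simpl. repeat split; lra. }
  apply NNPP. intros Hno.
  assert (Hlt : forall t x, 0 <= t <= S -> - Q <= fst x <= Q -> - Q <= snd x <= Q -> - l < f t x).
  { intros t x H1 H2 H3. apply Rnot_le_lt. intros Hle. apply Hno. exists t, x.
    repeat split; try tauto. intros t' x' H1' H2' H3'.
    assert (- f t' x' <= l); [|lra]. apply Hub. exists t', x'. tauto. }
  (* The number [d] is both the radius of the neighbourhood and the excess over [- l], so a uniform
     lower bound on this gauge bounds [f] away from the infimum. *)
  assert (Hex : forall p : R * (R * (R * unit)), exists d : posreal,
    let '(t, (x1, (x2, _))) := p in
    0 <= t <= S -> - Q <= x1 <= Q -> - Q <= x2 <= Q ->
    forall t' x', 0 <= t' <= S -> Rabs (t' - t) < d ->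
      Rabs (fst x' - x1) < d -> Rabs (snd x' - x2) < d -> - l + d <= f t' x').
  { intros (t & x1 & x2 & []).
    destruct (classic (0 <= t <= S /\ - Q <= x1 <= Q /\ - Q <= x2 <= Q)) as [(H1 & H2 & H3)|Hn].
    - specialize (Hlt t (x1, x2) H1 H2 H3).
      destruct (Hc t (x1, x2) H1 ((f t (x1, x2) + l) / 2)) as (d & Hd & H); [lra|].
      assert (Hd' : 0 < Rmin d ((f t (x1, x2) + l) / 2)) by (apply Rmin_pos; lra).
      exists (mkposreal _ Hd'). simpl. intros _ _ _ t' x' Ht' A1 A2 A3.
      pose proof (Rmin_l d ((f t (x1, x2) + l) / 2)).
      pose proof (Rmin_r d ((f t (x1, x2) + l) / 2)).
      specialize (H t' x' Ht' ltac:(lra) ltac:(simpl; lra) ltac:(simpl; lra)).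
      apply Rabs_def2 in H. lra.
    - exists (mkposreal 1 Rlt_0_1). intros; exfalso; tauto. }
  set (delta := fun p => proj1_sig (constructive_indefinite_description _ (Hex p))).
  destruct (compactness_value 3 (0, (- Q, (- Q, tt))) (S, (Q, (Q, tt))) delta) as [d Hd].
  assert (Hall : forall t x, 0 <= t <= S -> - Q <= fst x <= Q -> - Q <= snd x <= Q -> - l + d <= f t x).
  { intros t x H1 H2 H3.
    apply NNPP. intros Hn.
    apply (Hd (t, (fst x, (snd x, tt)))).
    { simpl. tauto. }
    intros ((t0 & x1 & x2 & []) & B1 & B2 & B3). apply Hn.
    unfold delta in B2, B3.
    destruct constructive_indefinite_description as [d' Hd']; simpl in *.
    destruct B1 as (?&?&?&_). destruct B2 as (?&?&?&_).
    specialize (Hd' ltac:(auto) ltac:(auto) ltac:(auto) t x ltac:(auto) ltac:(auto) ltac:(auto) ltac:(auto)).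
    lra. }
  assert (l <= l - d).
  { apply Hlub. intros v (t & x & H1 & H2 & H3 & ->). specialize (Hall t x H1 H2 H3). lra. }
  generalize (cond_pos d); lra.
Qed.

(** Only earlier times are compared: the minimum may be attained at the final time. *)
Lemma deriv_nonpos_of_left_min (f : R -> R) (t l : R) : 0 < t ->
  (forall t', 0 <= t' <= t -> f t <= f t') -> derivable_pt_lim f t l -> l <= 0.
Proof.
  intros Ht Hmin Hd. apply Rnot_lt_le. intros Hl.
  destruct (Hd (l / 2)) as [d H]; [lra|].
  pose proof (cond_pos d).
  set (h := - (Rmin t d / 2)).
  pose proof (Rmin_l t d). pose proof (Rmin_r t d).
  assert (0 < Rmin t d) by (apply Rmin_pos; auto).
  assert (Hh : h < 0) by (unfold h; lra).
  specialize (H h ltac:(lra)).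
  rewrite (Rabs_left h) in H by auto. specialize (H ltac:(unfold h; lra)).
  specialize (Hmin (t + h) ltac:(unfold h; lra)).
  apply Rabs_def2 in H.
  assert ((f (t + h) - f t) / h <= 0); [|lra].
  assert (/ h < 0) by now apply Rinv_lt_0_compat. unfold Rdiv. nra.
Qed.

Lemma deriv_zero_of_min (f : R -> R) (r l : R) : 0 < r ->
  (forall h, - r < h < r -> f 0 <= f h) -> derivable_pt_lim f 0 l -> l = 0.
Proof.
  intros Hr Hmin Hd.
  assert (H1 : forall g m, (forall h, - r < h < r -> g 0 <= g h) ->
     derivable_pt_lim g 0 m -> 0 <= m).
  { intros g m Hg Hm. apply Rnot_lt_le. intros Hl.
    destruct (Hm (- m / 2)) as [d H]; [lra|].
    pose proof (cond_pos d).
    set (h := Rmin r d / 2).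
    pose proof (Rmin_l r d). pose proof (Rmin_r r d).
    assert (0 < Rmin r d) by (apply Rmin_pos; auto).
    assert (Hh : 0 < h) by (unfold h; lra).
    specialize (H h ltac:(lra)).
    rewrite (Rabs_pos_eq h) in H by lra. specialize (H ltac:(unfold h; lra)).
    specialize (Hg h ltac:(unfold h; lra)).
    apply Rabs_def2 in H. rewrite Rplus_0_l in H.
    assert (0 <= (g h - g 0) / h); [|lra].
    apply Rmult_le_pos; [lra|]. apply Rlt_le, Rinv_0_lt_compat; auto. }
  apply Rle_antisym; [|now apply (H1 f)].
  assert (0 <= - l); [|lra].
  apply (H1 (fun h => f (- h))).
  - intros h Hh. rewrite Ropp_0. apply Hmin. lra.
  - replace (- l) with (l * -1) by ring.
    apply (derivable_pt_lim_comp Ropp f).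
    + apply is_derive_Reals. auto_derive; auto.
    + now rewrite Ropp_0.
Qed.

(* Bounded penalty localising a minimum; its gradient and its nonlocal term vanish with [e]. *)
Definition pen (e : R) (x : R2) : R := 1 - / (1 + e ^ 2 * (fst x ^ 2 + snd x ^ 2)).

Lemma pen_den e x : 1 <= 1 + e ^ 2 * (fst x ^ 2 + snd x ^ 2).
Proof.
  assert (0 <= e ^ 2 * (fst x ^ 2 + snd x ^ 2)); [|lra].
  apply Rmult_le_pos; [apply pow2_ge_0|]. apply Rplus_le_le_0_compat; apply pow2_ge_0.
Qed.

Lemma pen_bounds e x : 0 <= pen e x <= 1.
Proof.
  unfold pen. pose proof (pen_den e x).
  assert (0 < / (1 + e ^ 2 * (fst x ^ 2 + snd x ^ 2))) by (apply Rinv_0_lt_compat; lra).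
  assert (/ (1 + e ^ 2 * (fst x ^ 2 + snd x ^ 2)) <= / 1) by (apply Rinv_le_contravar; lra).
  rewrite Rinv_1 in H1. lra.
Qed.

Lemma pen_le e x : pen e x <= e ^ 2 * (fst x ^ 2 + snd x ^ 2).
Proof.
  unfold pen. pose proof (pen_den e x). set (q := e ^ 2 * _) in *.
  apply Rmult_le_reg_r with (1 + q); [lra|].
  replace ((1 - / (1 + q)) * (1 + q)) with q by (field; lra). nra.
Qed.

Lemma norm2_sq x : norm2 x * norm2 x = fst x ^ 2 + snd x ^ 2.
Proof.
  unfold norm2. apply sqrt_sqrt. apply Rplus_le_le_0_compat; apply pow2_ge_0.
Qed.

Lemma norm2_nonneg x : 0 <= norm2 x.
Proof. apply sqrt_pos. Qed.

Lemma norm2_cauchy_schwarz x y : fst x * fst y + snd x * snd y <= norm2 x * norm2 y.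
Proof.
  apply Rsqr_incr_0_var.
  - unfold Rsqr.
    replace (norm2 x * norm2 y * (norm2 x * norm2 y))
      with ((norm2 x * norm2 x) * (norm2 y * norm2 y)) by ring.
    rewrite !norm2_sq. generalize (pow2_ge_0 (fst x * snd y - snd x * fst y)). simpl. nra.
  - apply Rmult_le_pos; apply norm2_nonneg.
Qed.

Lemma norm2_le_iff x r : 0 <= r -> fst x ^ 2 + snd x ^ 2 <= r * r -> norm2 x <= r.
Proof.
  intros Hr H. apply Rsqr_incr_0_var; auto. unfold Rsqr. rewrite norm2_sq. exact H.
Qed.

Lemma norm2_triang x y : norm2 (fst x + fst y, snd x + snd y) <= norm2 x + norm2 y.
Proof.
  pose proof (norm2_nonneg x). pose proof (norm2_nonneg y).
  apply norm2_le_iff; [lra|]. simpl fst; simpl snd.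
  pose proof (norm2_cauchy_schwarz x y). pose proof (norm2_sq x). pose proof (norm2_sq y). nra.
Qed.

Lemma dist2_sym x y : dist2 x y = dist2 y x.
Proof. unfold dist2, norm2. f_equal. simpl. ring. Qed.

Lemma norm2_dist x y : norm2 y <= norm2 x + dist2 x y.
Proof.
  rewrite dist2_sym.
  apply Rle_trans with (2 := norm2_triang x (fst y - fst x, snd y - snd x)).
  right. unfold norm2. f_equal. simpl. ring.
Qed.

Lemma fst_le_norm2 x : Rabs (fst x) <= norm2 x.
Proof.
  apply Rsqr_incr_0_var; [|apply norm2_nonneg]. rewrite <- Rsqr_abs. unfold Rsqr.
  rewrite norm2_sq. generalize (pow2_ge_0 (snd x)). simpl; nra.
Qed.

Lemma snd_le_norm2 x : Rabs (snd x) <= norm2 x.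
Proof.
  apply Rsqr_incr_0_var; [|apply norm2_nonneg]. rewrite <- Rsqr_abs. unfold Rsqr.
  rewrite norm2_sq. generalize (pow2_ge_0 (fst x)). simpl; nra.
Qed.

Lemma norm2_le_sum x : norm2 x <= Rabs (fst x) + Rabs (snd x).
Proof.
  pose proof (Rabs_pos (fst x)). pose proof (Rabs_pos (snd x)).
  apply norm2_le_iff; [lra|].
  rewrite <- (pow2_abs (fst x)), <- (pow2_abs (snd x)). nra.
Qed.

(** After scaling by [e] the increment is [(q - p) (q + p) / ((1 + p^2) (1 + q^2))], and the factor
    multiplying [q - p] is at most 1. *)
Lemma pen_lip e x y : 0 < e -> pen e y - pen e x <= e * dist2 x y.
Proof.
  intros He. unfold pen. rewrite <- !norm2_sq.
  set (a := norm2 x). set (b := norm2 y). set (d := dist2 x y).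
  assert (Ha : 0 <= a) by apply norm2_nonneg. assert (Hb : 0 <= b) by apply norm2_nonneg.
  assert (Hd : 0 <= d) by apply dist2_nonneg.
  assert (Hab : b <= a + d) by apply norm2_dist.
  set (p := e * a). set (q := e * b).
  assert (0 <= p) by (apply Rmult_le_pos; lra). assert (0 <= q) by (apply Rmult_le_pos; lra).
  assert (Hpq : q <= p + e * d) by (unfold p, q; nra).
  replace (e ^ 2 * (a * a)) with (p * p) by (unfold p; ring).
  replace (e ^ 2 * (b * b)) with (q * q) by (unfold q; ring).
  set (D := e * d) in *. assert (0 <= D) by (unfold D; nra).
  clearbody p q D.
  assert (0 < 1 + p * p) by nra. assert (0 < 1 + q * q) by nra.
  apply Rmult_le_reg_r with ((1 + p * p) * (1 + q * q)); [nra|].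
  replace ((1 - / (1 + q * q) - (1 - / (1 + p * p))) * ((1 + p * p) * (1 + q * q)))
    with ((q - p) * (q + p)) by (field; lra).
  apply Rle_trans with (D * (q + p)); [apply Rmult_le_compat_r; lra|].
  apply Rmult_le_compat_l; auto.
  pose proof (pow2_ge_0 (q - 1)). nra.
Qed.

Lemma pen_d1 e x : 0 < e -> exists l, derivable_pt_lim (fun h => pen e (fst x + h, snd x)) 0 l /\
  Rabs l <= e.
Proof.
  intros He. pose proof (pen_den e x).
  set (D := 1 + e ^ 2 * (fst x ^ 2 + snd x ^ 2)) in *.
  exists (2 * e ^ 2 * fst x / (D * D)). split.
  - apply is_derive_Reals. unfold pen; simpl fst; simpl snd. auto_derive.
    + rewrite Rplus_0_r. unfold D in H. simpl in H. lra.
    + rewrite !Rplus_0_r. unfold D in *. simpl in *. field. lra.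
  - unfold Rdiv. rewrite Rabs_mult, (Rabs_pos_eq (/ (D * D))).
    2: { apply Rlt_le, Rinv_0_lt_compat; nra. }
    apply Rmult_le_reg_r with (D * D); [nra|].
    rewrite Rmult_assoc, Rinv_l by nra.
    rewrite Rmult_1_r, !Rabs_mult, (Rabs_pos_eq 2), (Rabs_pos_eq (e ^ 2)) by first [lra | apply pow2_ge_0].
    assert (2 * (e * Rabs (fst x)) <= D).
    { unfold D. rewrite <- (pow2_abs (fst x)).
      generalize (pow2_ge_0 (e * Rabs (fst x) - 1)) (pow2_ge_0 (e * snd x)). simpl. nra. }
    replace (2 * e ^ 2 * Rabs (fst x)) with (e * (2 * (e * Rabs (fst x)))) by ring.
    apply Rmult_le_compat_l; [lra|]. apply Rle_trans with D; [auto|nra].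
Qed.

Lemma pen_swap e x1 x2 : pen e (x1, x2) = pen e (x2, x1).
Proof. unfold pen; simpl. f_equal. f_equal. ring. Qed.

Lemma derivable_pt_lim_ext (f g : R -> R) x l :
  (forall y, f y = g y) -> derivable_pt_lim f x l -> derivable_pt_lim g x l.
Proof.
  intros E H eps He. destruct (H eps He) as [d Hd]. exists d. intros h.
  rewrite <- !E. apply Hd.
Qed.

Lemma pen_d2 e x : 0 < e -> exists l, derivable_pt_lim (fun h => pen e (fst x, snd x + h)) 0 l /\
  Rabs l <= e.
Proof.
  intros He. destruct (pen_d1 e (snd x, fst x) He) as (l & H & Hl). exists l. split; auto.
  revert H. apply derivable_pt_lim_ext. intros h. apply pen_swap.
Qed.

(* The part of [is_solution] preserved by [theta -> -theta] and needed for comparison. *)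
Definition wsol (s c : R) (u : R2 -> R2) (theta : R -> R2 -> R) (T M : R) : Prop :=
  cont_on dist3 (fun p => 0 <= fst p) (fun p => theta (fst p) (snd p)) /\
  (forall t x, 0 <= t <= T -> Rabs (theta t x) <= M) /\
  (forall t x, 0 < t -> exists dt d1 d2 L,
     derivable_pt_lim (fun tau => theta tau x) t dt /\
     derivable_pt_lim (fun h => theta t (fst x + h, snd x)) 0 d1 /\
     derivable_pt_lim (fun h => theta t (fst x, snd x + h)) 0 d2 /\
     pv_frac_integral s (theta t) x L /\
     dt + fst (u x) * d1 + snd (u x) * d2 + c * L = 0).

Lemma dist3_small (p q : R * R2) d : 0 < d -> Rabs (fst p - fst q) < d / 2 ->
  Rabs (fst (snd p) - fst (snd q)) < d / 2 -> Rabs (snd (snd p) - snd (snd q)) < d / 2 ->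
  dist3 p q < d.
Proof.
  intros Hd H1 H2 H3. unfold dist3. rewrite <- (sqrt_square d) by lra.
  apply sqrt_lt_1_alt. split.
  { repeat apply Rplus_le_le_0_compat; apply pow2_ge_0. }
  rewrite <- (pow2_abs (fst p - fst q)), <- (pow2_abs (fst (snd p) - fst (snd q))),
    <- (pow2_abs (snd (snd p) - snd (snd q))).
  pose proof (Rabs_pos (fst p - fst q)). pose proof (Rabs_pos (fst (snd p) - fst (snd q))).
  pose proof (Rabs_pos (snd (snd p) - snd (snd q))). nra.
Qed.

Lemma zero_pv s x : pv_frac_integral s (fun _ => 0) x 0.
Proof.
  apply pv_iff. exists (fun _ => 0). split.
  - intros r Hr. split; [apply ex_RInt_const|]. rewrite RInt_constR. eqR; ring.
  - intros eta He. exists 1, 0. split; [lra|]. intros a b _ _ _.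
    assert (HI : RInt.is_RInt (fun r => 0 * kern s r) a b 0).
    { apply (is_RInt_ext (fun _ => 0)).
      { intros; eqR; ring. }
      pose proof (is_RInt_const (V := R_NormedModule) a b 0) as HI.
      unfold scal in HI; simpl in HI; unfold mult in HI; simpl in HI.
      now rewrite Rmult_0_r in HI. }
    split; [now exists 0|]. rewrite (is_RInt_unique _ _ _ _ HI).
    rewrite Rminus_0_r, Rabs_R0. exact He.
Qed.

(* [W] is a subsolution in the time variable [t] related to physical time by [tau], with
   [g = tau']; the subsolution inequality is only needed where [theta] is below [W]. *)
Section Comparison.
Variables (s c U M MW Gm S : R) (u : R2 -> R2) (theta : R -> R2 -> R).
Variables (tau g : R -> R) (W : R -> R2 -> R).
Hypotheses (Hs : 0 < s) (Hs' : s < 1 / 2) (Hc : 0 <= c) (HS : 0 < S).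
Hypothesis HU : forall x, Rabs (fst (u x)) <= U /\ Rabs (snd (u x)) <= U.
Hypothesis Htau0 : tau 0 = 0.
Hypothesis Htau : forall t, 0 <= t <= S -> derivable_pt_lim tau t (g t) /\ 0 < g t <= Gm.
Hypothesis Hsol : wsol s c u theta (tau S) M.
Hypothesis HWc : cont3 S W.
Hypothesis HWM : forall t x, 0 <= t <= S -> W t x <= MW.
Hypothesis HW0 : forall x, W 0 x <= theta 0 x.
Hypothesis Hcontact : forall t x kap, 0 < t <= S -> 0 < kap -> theta (tau t) x < W t x ->
  exists Wt W1 W2 A B,
    derivable_pt_lim (fun t => W t x) t Wt /\
    derivable_pt_lim (fun h => W t (fst x + h, snd x)) 0 W1 /\
    derivable_pt_lim (fun h => W t (fst x, snd x + h)) 0 W2 /\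
    0 < A /\ 0 < B /\ (forall y, W t x - W t y <= Rmin A (B * dist2 x y)) /\
    Wt + g t * (fst (u x) * W1 + snd (u x) * W2 + c * Kc s A B) <= kap.

Lemma tau_incr t t' : 0 <= t -> t < t' -> t' <= S -> tau t < tau t'.
Proof.
  intros H1 H2 H3. destruct (MVT_cor2 tau g t t' H2) as (z & E & Hz).
  { intros z Hz. apply Htau. lra. }
  destruct (Htau z) as [_ Hg]; [lra|]. nra.
Qed.

Lemma tau_range t : 0 <= t <= S -> 0 <= tau t <= tau S.
Proof.
  intros Ht. rewrite <- Htau0. split.
  - destruct (Req_dec t 0) as [->|]; [lra|]. apply Rlt_le, tau_incr; lra.
  - destruct (Req_dec t S) as [->|]; [lra|]. apply Rlt_le, tau_incr; lra.
Qed.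

Lemma theta_tau_cont : cont3 S (fun t x => theta (tau t) x).
Proof.
  intros t x Ht eps He. destruct Hsol as (Hcont & _ & _).
  pose proof (tau_range t Ht) as Htt.
  destruct (Hcont (tau t, x)) with (eps := eps) as (d & Hd & H); simpl; [lra|auto|].
  destruct (Htau t Ht) as [Dt _].
  assert (Ct : continuity_pt tau t) by (apply derivable_continuous_pt; eexists; exact Dt).
  destruct (Ct (d / 2)) as (d' & Hd' & H'); [lra|].
  exists (Rmin d' (d / 2)). split; [apply Rmin_pos; lra|].
  pose proof (Rmin_l d' (d / 2)). pose proof (Rmin_r d' (d / 2)).
  intros t' x' Ht' A1 A2 A3. apply (H (tau t', x')); simpl.
  - apply (tau_range t'). auto.
  - apply dist3_small; simpl; auto.
    + rewrite Rabs_minus_sym. destruct (Req_dec t' t) as [->|Hne].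
      * rewrite Rminus_diag, Rabs_R0. lra.
      * apply (H' t'). split; [split; [exact I|auto]|]. simpl. unfold R_dist. lra.
    + rewrite Rabs_minus_sym. lra.
    + rewrite Rabs_minus_sym. lra.
Qed.

(** If [theta] falls below [W] somewhere, then [theta - W] plus a small penalty and a small slope
    [D t] has a negative minimum at a positive time. There the gradients of [theta] and [W] agree up
    to the penalty, and the equation contradicts the subsolution inequality: the slope contributes
    [D], while [kap], the drift of the penalty and its nonlocal term contribute at most [D / 4]
    each. *)
Theorem comparison t x : 0 <= t <= S -> W t x <= theta (tau t) x.
Proof.
  intros Ht. apply Rnot_lt_le. intros Hlt.
  destruct (Htau 0) as [_ HGm]; [lra|].
  pose proof Hsol as (Hcont & Hbd & Hpde).
  (* A third of the gap: the penalty and the slope may use one [dl] each and still leave [Psi t x]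
     negative. *)
  set (dl := (W t x - theta (tau t) x) / 3).
  assert (Hdl : 0 < dl) by (unfold dl; lra).
  set (D := dl / S). assert (HD : 0 < D) by (apply Rdiv_lt_0_compat; auto).
  assert (HDt : forall t, 0 <= t <= S -> 0 <= D * t <= dl).
  { intros t0 Ht0. split; [apply Rmult_le_pos; lra|]. replace dl with (D * S) by (unfold D; field; lra).
    apply Rmult_le_compat_l; lra. }
  (* [M' - 1] bounds [W - theta], so [Psi] becomes positive wherever the penalty is close enough to
     its supremum 1. *)
  set (M' := Rabs M + Rabs MW + 1).
  assert (HM' : 1 <= M') by (unfold M'; generalize (Rabs_pos M) (Rabs_pos MW); lra).
  assert (HUp : 0 <= U) by (apply Rle_trans with (2 := proj1 (HU x)); apply Rabs_pos).
  set (k := Gm * c * Kc s M' M' + 1).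
  assert (HKc : 0 < Kc s M' M') by (apply Kc_pos; lra).
  assert (Hk : 0 < k).
  { unfold k. assert (0 <= Gm * c * Kc s M' M'); [|lra]. apply Rmult_le_pos; [apply Rmult_le_pos|]; lra. }
  destruct (Rpower_small (2 * s) (D / 4 / k)) as (e1 & He1 & Hsm); [lra| |].
  { apply Rdiv_lt_0_compat; lra. }
  set (q := fst x ^ 2 + snd x ^ 2).
  assert (Hq : 0 <= q) by (apply Rplus_le_le_0_compat; apply pow2_ge_0).
  set (e2 := D / 4 / (2 * Gm * U * M' + 1)).
  assert (HGU : 0 <= 2 * Gm * U * M') by (repeat apply Rmult_le_pos; lra).
  assert (He2 : 0 < e2) by (unfold e2; apply Rdiv_lt_0_compat; lra).
  set (e3 := dl / (M' * q + 1)).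
  assert (HMq : 0 <= M' * q) by (apply Rmult_le_pos; lra).
  assert (He3 : 0 < e3) by (unfold e3; apply Rdiv_lt_0_compat; lra).
  (* [e1] controls the nonlocal term of the penalty, [e2] its transport by [u], and [e3] its value
     at the point [x] where the comparison fails; [e <= 1] gives [e^2 <= e]. *)
  set (e := Rmin (Rmin (e1 / 2) 1) (Rmin e2 e3)).
  assert (He : 0 < e) by (repeat apply Rmin_pos; lra).
  assert (e <= e1 / 2 /\ e <= 1 /\ e <= e2 /\ e <= e3) as (Hee1 & He1' & Hee2 & Hee3).
  { pose proof (Rmin_l (Rmin (e1 / 2) 1) (Rmin e2 e3)).
    pose proof (Rmin_r (Rmin (e1 / 2) 1) (Rmin e2 e3)).
    pose proof (Rmin_l (e1 / 2) 1). pose proof (Rmin_r (e1 / 2) 1).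
    pose proof (Rmin_l e2 e3). pose proof (Rmin_r e2 e3). fold e in H, H0. lra. }
  set (Psi := fun t x => theta (tau t) x + - W t x + (M' * pen e x + D * t)).
  assert (Hneg : Psi t x < 0).
  { unfold Psi. specialize (HDt t Ht).
    assert (M' * pen e x <= dl).
    { apply Rle_trans with (M' * (e ^ 2 * q)).
      - apply Rmult_le_compat_l; [lra|apply pen_le].
      - apply Rle_trans with (e3 * (M' * q)).
        + replace (M' * (e ^ 2 * q)) with (e ^ 2 * (M' * q)) by ring.
          apply Rmult_le_compat_r; auto. nra.
        + unfold e3. apply Rmult_le_reg_r with (M' * q + 1); [lra|].
          replace (dl / (M' * q + 1) * (M' * q) * (M' * q + 1)) with (dl * (M' * q))
            by (field; lra). nra. }
    unfold dl in *. lra. }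
  assert (Hfar : forall t x, 0 <= t <= S -> M' <= e * Rabs (fst x) \/ M' <= e * Rabs (snd x) ->
     0 < Psi t x).
  { intros t0 x0 Ht0 Hx0. unfold Psi.
    specialize (HDt t0 Ht0). specialize (HWM t0 x0 Ht0).
    specialize (Hbd (tau t0) x0 (tau_range t0 Ht0)).
    assert (Hp : M' - 1 < M' * pen e x0).
    { unfold pen.
      assert (Hbig : M' < 1 + e ^ 2 * (fst x0 ^ 2 + snd x0 ^ 2)).
      { rewrite <- (pow2_abs (fst x0)), <- (pow2_abs (snd x0)).
        destruct Hx0 as [Hx0|Hx0].
        - simpl in *. nra.
        - simpl in *. nra. }
      set (d := 1 + e ^ 2 * (fst x0 ^ 2 + snd x0 ^ 2)) in *.
      assert (M' * / d < 1); [|lra].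
      apply Rmult_lt_reg_r with d; [lra|]. rewrite Rmult_assoc, Rinv_l by lra. lra. }
    generalize (Rle_abs MW) (Rle_abs M). unfold M' in Hp.
    apply Rabs_le_between in Hbd. fold M' in Hp |- *. unfold M' in Hp at 1. lra. }
  assert (Hlow : forall t x, 0 <= t <= S -> - M - MW <= Psi t x).
  { intros t0 x0 Ht0. unfold Psi. specialize (HDt t0 Ht0). specialize (HWM t0 x0 Ht0).
    specialize (Hbd (tau t0) x0 (tau_range t0 Ht0)). apply Rabs_le_between in Hbd.
    assert (0 <= M' * pen e x0) by (apply Rmult_le_pos; [lra|apply pen_bounds]). lra. }
  assert (HPc : cont3 S Psi).
  { apply cont3_plus; [apply cont3_plus|].
    - exact theta_tau_cont.
    - now apply cont3_opp.
    - apply cont3_plus.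
      + apply cont3_lip with (M' * e). intros t0 x0 t1 x1 _ _.
        replace (M' * pen e x1 - M' * pen e x0) with (M' * (pen e x1 - pen e x0)) by ring.
        rewrite Rabs_mult, (Rabs_pos_eq M') by lra. rewrite Rmult_assoc.
        apply Rmult_le_compat_l; [lra|].
        assert (H : Rabs (pen e x1 - pen e x0) <= e * dist2 x0 x1).
        { pose proof (pen_lip e x0 x1 He). pose proof (pen_lip e x1 x0 He) as H2.
          rewrite (dist2_sym x1 x0) in H2. apply Rabs_le. lra. }
        apply Rle_trans with (1 := H). apply Rmult_le_compat_l; [lra|].
        pose proof (norm2_le_sum (fst x0 - fst x1, snd x0 - snd x1)) as Hn. simpl in Hn.
        fold (dist2 x0 x1) in Hn.
        rewrite (Rabs_minus_sym (fst x1)), (Rabs_minus_sym (snd x1)).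
        generalize (Rabs_pos (t1 - t0)). lra.
      + apply cont3_lip with D. intros t0 x0 t1 x1 _ _.
        replace (D * t1 - D * t0) with (D * (t1 - t0)) by ring.
        rewrite Rabs_mult, (Rabs_pos_eq D) by lra. apply Rmult_le_compat_l; [lra|].
        generalize (Rabs_pos (fst x1 - fst x0)) (Rabs_pos (snd x1 - snd x0)). lra. }
  set (Q := M' / e). assert (HQ : 0 < Q) by (apply Rdiv_lt_0_compat; lra).
  assert (HeQ : e * Q = M') by (unfold Q; field; lra).
  assert (Hout : forall z, Q <= Rabs z -> M' <= e * Rabs z).
  { intros z Hz. rewrite <- HeQ. apply Rmult_le_compat_l; lra. }
  destruct (box_min S Q (- M - MW) Psi) as (t0 & x0 & Ht0 & Hx1 & Hx2 & Hmin); auto; try lra.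
  assert (Hin : forall y, - Q <= y <= Q \/ Q <= Rabs y).
  { intros y. destruct (Rle_dec (Rabs y) Q) as [Hy|Hy]; [left|right; lra].
    now apply Rabs_le_between. }
  assert (HP0 : Psi t0 x0 < 0).
  { apply Rle_lt_trans with (2 := Hneg). apply Hmin; auto.
    - destruct (Hin (fst x)) as [|Hb]; auto. exfalso.
      specialize (Hfar t x Ht (or_introl (Hout _ Hb))). lra.
    - destruct (Hin (snd x)) as [|Hb]; auto. exfalso.
      specialize (Hfar t x Ht (or_intror (Hout _ Hb))). lra. }
  assert (Hglob : forall y, Psi t0 x0 <= Psi t0 y).
  { intros y. destruct (Hin (fst y)) as [Hy1|Hb].
    2: { specialize (Hfar t0 y Ht0 (or_introl (Hout _ Hb))). lra. }
    destruct (Hin (snd y)) as [Hy2|Hb].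
    2: { specialize (Hfar t0 y Ht0 (or_intror (Hout _ Hb))). lra. }
    now apply Hmin. }
  assert (Hpen0 : 0 <= M' * pen e x0) by (apply Rmult_le_pos; [lra|apply pen_bounds]).
  assert (Ht0' : 0 < t0).
  { destruct (Req_dec t0 0) as [E|]; [|lra]. exfalso. subst t0.
    unfold Psi in HP0. rewrite Htau0 in HP0. specialize (HW0 x0). lra. }
  pose proof (HDt t0 Ht0) as HDt0.
  destruct (Hcontact t0 x0 (D / 4)) as
    (Wt & W1 & W2 & A & B & DWt & DW1 & DW2 & HA & HB & HWL & Hineq); [lra|lra| |].
  { unfold Psi in HP0. lra. }
  destruct (Hpde (tau t0) x0) as (dt & d1 & d2 & L & Ddt & Dd1 & Dd2 & HL & Heq).
  { rewrite <- Htau0. apply tau_incr; lra. }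
  destruct (pen_d1 e x0 He) as (p1 & Dp1 & Hp1). destruct (pen_d2 e x0 He) as (p2 & Dp2 & Hp2).
  destruct (Htau t0 Ht0) as [Dtau Hg].
  assert (E1 : d1 + - W1 + M' * p1 = 0).
  { apply (deriv_zero_of_min (fun h => theta (tau t0) (fst x0 + h, snd x0)
       + - W t0 (fst x0 + h, snd x0) + M' * pen e (fst x0 + h, snd x0)) 1); [lra| |].
    - intros h _. rewrite Rplus_0_r. specialize (Hglob (fst x0 + h, snd x0)).
      destruct x0 as [x01 x02]; simpl in *. unfold Psi in Hglob. lra.
    - apply derivable_pt_lim_plus; [apply derivable_pt_lim_plus; auto|].
      + now apply derivable_pt_lim_opp.
      + now apply derivable_pt_lim_scal. }
  assert (E2 : d2 + - W2 + M' * p2 = 0).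
  { apply (deriv_zero_of_min (fun h => theta (tau t0) (fst x0, snd x0 + h)
       + - W t0 (fst x0, snd x0 + h) + M' * pen e (fst x0, snd x0 + h)) 1); [lra| |].
    - intros h _. rewrite Rplus_0_r. specialize (Hglob (fst x0, snd x0 + h)).
      destruct x0 as [x01 x02]; simpl in *. unfold Psi in Hglob. lra.
    - apply derivable_pt_lim_plus; [apply derivable_pt_lim_plus; auto|].
      + now apply derivable_pt_lim_opp.
      + now apply derivable_pt_lim_scal. }
  assert (E0 : dt * g t0 + - Wt + (0 + D * 1) <= 0).
  { apply (deriv_nonpos_of_left_min (fun t => Psi t x0) t0); auto.
    - intros t' Ht'. apply Hmin; auto; lra.
    - apply derivable_pt_lim_plus; [apply derivable_pt_lim_plus|apply derivable_pt_lim_plus].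
      + apply (derivable_pt_lim_comp tau (fun tau => theta tau x0)); auto.
      + now apply derivable_pt_lim_opp.
      + apply derivable_pt_lim_const.
      + apply (derivable_pt_lim_scal id D). apply derivable_pt_lim_id. }
  (* Minimality of [Psi] bounds the increments of [theta] by those of [W] and of the penalty, so
     [theta] is compared with the zero function. *)
  assert (HLb : L - 0 <= Kc s A B + Kc s M' (M' * e)).
  { apply (pv_compare2 s (theta (tau t0)) (fun _ => 0) x0); auto using zero_pv; try lra.
    - apply Rmult_lt_0_compat; lra.
    - intros y. specialize (Hglob y). specialize (HWL y). unfold Psi in Hglob.
      assert (M' * (pen e y - pen e x0) <= Rmin M' (M' * e * dist2 x0 y)).
      { apply Rmin_glb.
        - rewrite <- (Rmult_1_r M') at 2. apply Rmult_le_compat_l; [lra|].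
          pose proof (pen_bounds e y). pose proof (pen_bounds e x0). lra.
        - rewrite Rmult_assoc. apply Rmult_le_compat_l; [lra|]. now apply pen_lip. }
      lra. }
  assert (HKe : Gm * (c * Kc s M' (M' * e)) <= D / 4).
  { assert (EK : Kc s M' (M' * e) = Rpower e (2 * s) * Kc s M' M').
    { unfold Kc. replace (M' * e / M') with e by (field; lra).
      replace (M' / M') with 1 by (field; lra).
      unfold Rpower at 3. rewrite ln_1, Rmult_0_r, exp_0. ring. }
    rewrite EK. specialize (Hsm e He ltac:(lra)).
    apply Rle_trans with (k * Rpower e (2 * s)).
    - assert (0 < Rpower e (2 * s)) by apply exp_pos. unfold k. nra.
    - apply Rmult_lt_compat_l with (r := k) in Hsm; auto.
      replace (k * (D / 4 / k)) with (D / 4) in Hsm by (field; lra). lra. }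
  assert (HUe : forall v p, Rabs v <= U -> Rabs p <= e -> - (U * e) <= v * p <= U * e).
  { intros v p Hv Hp. apply Rabs_le_between. rewrite Rabs_mult.
    apply Rmult_le_compat; auto using Rabs_pos. }
  destruct (HU x0) as [HU1 HU2].
  pose proof (HUe _ _ HU1 Hp1) as B1. pose proof (HUe _ _ HU2 Hp2) as B2.
  assert (HUM : Gm * (2 * (M' * (U * e))) <= D / 4).
  { apply Rle_trans with ((2 * Gm * U * M' + 1) * e2).
    - assert (2 * Gm * U * M' * e <= (2 * Gm * U * M' + 1) * e2)
        by (apply Rmult_le_compat; lra). lra.
    - unfold e2. right. field. lra. }
  set (v1 := fst (u x0)) in *. set (v2 := snd (u x0)) in *.
  assert (d1 = W1 - M' * p1) by lra. assert (d2 = W2 - M' * p2) by lra. subst d1 d2.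
  assert (HcL : c * L <= c * Kc s A B + c * Kc s M' (M' * e)).
  { rewrite <- Rmult_plus_distr_l. apply Rmult_le_compat_l; lra. }
  set (gg := g t0) in *.
  assert (F1 : gg * (v1 * W1 + v2 * W2 + c * L - M' * (v1 * p1 + v2 * p2)) = - (dt * gg)).
  { assert (X : dt = - (v1 * (W1 - M' * p1) + v2 * (W2 - M' * p2) + c * L)) by lra.
    rewrite X. ring. }
  assert (F2 : gg * (c * L) <= gg * (c * Kc s A B) + gg * (c * Kc s M' (M' * e))).
  { rewrite <- Rmult_plus_distr_l. apply Rmult_le_compat_l; lra. }
  assert (F3 : gg * (c * Kc s M' (M' * e)) <= Gm * (c * Kc s M' (M' * e))).
  { apply Rmult_le_compat_r; [|lra]. apply Rmult_le_pos; auto.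
    apply Rlt_le, Kc_pos; try lra. apply Rmult_lt_0_compat; lra. }
  assert (F4 : gg * (- (M' * (v1 * p1 + v2 * p2))) <= gg * (2 * (M' * (U * e)))).
  { apply Rmult_le_compat_l; [lra|].
    assert (M' * (- (v1 * p1 + v2 * p2)) <= M' * (2 * (U * e))) by (apply Rmult_le_compat_l; lra).
    lra. }
  assert (F5 : gg * (2 * (M' * (U * e))) <= Gm * (2 * (M' * (U * e)))).
  { apply Rmult_le_compat_r; [|lra].
    assert (0 <= M' * (U * e)) by (repeat apply Rmult_le_pos; lra). lra. }
  assert (F6 : gg * (v1 * W1 + v2 * W2 + c * L - M' * (v1 * p1 + v2 * p2))
    = gg * (v1 * W1 + v2 * W2 + c * Kc s A B) + (gg * (c * L) - gg * (c * Kc s A B))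
      + gg * (- (M' * (v1 * p1 + v2 * p2)))) by ring.
  rewrite F1 in F6. lra.
Qed.

End Comparison.

(** * Finite sums *)

Fixpoint lsum {T : Type} (f : T -> R) (l : list T) : R :=
  match l with nil => 0 | a :: l' => f a + lsum f l' end.

Section Lsum.
Context {T : Type}.
Implicit Types (f g : T -> R) (l : list T).

Lemma lsum_ext f g l : (forall a, In a l -> f a = g a) -> lsum f l = lsum g l.
Proof.
  induction l as [|a l IH]; simpl; intros H; auto. rewrite H, IH; auto.
Qed.

Lemma lsum_app f l l' : lsum f (l ++ l') = lsum f l + lsum f l'.
Proof. induction l as [|a l IH]; simpl; [ring|]. rewrite IH. ring. Qed.

Lemma lsum_plus f g l : lsum (fun a => f a + g a) l = lsum f l + lsum g l.
Proof. induction l as [|a l IH]; simpl; [ring|]. rewrite IH. ring. Qed.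

Lemma lsum_minus f g l : lsum (fun a => f a - g a) l = lsum f l - lsum g l.
Proof. induction l as [|a l IH]; simpl; [ring|]. rewrite IH. ring. Qed.

Lemma lsum_scal c f l : lsum (fun a => c * f a) l = c * lsum f l.
Proof. induction l as [|a l IH]; simpl; [ring|]. rewrite IH. ring. Qed.

Lemma lsum_zero l : lsum (fun _ : T => 0) l = 0.
Proof. induction l as [|a l IH]; simpl; [ring|]. rewrite IH. ring. Qed.

Lemma lsum_le f g l : (forall a, In a l -> f a <= g a) -> lsum f l <= lsum g l.
Proof.
  induction l as [|a l IH]; simpl; intros H; [lra|].
  apply Rplus_le_compat; auto.
Qed.

Lemma lsum_nonneg f l : (forall a, In a l -> 0 <= f a) -> 0 <= lsum f l.
Proof. intros H. rewrite <- (lsum_zero l). now apply lsum_le. Qed.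

Lemma lsum_abs f l : Rabs (lsum f l) <= lsum (fun a => Rabs (f a)) l.
Proof.
  induction l as [|a l IH]; simpl; [rewrite Rabs_R0; lra|].
  apply Rle_trans with (1 := Rabs_triang _ _). lra.
Qed.

Lemma lsum_term f l a : (forall b, In b l -> 0 <= f b) -> In a l -> f a <= lsum f l.
Proof.
  induction l as [|b l IH]; simpl; intros H Ha; [tauto|].
  assert (0 <= lsum f l) by (apply lsum_nonneg; auto).
  destruct Ha as [->|Ha]; [lra|].
  specialize (IH (fun b Hb => H b (or_intror Hb)) Ha). specialize (H b (or_introl eq_refl)). lra.
Qed.

Lemma lsum_derive (F : T -> R -> R) (F' : T -> R) l t :
  (forall a, In a l -> derivable_pt_lim (F a) t (F' a)) ->
  derivable_pt_lim (fun t => lsum (fun a => F a t) l) t (lsum F' l).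
Proof.
  induction l as [|a l IH]; simpl; intros H.
  - apply derivable_pt_lim_const.
  - apply derivable_pt_lim_plus; auto.
Qed.

End Lsum.

Lemma lsum_map {T T' : Type} (h : T -> T') (f : T' -> R) l :
  lsum f (map h l) = lsum (fun a => f (h a)) l.
Proof. induction l as [|a l IH]; simpl; auto. now rewrite IH. Qed.

Lemma lsum_exchange {T T' : Type} (f : T -> T' -> R) l l' :
  lsum (fun a => lsum (f a) l') l = lsum (fun b => lsum (fun a => f a b) l) l'.
Proof.
  induction l as [|a l IH]; simpl.
  - now rewrite lsum_zero.
  - rewrite IH, lsum_plus. reflexivity.
Qed.

(** * Truncated binomial series *)

(** The rising factorial [p (p + 1) ... (p + n - 1)] over [n!], the Taylor coefficient of
    [(1 - v)^(-p)]. *)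
Fixpoint cn (p : R) (n : nat) : R :=
  match n with O => 1 | S m => cn p m * (p + INR m) / INR (S m) end.

(* Truncations of the binomial series of [(1 - v)^(-p)], with two derivatives. *)
Fixpoint SN (p : R) (N : nat) (v : R) : R :=
  match N with O => 1 | S m => SN p m v + cn p (S m) * v ^ S m end.
Fixpoint SN1 (p : R) (N : nat) (v : R) : R :=
  match N with O => 0 | S m => SN1 p m v + cn p (S m) * INR (S m) * v ^ m end.
Fixpoint SN2 (p : R) (N : nat) (v : R) : R :=
  match N with O => 0 | S m => SN2 p m v + cn p (S m) * INR (S m) * (INR m * v ^ pred m) end.

Section Series.
Variables (p : R).
Hypotheses (Hp : 0 < p) (Hp' : p < 1 / 2).

Lemma cn_rec n : cn p (S n) * INR (S n) = cn p n * (p + INR n).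
Proof.
  change (cn p (S n)) with (cn p n * (p + INR n) / INR (S n)). field. apply not_0_INR. lia.
Qed.

Lemma cn_bounds n : 0 < cn p n <= 1.
Proof.
  induction n as [|n IH]; [simpl; lra|].
  pose proof (cn_rec n) as E. pose proof (pos_INR n) as Hn.
  rewrite S_INR in E. assert (0 < cn p n * (p + INR n)) by nra.
  split.
  - apply Rmult_lt_reg_r with (INR n + 1); lra.
  - apply Rmult_le_reg_r with (INR n + 1); [lra|]. rewrite E. nra.
Qed.

Lemma SN_derive N v : is_derive (SN p N) v (SN1 p N v).
Proof.
  induction N as [|N IH]; [apply (is_derive_const (V := R_NormedModule))|].
  cbn [SN SN1]. apply (is_derive_plus (SN p N) (fun v => cn p (S N) * v ^ S N)); auto.
  rewrite Rmult_assoc. apply (is_derive_scal (fun v => v ^ S N)).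
  apply is_derive_Reals. apply (derivable_pt_lim_pow v (S N)).
Qed.

Lemma SN1_derive N v : is_derive (SN1 p N) v (SN2 p N v).
Proof.
  induction N as [|N IH]; [apply (is_derive_const (V := R_NormedModule))|].
  cbn [SN1 SN2].
  apply (is_derive_plus (SN1 p N) (fun v => cn p (S N) * INR (S N) * v ^ N)); auto.
  apply (is_derive_scal (fun v => v ^ N)).
  apply is_derive_Reals. apply (derivable_pt_lim_pow v N).
Qed.

(* The full series satisfies [(1 - v) S' = p S]; truncation only loses a term of definite sign. *)
Lemma SN1_ode N v : (1 - v) * SN1 p N v = p * SN p N v - (p + INR N) * cn p N * v ^ N.
Proof.
  induction N as [|N IH]; [simpl; ring|].
  cbn [SN SN1]. rewrite Rmult_plus_distr_l, IH, cn_rec.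
  replace (cn p (S N) * v ^ S N) with (cn p (S N) * v ^ S N) by ring.
  replace ((p + INR (S N)) * cn p (S N) * v ^ S N)
    with (p * cn p (S N) * v ^ S N + cn p (S N) * INR (S N) * v ^ S N) by ring.
  rewrite cn_rec. simpl pow. ring.
Qed.

(** Formally the derivative of [SN1_ode], which moves one [SN1] to the right and turns [p] into
    [p + 1]. *)
Lemma SN2_ode N v : (1 - v) * SN2 p N v
  = (p + 1) * SN1 p N v - (p + INR N) * cn p N * (INR N * v ^ pred N).
Proof.
  induction N as [|N IH]; [simpl; ring|].
  cbn [SN1 SN2]. rewrite Rmult_plus_distr_l, IH.
  replace ((p + INR (S N)) * cn p (S N) * (INR (S N) * v ^ pred (S N)))
    with ((p + INR (S N)) * (cn p (S N) * INR (S N)) * v ^ N) by (simpl pred; ring).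
  rewrite !cn_rec, S_INR. destruct N as [|N]; simpl pred; [simpl; ring|].
  change (v ^ S N) with (v * v ^ N). ring.
Qed.

Opaque cn.

Lemma SN_ge1 N v : 0 <= v -> 1 <= SN p N v.
Proof.
  intros Hv. induction N as [|N IH]; [simpl; lra|]. cbn [SN].
  assert (0 <= cn p (S N) * v ^ S N).
  { apply Rmult_le_pos; [apply Rlt_le, cn_bounds|now apply pow_le]. } lra.
Qed.

Lemma SN1_nonneg N v : 0 <= v -> 0 <= SN1 p N v.
Proof.
  intros Hv. induction N as [|N IH]; [simpl; lra|]. cbn [SN1].
  apply Rplus_le_le_0_compat; auto. apply Rmult_le_pos; [apply Rmult_le_pos|].
  - apply Rlt_le, cn_bounds. - apply pos_INR. - now apply pow_le.
Qed.

Lemma SN2_nonneg N v : 0 <= v -> 0 <= SN2 p N v.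
Proof.
  intros Hv. induction N as [|N IH]; [simpl; lra|]. cbn [SN2].
  apply Rplus_le_le_0_compat; auto.
  apply Rmult_le_pos; [apply Rmult_le_pos|apply Rmult_le_pos].
  - apply Rlt_le, cn_bounds. - apply pos_INR. - apply pos_INR. - now apply pow_le.
Qed.

(** The discarded term of [SN1_ode] is nonnegative. Together with [SN2_le] this controls derivatives
    by [SN] itself with the constants of the full series, hence uniformly in [N]; the estimates of
    the field rest on it. *)
Lemma SN1_le N v : 0 <= v -> (1 - v) * SN1 p N v <= p * SN p N v.
Proof.
  intros Hv. rewrite SN1_ode.
  assert (0 <= (p + INR N) * cn p N * v ^ N); [|lra].
  pose proof (pos_INR N). pose proof (cn_bounds N).
  apply Rmult_le_pos; [apply Rmult_le_pos; lra|now apply pow_le].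
Qed.

Lemma SN2_le N v : 0 <= v -> (1 - v) * SN2 p N v <= (p + 1) * SN1 p N v.
Proof.
  intros Hv. rewrite SN2_ode.
  assert (0 <= (p + INR N) * cn p N * (INR N * v ^ pred N)); [|lra].
  pose proof (pos_INR N). pose proof (cn_bounds N).
  apply Rmult_le_pos; [apply Rmult_le_pos; lra|].
  apply Rmult_le_pos; [lra|now apply pow_le].
Qed.

Lemma mono_of_deriv (f f' : R -> R) a b : a <= b ->
  (forall z, a <= z <= b -> is_derive f z (f' z)) ->
  (forall z, a <= z <= b -> 0 <= f' z) -> f a <= f b.
Proof.
  intros Hab Hd Hn. destruct (Req_dec a b) as [->|Hne]; [lra|].
  destruct (MVT_cor2 f f' a b) as (z & E & Hz); [lra| |].
  { intros. apply is_derive_Reals. auto. }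
  specialize (Hn z ltac:(lra)). nra.
Qed.

Lemma SN_mono N a b : 0 <= a -> a <= b -> SN p N a <= SN p N b.
Proof.
  intros Ha Hab. apply (mono_of_deriv _ (SN1 p N)); auto; intros.
  - apply SN_derive. - apply SN1_nonneg. lra.
Qed.

Lemma SN1_mono N a b : 0 <= a -> a <= b -> SN1 p N a <= SN1 p N b.
Proof.
  intros Ha Hab. apply (mono_of_deriv _ (SN2 p N)); auto; intros.
  - apply SN1_derive. - apply SN2_nonneg. lra.
Qed.

Lemma SNpow_derive N v : v < 1 ->
  is_derive (fun v => SN p N v * Rpower (1 - v) p) v
    (- ((p + INR N) * cn p N * v ^ N * Rpower (1 - v) (p - 1))).
Proof.
  intros Hv.
  assert (E : Rpower (1 - v) p = (1 - v) * Rpower (1 - v) (p - 1)).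
  { rewrite <- (Rpower_1 (1 - v)) at 2 by lra. rewrite <- Rpower_plus. f_equal. ring. }
  replace (- _) with (SN1 p N v * Rpower (1 - v) p
     + SN p N v * (-1 * (p * Rpower (1 - v) (p - 1)))).
  2: { rewrite E. pose proof (SN1_ode N v) as H.
       replace (SN1 p N v * ((1 - v) * Rpower (1 - v) (p - 1)))
         with ((1 - v) * SN1 p N v * Rpower (1 - v) (p - 1)) by ring.
       rewrite H. ring. }
  apply (is_derive_mult (SN p N) (fun v => Rpower (1 - v) p)).
  - apply SN_derive.
  - apply (is_derive_comp (fun r => Rpower r p) (fun v => 1 - v)).
    + apply Rpower_derive. lra.
    + auto_derive; auto; ring.
  - intros; apply Rmult_comm.
Qed.

(** The product [SN * (1 - v)^p] equals 1 at [v = 0] and decreases, its derivative being minus the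
    truncation term. *)
Lemma SN_upper N v : 0 <= v -> v < 1 -> SN p N v <= Rpower (1 - v) (- p).
Proof.
  intros Hv Hv'.
  assert (H : - (SN p N 0 * Rpower (1 - 0) p) <= - (SN p N v * Rpower (1 - v) p)).
  { apply (mono_of_deriv (fun v => - (SN p N v * Rpower (1 - v) p))
      (fun v => (p + INR N) * cn p N * v ^ N * Rpower (1 - v) (p - 1))); auto.
    - intros z Hz. rewrite <- (Ropp_involutive (_ * _)).
      apply (is_derive_opp (fun v => SN p N v * Rpower (1 - v) p)).
      apply SNpow_derive. lra.
    - intros z Hz. pose proof (pos_INR N). pose proof (cn_bounds N).
      apply Rmult_le_pos; [|apply Rlt_le, exp_pos].
      apply Rmult_le_pos; [apply Rmult_le_pos; lra|apply pow_le; lra]. }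
  assert (H0 : SN p N 0 = 1).
  { clear. induction N as [|N IH]; auto. cbn [SN]. rewrite IH. simpl. ring. }
  rewrite H0, Rminus_0_r in H. unfold Rpower in H at 1. rewrite ln_1, Rmult_0_r, exp_0 in H.
  rewrite Rpower_Ropp. assert (0 < Rpower (1 - v) p) by apply exp_pos.
  apply Rmult_le_reg_r with (Rpower (1 - v) p); auto. rewrite Rinv_l by lra. lra.
Qed.

(** The same product drops from 1 by at most the size of the truncation term, which the hypothesis
    keeps below 1/2. For fixed [v < 1] the hypothesis holds for some [N], by [pow_linear_small]. *)
Lemma SN_lower N v : 0 <= v -> v < 1 -> (1 + INR N) * v ^ N <= (1 - v) / 2 ->
  Rpower (1 - v) (- p) / 2 <= SN p N v.
Proof.
  intros Hv Hv' HN.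
  assert (Hh : 1 - SN p N v * Rpower (1 - v) p <= 1 / 2).
  { assert (H0 : SN p N 0 * Rpower (1 - 0) p = 1).
    { rewrite Rminus_0_r. unfold Rpower. rewrite ln_1, Rmult_0_r, exp_0, Rmult_1_r.
      clear. induction N as [|N IH]; auto. cbn [SN]. rewrite IH. simpl. ring. }
    rewrite <- H0 at 1.
    destruct (Req_dec v 0) as [->|Hne]; [lra|].
    destruct (MVT_cor2 (fun v => SN p N v * Rpower (1 - v) p)
      (fun v => - ((p + INR N) * cn p N * v ^ N * Rpower (1 - v) (p - 1))) 0 v)
      as (z & E & Hz); [lra| |].
    { intros z Hz. apply is_derive_Reals, SNpow_derive. lra. }
    replace (_ - _) with (- (SN p N v * Rpower (1 - v) p - SN p N 0 * Rpower (1 - 0) p)) by ring.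
    rewrite E, Rminus_0_r.
    pose proof (pos_INR N). pose proof (cn_bounds N).
    assert (B1 : 0 <= (p + INR N) * cn p N <= 1 + INR N) by (split; nra).
    assert (B2 : 0 <= z ^ N <= v ^ N) by (split; [apply pow_le; lra|apply pow_incr; lra]).
    assert (B3 : 0 <= Rpower (1 - z) (p - 1) <= / (1 - v)).
    { split; [apply Rlt_le, exp_pos|].
      replace (p - 1) with (- (1 - p)) by ring. rewrite Rpower_inv_base by lra.
      apply Rle_trans with (Rpower (/ (1 - v)) (1 - p)).
      - apply Rle_Rpower_l; [lra|]. split; [apply Rinv_0_lt_compat; lra|].
        apply Rinv_le_contravar; lra.
      - rewrite <- (Rpower_1 (/ (1 - v))) at 2 by (apply Rinv_0_lt_compat; lra).
        apply Rle_Rpower; [|lra]. rewrite <- Rinv_1. apply Rinv_le_contravar; lra. }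
    assert (B4 : (p + INR N) * cn p N * z ^ N <= (1 + INR N) * v ^ N).
    { apply Rmult_le_compat; tauto || lra. }
    assert (B5 : (p + INR N) * cn p N * z ^ N * Rpower (1 - z) (p - 1) <= (1 - v) / 2 * / (1 - v)).
    { apply Rmult_le_compat; try tauto; try lra. apply Rmult_le_pos; tauto. }
    replace ((1 - v) / 2 * / (1 - v)) with (1 / 2) in B5 by (field; lra).
    assert (0 <= (p + INR N) * cn p N * z ^ N * Rpower (1 - z) (p - 1)).
    { apply Rmult_le_pos; [apply Rmult_le_pos|]; tauto. }
    nra. }
  rewrite Rpower_Ropp. assert (0 < Rpower (1 - v) p) by apply exp_pos.
  apply Rmult_le_reg_r with (Rpower (1 - v) p); auto.
  replace (/ Rpower (1 - v) p / 2 * Rpower (1 - v) p) with (1 / 2) by (field; lra). lra.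
Qed.

End Series.

(** With [v = w^2], one factor [w^N] absorbs the linear growth by Bernoulli's inequality and the
    other tends to 0. *)
Lemma pow_linear_small v eps : 0 <= v -> v < 1 -> 0 < eps ->
  exists N, (1 + INR N) * v ^ N <= eps.
Proof.
  intros Hv Hv' He. set (w := sqrt v).
  assert (Hw : 0 <= w) by apply sqrt_pos.
  assert (Hww : w * w = v) by (now apply sqrt_sqrt).
  assert (Hw1 : w < 1) by nra.
  (* [w] may be 0; the midpoint [w'] can be inverted and still lies below 1. *)
  set (w' := (1 + w) / 2). assert (Hw' : 0 < w' < 1) by (unfold w'; lra).
  set (dl := / w' - 1).
  assert (Hdl : 0 < dl).
  { unfold dl. assert (/ 1 < / w') by (apply Rinv_lt_contravar; lra). rewrite Rinv_1 in H. lra. }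
  assert (Hk : 0 < 1 + / dl) by (assert (0 < / dl) by (now apply Rinv_0_lt_compat); lra).
  destruct (pow_lt_1_zero w') with (y := eps / (1 + / dl)) as [N HN].
  { rewrite Rabs_pos_eq; lra. }
  { now apply Rdiv_lt_0_compat. }
  exists N. specialize (HN N (le_n N)).
  rewrite Rabs_pos_eq in HN by (apply pow_le; lra).
  assert (P : 0 <= w' ^ N) by (apply pow_le; lra).
  assert (Hb : (1 + INR N) * w' ^ N <= 1 + / dl).
  { pose proof (poly N dl Hdl) as Hpoly.
    replace (1 + dl) with (/ w') in Hpoly by (unfold dl; ring).
    rewrite pow_inv in Hpoly.
    assert (P' : 0 < w' ^ N) by (apply pow_lt; lra).
    assert ((1 + INR N * dl) * w' ^ N <= 1).
    { apply Rmult_le_reg_r with (/ w' ^ N); [now apply Rinv_0_lt_compat|].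
      rewrite Rmult_assoc, Rinv_r by lra. lra. }
    assert (INR N * w' ^ N <= / dl).
    { apply Rmult_le_reg_r with dl; auto. rewrite Rinv_l by lra. nra. }
    assert (w' ^ N <= 1) by (rewrite <- (pow1 N); apply pow_incr; lra).
    lra. }
  assert (Hvw : v ^ N <= w' ^ N * w' ^ N).
  { rewrite <- Rpow_mult_distr. apply pow_incr. split; auto. rewrite <- Hww.
    assert (w <= w') by (unfold w'; lra). nra. }
  apply Rle_trans with ((1 + INR N) * w' ^ N * w' ^ N).
  - rewrite Rmult_assoc. apply Rmult_le_compat_l; auto. pose proof (pos_INR N). lra.
  - apply Rle_trans with ((1 + / dl) * (eps / (1 + / dl))).
    + apply Rmult_le_compat; try lra. apply Rmult_le_pos; auto. pose proof (pos_INR N). lra.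
    + right. field. split; lra.
Qed.

(** * The velocity field *)

(* [1 - mcos2 x y = (sin^2 x + sin^2 y) / 2] vanishes exactly on the lattice [PI Z^2]. *)
Definition mcos2 (x y : R) : R := (cos x ^ 2 + cos y ^ 2) / 2.

(* The [y]-derivative of the stream function [sin x sin y SN (mcos2 x y)]; the field used is
   [A (- vel x y, vel y x)]. *)
Definition vel (p : R) (N : nat) (x y : R) : R :=
  sin x * cos y * (SN p N (mcos2 x y) - sin y ^ 2 * SN1 p N (mcos2 x y)).

Lemma sin_sq x : sin x ^ 2 = 1 - cos x ^ 2.
Proof. generalize (sin2_cos2 x). unfold Rsqr. simpl. lra. Qed.

Lemma one_minus_mcos2 x y : 1 - mcos2 x y = (sin x ^ 2 + sin y ^ 2) / 2.
Proof. unfold mcos2. rewrite !sin_sq. lra. Qed.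

Lemma mcos2_bounds x y : 0 <= mcos2 x y <= 1.
Proof.
  pose proof (one_minus_mcos2 x y) as H.
  pose proof (pow2_ge_0 (sin x)). pose proof (pow2_ge_0 (sin y)).
  assert (0 <= mcos2 x y); [|lra]. unfold mcos2.
  pose proof (pow2_ge_0 (cos x)). pose proof (pow2_ge_0 (cos y)). lra.
Qed.

Lemma mcos2_sym x y : mcos2 x y = mcos2 y x.
Proof. unfold mcos2. lra. Qed.

Lemma Rabs_cos_le x : Rabs (cos x) <= 1.
Proof. apply Rabs_le, COS_bound. Qed.
Lemma Rabs_sin_le x : Rabs (sin x) <= 1.
Proof. apply Rabs_le, SIN_bound. Qed.

Section Velocity.
Variables (p : R) (N : nat).
Hypotheses (Hp : 0 < p) (Hp' : p < 1 / 2).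

(** [b] stands for [sin y ^ 2]. By [SN1_le] the subtracted term is at most [2 p SN], so [p < 1/2]
    keeps the bracket positive: the components of the field have the signs of the saddle. *)
Lemma bracket_bounds b v : 0 <= v -> 0 <= b -> b <= 2 * (1 - v) ->
  (1 - 2 * p) * SN p N v <= SN p N v - b * SN1 p N v <= SN p N v.
Proof.
  intros Hv Hb Hb'. pose proof (SN1_le p Hp Hp' N v Hv). pose proof (SN1_nonneg p Hp Hp' N v Hv).
  assert (b * SN1 p N v <= 2 * (1 - v) * SN1 p N v) by (apply Rmult_le_compat_r; auto).
  assert (0 <= b * SN1 p N v) by (now apply Rmult_le_pos). lra.
Qed.

Lemma bracket_abs b v : 0 <= v -> 0 <= b -> b <= 2 * (1 - v) ->
  Rabs (SN p N v - b * SN1 p N v) <= SN p N v.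
Proof.
  intros Hv Hb Hb'. pose proof (bracket_bounds b v Hv Hb Hb').
  rewrite Rabs_pos_eq; [lra|]. nra.
Qed.

Lemma sin_sq_le_mcos2 x y : 0 <= sin y ^ 2 <= 2 * (1 - mcos2 x y).
Proof.
  rewrite one_minus_mcos2. pose proof (pow2_ge_0 (sin x)). pose proof (pow2_ge_0 (sin y)). lra.
Qed.

Lemma SN_lat x y : mcos2 x y < 1 ->
  SN p N (mcos2 x y) <= Rpower (sqrt (1 - mcos2 x y)) (- (2 * p)).
Proof.
  intros Hv. pose proof (mcos2_bounds x y).
  apply Rle_trans with (1 := SN_upper p Hp Hp' N (mcos2 x y) ltac:(lra) Hv).
  right. rewrite <- Rpower_sqrt by lra. rewrite Rpower_mult. f_equal. lra.
Qed.

Lemma vel_bound x y : mcos2 x y < 1 ->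
  Rabs (vel p N x y) <= 2 * Rpower (sqrt (1 - mcos2 x y)) (1 - 2 * p).
Proof.
  intros Hv. pose proof (mcos2_bounds x y) as Hb. unfold vel.
  set (lat := sqrt (1 - mcos2 x y)).
  assert (Hsg : 0 < lat) by (apply sqrt_lt_R0; lra).
  assert (Hsg2 : lat * lat = 1 - mcos2 x y) by (apply sqrt_sqrt; lra).
  assert (Hsin : Rabs (sin x) <= 2 * lat).
  { apply Rsqr_incr_0_var; [|lra]. rewrite <- Rsqr_abs. unfold Rsqr.
    pose proof (one_minus_mcos2 x y). simpl in *. nra. }
  replace (1 - 2 * p) with (1 + - (2 * p)) by ring. rewrite Rpower_plus, Rpower_1 by auto.
  rewrite !Rabs_mult.
  pose proof (SN_lat x y Hv) as HS. fold lat in HS.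
  pose proof (sin_sq_le_mcos2 x y) as Hs2.
  pose proof (bracket_abs (sin y ^ 2) (mcos2 x y) ltac:(lra) ltac:(lra) ltac:(lra)) as HB.
  apply Rle_trans with (2 * lat * 1 * SN p N (mcos2 x y)).
  - apply Rmult_le_compat; auto using Rabs_pos.
    + apply Rmult_le_pos; apply Rabs_pos.
    + apply Rmult_le_compat; auto using Rabs_pos, Rabs_cos_le.
  - rewrite Rmult_1_r, <- Rmult_assoc. apply Rmult_le_compat_l; lra.
Qed.

Lemma vel_zero x y : mcos2 x y = 1 -> vel p N x y = 0.
Proof.
  intros H. pose proof (one_minus_mcos2 x y). rewrite H in H0.
  assert (sin x ^ 2 = 0).
  { pose proof (pow2_ge_0 (sin x)). pose proof (pow2_ge_0 (sin y)). lra. }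
  assert (sin x = 0) by (simpl in H1; nra). unfold vel. rewrite H2. ring.
Qed.

Definition dvel (x y a b : R) : R :=
  let v := mcos2 x y in
  let v' := - (cos x * sin x * a + cos y * sin y * b) in
  let Br := SN p N v - sin y ^ 2 * SN1 p N v in
  cos x * a * cos y * Br - sin x * (sin y * b) * Br
  + sin x * cos y * (SN1 p N v * v' - 2 * sin y * cos y * b * SN1 p N v
                      - sin y ^ 2 * (SN2 p N v * v')).

Lemma vel_line_derive x0 y0 a b t :
  is_derive (fun t => vel p N (x0 + t * a) (y0 + t * b)) t
    (dvel (x0 + t * a) (y0 + t * b) a b).
Proof.
  assert (H0 : ex_derive (fun z => SN p N z) (mcos2 (x0 + t * a) (y0 + t * b)))
    by (eexists; apply SN_derive).
  assert (H1 : ex_derive (fun z => SN1 p N z) (mcos2 (x0 + t * a) (y0 + t * b)))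
    by (eexists; apply SN1_derive).
  pose proof (is_derive_unique _ _ _ (SN_derive p N (mcos2 (x0 + t * a) (y0 + t * b)))) as E0.
  pose proof (is_derive_unique _ _ _ (SN1_derive p N (mcos2 (x0 + t * a) (y0 + t * b)))) as E1.
  unfold vel, dvel, mcos2 in *. auto_derive.
  - repeat split; auto.
  - cbv zeta. simpl in *. unfold Rdiv in *.
    change (fun x : R => SN p N x) with (SN p N).
    change (fun x : R => SN1 p N x) with (SN1 p N). rewrite E0, E1. field.
Qed.

(** Each derivative of [SN] costs a factor [1 / (1 - v)], which is repaid by products of two sines,
    at most [2 (1 - v)]. The five terms of the derivative contribute 1, 1, 1, 1 and 3. *)
Lemma dvel_bound x y a b : Rabs (dvel x y a b) <= 7 * SN p N (mcos2 x y) * (Rabs a + Rabs b).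
Proof.
  pose proof (mcos2_bounds x y) as Hv. pose proof (one_minus_mcos2 x y) as HD.
  unfold dvel. cbv zeta.
  set (v := mcos2 x y) in *.
  pose proof (sin_sq_le_mcos2 x y) as Hsy. fold v in Hsy.
  pose proof (bracket_abs (sin y ^ 2) v ltac:(lra) ltac:(lra) ltac:(lra)) as HB.
  pose proof (SN1_le p Hp Hp' N v ltac:(lra)) as L1.
  pose proof (SN2_le p Hp Hp' N v ltac:(lra)) as L2.
  pose proof (SN_ge1 p Hp Hp' N v ltac:(lra)) as G0.
  pose proof (SN1_nonneg p Hp Hp' N v ltac:(lra)) as G1.
  pose proof (SN2_nonneg p Hp Hp' N v ltac:(lra)) as G2.
  set (Br := SN p N v - sin y ^ 2 * SN1 p N v) in *.
  set (S0 := SN p N v) in *. set (S1 := SN1 p N v) in *. set (S2 := SN2 p N v) in *.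
  set (v' := - (cos x * sin x * a + cos y * sin y * b)).
  clearbody S0 S1 S2 Br.
  set (m := Rabs a + Rabs b).
  pose proof (Rabs_pos a) as Pa. pose proof (Rabs_pos b) as Pb.
  pose proof (Rabs_cos_le x) as Cx. pose proof (Rabs_cos_le y) as Cy.
  pose proof (Rabs_sin_le x) as Sx. pose proof (Rabs_sin_le y) as Sy.
  pose proof (Rabs_pos (cos y)).
  pose proof (Rabs_pos (sin x)) as Px. pose proof (Rabs_pos (sin y)) as Py.
  set (D := 1 - v) in *.
  assert (HDx : Rabs (sin x) * Rabs (sin x) <= 2 * D).
  { rewrite <- Rabs_mult, Rabs_pos_eq by (apply Rle_0_sqr).
    simpl in *. lra. }
  assert (HDxy : Rabs (sin x) * Rabs (sin y) <= D).
  { rewrite <- (pow2_abs (sin x)), <- (pow2_abs (sin y)) in HD.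
    pose proof (pow2_ge_0 (Rabs (sin x) - Rabs (sin y))). simpl in *. nra. }
  assert (Hxv : Rabs (sin x) * Rabs v' <= 2 * D * m).
  { unfold v'. rewrite Rabs_Ropp.
    assert (Rabs (cos x * sin x * a + cos y * sin y * b)
      <= Rabs (sin x) * Rabs a + Rabs (sin y) * Rabs b).
    { apply Rle_trans with (1 := Rabs_triang _ _). rewrite !Rabs_mult.
      apply Rplus_le_compat; (apply Rmult_le_compat_r; [assumption|]);
        [rewrite <- (Rmult_1_l (Rabs (sin x))) at 2|rewrite <- (Rmult_1_l (Rabs (sin y))) at 2];
        apply Rmult_le_compat_r; assumption. }
    apply Rle_trans with (Rabs (sin x) * (Rabs (sin x) * Rabs a + Rabs (sin y) * Rabs b)).
    - apply Rmult_le_compat_l; auto.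
    - rewrite Rmult_plus_distr_l, <- !Rmult_assoc. unfold m.
      assert (Rabs (sin x) * Rabs (sin x) * Rabs a <= 2 * D * Rabs a) by (apply Rmult_le_compat_r; lra).
      assert (Rabs (sin x) * Rabs (sin y) * Rabs b <= 2 * D * Rabs b) by (apply Rmult_le_compat_r; lra).
      lra. }
  assert (Hm : 0 <= m) by (unfold m; lra).
  assert (HDS1 : 2 * D * S1 <= S0) by nra.
  (* [SN2_le] followed by [SN1_le] gives [D^2 S2 <= (p + 1) p S0], and [(p + 1) p <= 3/4] for
     [p < 1/2]. *)
  assert (HDS2 : 4 * D * (D * S2) <= 3 * S0).
  { assert (4 * D * (D * S2) <= 4 * D * ((p + 1) * S1)) by (apply Rmult_le_compat_l; lra).
    assert (4 * ((p + 1) * (D * S1)) <= 4 * ((p + 1) * (p * S0))) by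
      (apply Rmult_le_compat_l; [lra|]; apply Rmult_le_compat_l; lra).
    assert ((p + 1) * p * S0 <= 3 / 4 * S0) by (apply Rmult_le_compat_r; nra).
    lra. }
  assert (T1 : Rabs (cos x * a * cos y * Br) <= S0 * Rabs a).
  { rewrite !Rabs_mult.
    replace (S0 * Rabs a) with (1 * Rabs a * 1 * S0) by ring.
    repeat apply Rmult_le_compat; auto using Rabs_pos; try lra;
      repeat apply Rmult_le_pos; auto using Rabs_pos. }
  assert (T2 : Rabs (sin x * (sin y * b) * Br) <= S0 * Rabs b).
  { rewrite !Rabs_mult.
    replace (S0 * Rabs b) with (1 * (1 * Rabs b) * S0) by ring.
    repeat apply Rmult_le_compat; auto using Rabs_pos; try lra;
      repeat apply Rmult_le_pos; auto using Rabs_pos. }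
  assert (T3 : Rabs (sin x * cos y * (S1 * v')) <= S0 * m).
  { rewrite !Rabs_mult, (Rabs_pos_eq S1) by auto.
    replace (_ * _) with (Rabs (cos y) * (S1 * (Rabs (sin x) * Rabs v'))) by ring.
    apply Rle_trans with (1 * (S1 * (2 * D * m))).
    - apply Rmult_le_compat; auto; [|apply Rmult_le_compat_l; auto].
      repeat apply Rmult_le_pos; auto using Rabs_pos.
    - replace (1 * (S1 * (2 * D * m))) with (2 * D * S1 * m) by ring.
      now apply Rmult_le_compat_r. }
  assert (T4 : Rabs (sin x * cos y * (2 * sin y * cos y * b * S1)) <= S0 * Rabs b).
  { rewrite !Rabs_mult, (Rabs_pos_eq S1), (Rabs_pos_eq 2) by (auto; lra).
    replace (_ * _) with (Rabs (cos y) * Rabs (cos y) *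
       ((Rabs (sin x) * Rabs (sin y)) * (2 * S1 * Rabs b))) by ring.
    apply Rle_trans with (1 * 1 * (D * (2 * S1 * Rabs b))).
    - assert (0 <= 2 * S1 * Rabs b) by (apply Rmult_le_pos; lra).
      apply Rmult_le_compat.
      + apply Rmult_le_pos; auto.
      + apply Rmult_le_pos; auto. apply Rmult_le_pos; auto.
      + apply Rmult_le_compat; auto.
      + apply Rmult_le_compat_r; auto.
    - replace (1 * 1 * (D * (2 * S1 * Rabs b))) with (2 * D * S1 * Rabs b) by ring.
      now apply Rmult_le_compat_r. }
  assert (T5 : Rabs (sin x * cos y * (sin y ^ 2 * (S2 * v'))) <= 3 * S0 * m).
  { rewrite !Rabs_mult, (Rabs_pos_eq S2), (Rabs_pos_eq (sin y ^ 2)) by (auto; apply pow2_ge_0).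
    replace (_ * _) with (Rabs (cos y) * (sin y ^ 2 * (S2 * (Rabs (sin x) * Rabs v')))) by ring.
    apply Rle_trans with (1 * (2 * D * (S2 * (2 * D * m)))).
    - assert (0 <= Rabs (sin x) * Rabs v') by (apply Rmult_le_pos; auto using Rabs_pos).
      assert (0 <= S2 * (Rabs (sin x) * Rabs v')) by (apply Rmult_le_pos; auto).
      apply Rmult_le_compat; auto.
      + apply Rmult_le_pos; lra.
      + apply Rmult_le_compat; try lra. apply Rmult_le_compat_l; auto.
    - replace (1 * (2 * D * (S2 * (2 * D * m)))) with (4 * D * (D * S2) * m) by ring.
      now apply Rmult_le_compat_r. }
  replace (cos x * a * cos y * Br - sin x * (sin y * b) * Br +
     sin x * cos y * (S1 * v' - 2 * sin y * cos y * b * S1 - sin y ^ 2 * (S2 * v')))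
    with (cos x * a * cos y * Br + - (sin x * (sin y * b) * Br) +
      sin x * cos y * (S1 * v') + - (sin x * cos y * (2 * sin y * cos y * b * S1))
      + - (sin x * cos y * (sin y ^ 2 * (S2 * v')))) by ring.
  assert (Hab : S0 * Rabs a <= S0 * m /\ S0 * Rabs b <= S0 * m).
  { split; apply Rmult_le_compat_l; unfold m; lra. }
  eapply Rle_trans; [apply Rabs_triang|]. rewrite Rabs_Ropp.
  eapply Rle_trans; [apply Rplus_le_compat_r, Rabs_triang|]. rewrite Rabs_Ropp.
  eapply Rle_trans; [apply Rplus_le_compat_r, Rplus_le_compat_r, Rabs_triang|].
  eapply Rle_trans; [apply Rplus_le_compat_r, Rplus_le_compat_r, Rplus_le_compat_r, Rabs_triang|].
  rewrite Rabs_Ropp. lra.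
Qed.

(** A Lipschitz substitute for the distance to the lattice [PI Z^2]; by [SN_lat] the series grows at
    most like [lat^(-2p)]. *)
Definition lat (P : R2) : R := sqrt (1 - mcos2 (fst P) (snd P)).

Lemma Rabs_sin_diff a b : Rabs (sin a - sin b) <= Rabs (a - b).
Proof.
  destruct (MVT_abs sin cos b a) as [c [E _]].
  { intros; apply derivable_pt_lim_sin. }
  rewrite E. rewrite <- (Rmult_1_l (Rabs (a - b))) at 2.
  apply Rmult_le_compat_r; [apply Rabs_pos|apply Rabs_cos_le].
Qed.

Lemma lat_norm P : lat P = norm2 (sin (fst P), sin (snd P)) * / sqrt 2.
Proof.
  unfold lat, norm2. simpl fst; simpl snd. rewrite one_minus_mcos2, sqrt_div_alt by lra.
  reflexivity.
Qed.

Lemma lat_lip P Q : lat Q <= lat P + dist2 P Q.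
Proof.
  rewrite !lat_norm.
  pose proof (norm2_dist (sin (fst P), sin (snd P)) (sin (fst Q), sin (snd Q))) as H.
  assert (H2 : dist2 (sin (fst P), sin (snd P)) (sin (fst Q), sin (snd Q)) <= dist2 P Q).
  { apply norm2_le_iff; [apply dist2_nonneg|]. simpl fst; simpl snd.
    unfold dist2. rewrite norm2_sq. simpl fst; simpl snd.
    rewrite <- !(pow2_abs (_ - _)).
    apply Rplus_le_compat; apply pow_incr; (split; [apply Rabs_pos|apply Rabs_sin_diff]). }
  assert (Hs : 0 < / sqrt 2 <= 1).
  { assert (1 <= sqrt 2) by (rewrite <- sqrt_1 at 1; apply sqrt_le_1_alt; lra).
    split; [apply Rinv_0_lt_compat; lra|]. rewrite <- Rinv_1. apply Rinv_le_contravar; lra. }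
  pose proof (dist2_nonneg P Q). nra.
Qed.

Lemma mcos2_lt1 P : 0 < lat P -> mcos2 (fst P) (snd P) < 1.
Proof.
  intros H. pose proof (mcos2_bounds (fst P) (snd P)).
  destruct (Req_dec (mcos2 (fst P) (snd P)) 1) as [E|]; [|lra].
  unfold lat in H. rewrite E, Rminus_diag, sqrt_0 in H. lra.
Qed.

Lemma Rpower_le_pos a b e : 0 <= e -> 0 < a -> a <= b -> Rpower a e <= Rpower b e.
Proof. intros. apply Rle_Rpower_l; auto. Qed.

Lemma Rpower_le_neg a b e : 0 <= e -> 0 < a -> a <= b -> Rpower b (- e) <= Rpower a (- e).
Proof.
  intros. rewrite !Rpower_Ropp. apply Rinv_le_contravar; [apply exp_pos|].
  now apply Rle_Rpower_l.
Qed.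

Lemma vel_small P d : 0 < d -> lat P <= 2 * d ->
  Rabs (vel p N (fst P) (snd P)) <= 4 * Rpower d (1 - 2 * p).
Proof.
  intros Hd Hs. assert (0 < Rpower d (1 - 2 * p)) by apply exp_pos.
  destruct (Req_dec (mcos2 (fst P) (snd P)) 1) as [E|Hne].
  - rewrite vel_zero, Rabs_R0 by auto. lra.
  - pose proof (mcos2_bounds (fst P) (snd P)).
    apply Rle_trans with (1 := vel_bound (fst P) (snd P) ltac:(lra)).
    change (sqrt (1 - mcos2 (fst P) (snd P))) with (lat P).
    assert (0 < lat P) by (apply sqrt_lt_R0; lra).
    assert (Rpower (lat P) (1 - 2 * p) <= Rpower (2 * d) (1 - 2 * p)) by
      (apply Rpower_le_pos; lra).
    assert (Rpower (2 * d) (1 - 2 * p) <= 2 * Rpower d (1 - 2 * p)).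
    { rewrite <- Rpower_mult_distr by lra.
      apply Rmult_le_compat_r; [lra|].
      apply Rle_trans with (Rpower 2 1); [apply Rle_Rpower; lra|rewrite Rpower_1; lra]. }
    lra.
Qed.

(** Every point of the segment from [P] to [Q] has [lat] at least [d = dist2 P Q], so the mean value
    theorem applies with [SN <= d^(-2p)]. The constant is [14 = 7 * 2], since
    [Rabs a + Rabs b <= 2 d]. *)
Lemma vel_holder_far P Q : P <> Q -> 2 * dist2 P Q <= lat P -> 0 < dist2 P Q ->
  Rabs (vel p N (fst Q) (snd Q) - vel p N (fst P) (snd P)) <= 14 * Rpower (dist2 P Q) (1 - 2 * p).
Proof.
  intros HPQ Hs Hd. set (d := dist2 P Q) in *.
  set (a := fst Q - fst P). set (b := snd Q - snd P).
  destruct (MVT_abs (fun t => vel p N (fst P + t * a) (snd P + t * b))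
    (fun t => dvel (fst P + t * a) (snd P + t * b) a b) 0 1) as (t & E & Ht).
  { intros. apply is_derive_Reals, vel_line_derive. }
  rewrite Rmin_left, Rmax_right in Ht by lra.
  rewrite !Rmult_0_l, !Rplus_0_r, !Rmult_1_l in E.
  replace (fst P + a) with (fst Q) in E by (unfold a; ring).
  replace (snd P + b) with (snd Q) in E by (unfold b; ring).
  rewrite E, Rminus_0_r, Rabs_R1, Rmult_1_r.
  apply Rle_trans with (1 := dvel_bound _ _ _ _).
  set (Z := (fst P + t * a, snd P + t * b)).
  assert (HZ : dist2 Z P <= d).
  { apply norm2_le_iff; [apply dist2_nonneg|]. unfold d, dist2. rewrite norm2_sq.
    unfold Z; simpl fst; simpl snd. unfold a, b.
    replace (fst P + t * (fst Q - fst P) - fst P) with (- (t * (fst P - fst Q))) by ring.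
    replace (snd P + t * (snd Q - snd P) - snd P) with (- (t * (snd P - snd Q))) by ring.
    replace ((- (t * (fst P - fst Q))) ^ 2 + (- (t * (snd P - snd Q))) ^ 2)
      with (t ^ 2 * ((fst P - fst Q) ^ 2 + (snd P - snd Q) ^ 2)) by ring.
    pose proof (pow2_ge_0 (fst P - fst Q)). pose proof (pow2_ge_0 (snd P - snd Q)).
    assert (t ^ 2 <= 1) by (simpl; nra). nra. }
  pose proof (lat_lip Z P) as HL.
  pose proof (SN_lat (fst Z) (snd Z) (mcos2_lt1 Z ltac:(lra))) as HS.
  change (sqrt (1 - mcos2 (fst Z) (snd Z))) with (lat Z) in HS. unfold Z in HS at 1 2; simpl fst in HS; simpl snd in HS.
  assert (HS2 : SN p N (mcos2 (fst P + t * a) (snd P + t * b)) <= Rpower d (- (2 * p))).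
  { apply Rle_trans with (1 := HS). apply Rpower_le_neg; lra. }
  assert (Ha : Rabs a <= d).
  { unfold a, d. rewrite Rabs_minus_sym. apply (fst_le_norm2 (fst P - fst Q, snd P - snd Q)). }
  assert (Hb : Rabs b <= d).
  { unfold b, d. rewrite Rabs_minus_sym. apply (snd_le_norm2 (fst P - fst Q, snd P - snd Q)). }
  replace (1 - 2 * p) with (1 + - (2 * p)) by ring. rewrite Rpower_plus, Rpower_1 by auto.
  assert (0 < Rpower d (- (2 * p))) by apply exp_pos.
  apply Rle_trans with (7 * Rpower d (- (2 * p)) * (2 * d)); [|right; ring].
  apply Rmult_le_compat.
  - pose proof (mcos2_bounds (fst P + t * a) (snd P + t * b)).
    pose proof (SN_ge1 p Hp Hp' N _ (proj1 H0)). lra.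
  - pose proof (Rabs_pos a). pose proof (Rabs_pos b). lra.
  - lra.
  - lra.
Qed.

Lemma dist2_gt0 P Q : P <> Q -> 0 < dist2 P Q.
Proof.
  intros H. destruct (dist2_nonneg P Q) as [|E]; auto. exfalso. apply H.
  pose proof (norm2_sq (fst P - fst Q, snd P - snd Q)) as E2. unfold dist2 in E.
  rewrite <- E in E2. simpl in E2. destruct P as [p1 p2], Q as [q1 q2]; simpl in *.
  pose proof (Rle_0_sqr (p1 - q1)). pose proof (Rle_0_sqr (p2 - q2)). unfold Rsqr in *.
  assert (p1 - q1 = 0) by (apply Rsqr_0_uniq; unfold Rsqr; lra).
  assert (p2 - q2 = 0) by (apply Rsqr_0_uniq; unfold Rsqr; lra).
  f_equal; lra.
Qed.

(** Either one of the points is far from the lattice compared with the distance between them, and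
    the gradient bound applies, or both are close and each value is at most [4 d^(1 - 2p)]. *)
Lemma vel_holder P Q : P <> Q ->
  Rabs (vel p N (fst P) (snd P) - vel p N (fst Q) (snd Q)) <= 14 * Rpower (dist2 P Q) (1 - 2 * p).
Proof.
  intros H. pose proof (dist2_gt0 P Q H) as Hd.
  destruct (Rle_dec (2 * dist2 P Q) (lat P)) as [H1|H1].
  { rewrite Rabs_minus_sym. now apply vel_holder_far. }
  destruct (Rle_dec (2 * dist2 P Q) (lat Q)) as [H2|H2].
  { rewrite dist2_sym in *. apply vel_holder_far; auto. }
  pose proof (vel_small P (dist2 P Q) Hd ltac:(lra)).
  pose proof (vel_small Q (dist2 P Q) Hd ltac:(lra)).
  eapply Rle_trans; [apply (Rabs_triang _ (- vel p N (fst Q) (snd Q)))|]. rewrite Rabs_Ropp.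
  assert (0 < Rpower (dist2 P Q) (1 - 2 * p)) by apply exp_pos. lra.
Qed.

Lemma vel_le2 x y : Rabs (vel p N x y) <= 2.
Proof.
  destruct (Req_dec (mcos2 x y) 1) as [E|Hne].
  - rewrite vel_zero, Rabs_R0 by auto. lra.
  - pose proof (mcos2_bounds x y). apply Rle_trans with (1 := vel_bound x y ltac:(lra)).
    assert (Rpower (sqrt (1 - mcos2 x y)) (1 - 2 * p) <= Rpower 1 (1 - 2 * p)).
    { apply Rpower_le_pos; [lra|apply sqrt_lt_R0; lra|]. apply Rle_trans with (sqrt 1); [apply sqrt_le_1_alt; lra|rewrite sqrt_1; lra]. }
    unfold Rpower in H0 at 2. rewrite ln_1, Rmult_0_r, exp_0 in H0. lra.
Qed.

End Velocity.

(** * Trigonometric polynomials and the fields they generate *)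

Notation mode := (R * (Z * Z))%type.

Definition ph (j : Z * Z) (x : R2) : R := IZR (fst j) * fst x + IZR (snd j) * snd x.

Definition csum (L : list mode) (x : R2) : R := lsum (fun e => fst e * cos (ph (snd e) x)) L.

Definition trig (f : R2 -> R) : Prop := exists L, forall x, f x = csum L x.

Lemma trig_ext f g : (forall x, f x = g x) -> trig f -> trig g.
Proof. intros E [L H]. exists L. intros x. now rewrite <- E. Qed.

Lemma trig_plus f g : trig f -> trig g -> trig (fun x => f x + g x).
Proof.
  intros [L H] [L' H']. exists (L ++ L'). intros x. unfold csum. rewrite lsum_app, H, H'. reflexivity.
Qed.

Lemma trig_scal c f : trig f -> trig (fun x => c * f x).
Proof.
  intros [L H]. exists (map (fun e => (c * fst e, snd e)) L). intros x.
  rewrite H. unfold csum. rewrite lsum_map, <- lsum_scal. apply lsum_ext. intros; simpl; ring.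
Qed.

Lemma trig_mul_cos m f : trig f -> trig (fun x => cos (ph m x) * f x).
Proof.
  intros [L H].
  exists (map (fun e => (fst e / 2, ((fst (snd e) + fst m)%Z, (snd (snd e) + snd m)%Z))) L
    ++ map (fun e => (fst e / 2, ((fst (snd e) - fst m)%Z, (snd (snd e) - snd m)%Z))) L).
  intros x. rewrite H. unfold csum. rewrite lsum_app, !lsum_map, <- lsum_plus, <- lsum_scal.
  apply lsum_ext. intros [c j] _. simpl. unfold ph; simpl.
  rewrite !plus_IZR, !minus_IZR.
  set (a := IZR (fst m) * fst x + IZR (snd m) * snd x).
  set (b := IZR (fst j) * fst x + IZR (snd j) * snd x).
  replace (_ * fst x + _ * snd x) with (b + a) by (unfold a, b; ring).
  replace ((IZR (fst j) - IZR (fst m)) * fst x + (IZR (snd j) - IZR (snd m)) * snd x)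
    with (b - a) by (unfold a, b; ring).
  rewrite cos_plus, cos_minus. field.
Qed.

Lemma mcos2_double x y : mcos2 x y = / 2 + / 4 * (cos (2 * x) + cos (2 * y)).
Proof. unfold mcos2. rewrite !cos_2a_cos. field. Qed.

Lemma trig_mul_mcos2 f : trig f -> trig (fun x => mcos2 (fst x) (snd x) * f x).
Proof.
  intros H.
  apply trig_ext with (fun x => / 2 * f x + / 4 * (cos (ph (2, 0)%Z x) * f x + cos (ph (0, 2)%Z x) * f x)).
  - intros x. rewrite mcos2_double. unfold ph; simpl.
    replace (2 * fst x + 0 * snd x) with (2 * fst x) by ring.
    replace (0 * fst x + 2 * snd x) with (2 * snd x) by ring. ring.
  - apply trig_plus; [now apply trig_scal|]. apply trig_scal, trig_plus; now apply trig_mul_cos.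
Qed.

Lemma trig_mul_mcos2_pow n f : trig f -> trig (fun x => mcos2 (fst x) (snd x) ^ n * f x).
Proof.
  intros H. induction n as [|n IH].
  - apply trig_ext with (2 := H). intros; simpl; ring.
  - apply trig_mul_mcos2 in IH. apply trig_ext with (2 := IH). intros; simpl; ring.
Qed.

Lemma trig_sin_sin : trig (fun x => sin (fst x) * sin (snd x)).
Proof.
  exists ((/ 2, (1, -1)%Z) :: (- / 2, (1, 1)%Z) :: nil). intros x. unfold csum, ph; simpl.
  replace (1 * fst x + -1 * snd x) with (fst x - snd x) by ring.
  replace (1 * fst x + 1 * snd x) with (fst x + snd x) by ring.
  rewrite cos_plus, cos_minus. field.
Qed.

(** Every partial sum is a cosine polynomial with integer frequencies, the form required by the
    Galerkin scheme on [Z^2]. *)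
Lemma trig_stream A p N :
  trig (fun x => A * (sin (fst x) * sin (snd x)) * SN p N (mcos2 (fst x) (snd x))).
Proof.
  induction N as [|N IH].
  - apply trig_ext with (fun x => A * (sin (fst x) * sin (snd x))).
    + intros; simpl; ring.
    + apply trig_scal, trig_sin_sin.
  - apply trig_ext with (fun x => A * (sin (fst x) * sin (snd x)) * SN p N (mcos2 (fst x) (snd x))
      + A * cn p (S N) * (mcos2 (fst x) (snd x) ^ S N * (sin (fst x) * sin (snd x)))).
    + intros x. cbn [SN]. ring.
    + apply trig_plus; auto. apply trig_scal, trig_mul_mcos2_pow, trig_sin_sin.
Qed.

(* Perpendicular gradient of the stream function [csum L]. *)
Definition field (L : list mode) (x : R2) : R2 :=
  (lsum (fun e => fst e * IZR (snd (snd e)) * sin (ph (snd e) x)) L,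
   lsum (fun e => - (fst e * IZR (fst (snd e))) * sin (ph (snd e) x)) L).

Lemma csum_d2 L x y :
  derivable_pt_lim (fun y => csum L (x, y)) y (- fst (field L (x, y))).
Proof.
  assert (E : - fst (field L (x, y)) =
    lsum (fun e : mode => fst e * (- sin (ph (snd e) (x, y)) * IZR (snd (snd e)))) L).
  { unfold field. simpl fst at 1.
    replace (- lsum _ L) with (-1 * lsum (fun e : mode => fst e * IZR (snd (snd e)) * sin (ph (snd e) (x, y))) L)
      by ring.
    rewrite <- lsum_scal. apply lsum_ext. intros; ring. }
  rewrite E. unfold csum.
  apply (lsum_derive (fun e y => fst e * cos (ph (snd e) (x, y)))). intros e _.
  apply is_derive_Reals. unfold ph; simpl. auto_derive; auto. ring.
Qed.

Lemma csum_d1 L x y :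
  derivable_pt_lim (fun x => csum L (x, y)) x (snd (field L (x, y))).
Proof.
  unfold csum, field. simpl snd at 1.
  apply (lsum_derive (fun e x => fst e * cos (ph (snd e) (x, y)))). intros e _.
  apply is_derive_Reals. unfold ph; simpl. auto_derive; auto. ring.
Qed.

Lemma stream_d2 A p N x y :
  is_derive (fun y => A * (sin x * sin y) * SN p N (mcos2 x y)) y (A * vel p N x y).
Proof.
  assert (H0 : ex_derive (fun z => SN p N z) (mcos2 x y)) by (eexists; apply SN_derive).
  pose proof (is_derive_unique _ _ _ (SN_derive p N (mcos2 x y))) as E0.
  unfold vel, mcos2 in *. auto_derive.
  - repeat split; auto.
  - simpl in *. unfold Rdiv in *. change (fun x : R => SN p N x) with (SN p N).
    rewrite E0. field.
Qed.

(** Both sides are derivatives of the same stream function, so uniqueness of the derivative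
    identifies them and the Fourier coefficients are never computed. *)
Lemma field_stream A p N : exists L, forall x y,
  field L (x, y) = (- A * vel p N x y, A * vel p N y x).
Proof.
  destruct (trig_stream A p N) as [L H]. exists L. intros x y.
  rewrite (surjective_pairing (field L (x, y))). f_equal.
  - assert (E : - fst (field L (x, y)) = A * vel p N x y); [|lra].
    apply (uniqueness_limite (fun y => csum L (x, y)) y); [apply csum_d2|].
    apply derivable_pt_lim_ext with (fun y => A * (sin x * sin y) * SN p N (mcos2 x y)).
    + intros z. exact (H (x, z)).
    + apply is_derive_Reals, stream_d2.
  - apply (uniqueness_limite (fun x => csum L (x, y)) x); [apply csum_d1|].
    apply derivable_pt_lim_ext with (fun x => A * (sin y * sin x) * SN p N (mcos2 y x)).
    + intros z. rewrite <- (H (z, y)). simpl. rewrite (mcos2_sym y z). ring.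
    + apply is_derive_Reals, stream_d2.
Qed.

(* The phase [phi] makes the class closed under differentiation. *)
Definition tsum (L : list (R * (R * R))) (phi : R) (x : R2) : R :=
  lsum (fun e => fst e * sin (fst (snd e) * fst x + snd (snd e) * snd x + phi)) L.

Lemma tsum_d1 L phi x : derivable_pt_lim (fun h => tsum L phi (fst x + h, snd x)) 0
  (tsum (map (fun e => (fst e * fst (snd e), snd e)) L) (phi + PI / 2) x).
Proof.
  unfold tsum. rewrite lsum_map.
  apply (lsum_derive (fun e h => fst e * sin (fst (snd e) * (fst x + h) + snd (snd e) * snd x + phi))).
  intros [c [a b]] _; simpl. apply is_derive_Reals. auto_derive; auto.
  rewrite Rplus_0_r, <- Rplus_assoc.
  replace (a * fst x + b * snd x + phi + PI / 2) with (PI / 2 + (a * fst x + b * snd x + phi)) by ring.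
  rewrite <- cos_sin. ring.
Qed.

Lemma tsum_d2 L phi x : derivable_pt_lim (fun h => tsum L phi (fst x, snd x + h)) 0
  (tsum (map (fun e => (fst e * snd (snd e), snd e)) L) (phi + PI / 2) x).
Proof.
  unfold tsum. rewrite lsum_map.
  apply (lsum_derive (fun e h => fst e * sin (fst (snd e) * fst x + snd (snd e) * (snd x + h) + phi))).
  intros [c [a b]] _; simpl. apply is_derive_Reals. auto_derive; auto.
  rewrite Rplus_0_r, <- Rplus_assoc.
  replace (a * fst x + b * snd x + phi + PI / 2) with (PI / 2 + (a * fst x + b * snd x + phi)) by ring.
  rewrite <- cos_sin. ring.
Qed.

Lemma tsum_lip L phi x y :
  Rabs (tsum L phi y - tsum L phi x)
    <= lsum (fun e => Rabs (fst e) * (Rabs (fst (snd e)) + Rabs (snd (snd e)))) L * dist2 x y.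
Proof.
  unfold tsum. rewrite <- lsum_minus. apply Rle_trans with (1 := lsum_abs _ _).
  rewrite Rmult_comm, <- lsum_scal. apply lsum_le. intros [c [a b]] _; simpl.
  rewrite <- Rmult_minus_distr_l, Rabs_mult, (Rmult_comm (dist2 x y)), Rmult_assoc.
  apply Rmult_le_compat_l; [apply Rabs_pos|].
  apply Rle_trans with (1 := Rabs_sin_diff _ _).
  replace (_ - _) with (- (a * (fst x - fst y) + b * (snd x - snd y))) by ring.
  rewrite Rabs_Ropp. apply Rle_trans with (1 := Rabs_triang _ _). rewrite !Rabs_mult.
  rewrite Rmult_plus_distr_r.
  apply Rplus_le_compat; (apply Rmult_le_compat_l; [apply Rabs_pos|]).
  - apply (fst_le_norm2 (fst x - fst y, snd x - snd y)).
  - apply (snd_le_norm2 (fst x - fst y, snd x - snd y)).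
Qed.

Lemma lip_cont_on (f : R2 -> R) K : (forall x y, Rabs (f y - f x) <= K * dist2 x y) ->
  cont_on dist2 (fun _ => True) f.
Proof.
  intros H x _ eps He. set (k := Rabs K + 1).
  assert (Hk : 0 < k) by (unfold k; generalize (Rabs_pos K); lra).
  exists (eps / k). split; [now apply Rdiv_lt_0_compat|].
  intros y _ Hd. apply Rle_lt_trans with (1 := H x y).
  apply Rle_lt_trans with (k * dist2 x y).
  - apply Rmult_le_compat_r; [apply dist2_nonneg|]. unfold k. generalize (Rle_abs K); lra.
  - replace eps with (k * (eps / k)) by (field; lra). now apply Rmult_lt_compat_l.
Qed.

Lemma tsum_smooth L phi : smooth2 (tsum L phi).
Proof.
  intros k. revert L phi. induction k as [|k IH]; intros L phi.
  - simpl. eapply lip_cont_on. intros; apply tsum_lip.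
  - split; [eapply lip_cont_on; intros; apply tsum_lip|].
    repeat constructor.
    + eexists. split; [intros x _; apply tsum_d1|apply IH].
    + eexists. split; [intros x _; apply tsum_d2|apply IH].
Qed.

Lemma Ck_ext {X} (d : X -> X -> R) dirs U k : forall f g : X -> R,
  (forall x, f x = g x) -> Ck d dirs U k f -> Ck d dirs U k g.
Proof.
  induction k as [|k IH]; intros f g E; simpl.
  - intros H x Hx eps He. destruct (H x Hx eps He) as (dl & Hd & Hf).
    exists dl. split; auto. intros y Hy Hxy. rewrite <- !E. auto.
  - intros [H1 H2]. split.
    + intros x Hx eps He. destruct (H1 x Hx eps He) as (dl & Hd & Hf).
      exists dl. split; auto. intros y Hy Hxy. rewrite <- !E. auto.
    + revert H2. apply Forall_impl. intros e (h & Hh & Hk). exists h. split; auto.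
      intros x Hx. apply derivable_pt_lim_ext with (2 := Hh x Hx). auto.
Qed.

Lemma field_tsum1 L x : fst (field L x) = tsum (map (fun e : mode =>
  (fst e * IZR (snd (snd e)), (IZR (fst (snd e)), IZR (snd (snd e))))) L) 0 x.
Proof.
  unfold field, tsum; simpl. rewrite lsum_map. apply lsum_ext. intros e _. simpl.
  rewrite Rplus_0_r. reflexivity.
Qed.

Lemma field_tsum2 L x : snd (field L x) = tsum (map (fun e : mode =>
  (- (fst e * IZR (fst (snd e))), (IZR (fst (snd e)), IZR (snd (snd e))))) L) 0 x.
Proof.
  unfold field, tsum; simpl. rewrite lsum_map. apply lsum_ext. intros e _. simpl.
  rewrite Rplus_0_r. reflexivity.
Qed.

Lemma field_smooth L : smooth_field (field L).
Proof.
  split; intros k.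
  - apply Ck_ext with (1 := fun x => eq_sym (field_tsum1 L x)). apply tsum_smooth.
  - apply Ck_ext with (1 := fun x => eq_sym (field_tsum2 L x)). apply tsum_smooth.
Qed.

Lemma field_div_free L : div_free (field L).
Proof.
  intros x. do 2 eexists. split; [|split].
  - apply derivable_pt_lim_ext with (1 := fun h => eq_sym (field_tsum1 L _)). apply tsum_d1.
  - apply derivable_pt_lim_ext with (1 := fun h => eq_sym (field_tsum2 L _)). apply tsum_d2.
  - unfold tsum. rewrite !lsum_map, <- lsum_plus, <- (lsum_zero L).
    apply lsum_ext. intros e _. simpl. ring.
Qed.

(** * Inflow along the axis: monotonicity, lower bounds and the deviation off the axis *)

Section Flow.
Variables (p : R) (N : nat).
Hypotheses (Hp : 0 < p) (Hp' : p < 1 / 2).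

(* [A * speed x] is the speed towards the origin along the [x]-axis. *)
Definition speed (x : R) : R := sin x * SN p N (1 - sin x ^ 2 / 2).

Lemma mcos2_axis x : mcos2 x 0 = 1 - sin x ^ 2 / 2.
Proof. unfold mcos2. rewrite cos_0, sin_sq. simpl. field. Qed.

Lemma axis_range x : 0 <= 1 - sin x ^ 2 / 2.
Proof. rewrite <- mcos2_axis. apply mcos2_bounds. Qed.

(** The derivative is again a bracket of [bracket_bounds], in the extreme case
    [b = z^2 = 2 (1 - v)]. *)
Lemma profile_mono a b : 0 <= a -> a <= b -> b <= 1 ->
  a * SN p N (1 - a ^ 2 / 2) <= b * SN p N (1 - b ^ 2 / 2).
Proof.
  intros Ha Hab Hb.
  apply (mono_of_deriv (fun z => z * SN p N (1 - z ^ 2 / 2))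
    (fun z => SN p N (1 - z ^ 2 / 2) - z ^ 2 * SN1 p N (1 - z ^ 2 / 2))); auto.
  - intros z Hz.
    assert (H0 : ex_derive (fun z => SN p N z) (1 - z ^ 2 / 2)) by (eexists; apply SN_derive).
    pose proof (is_derive_unique _ _ _ (SN_derive p N (1 - z ^ 2 / 2))) as E0.
    auto_derive.
    + repeat split; auto.
    + simpl in *. unfold Rdiv in *. change (fun x : R => SN p N x) with (SN p N).
      unfold Rminus in E0. rewrite E0. unfold Rminus. field.
  - intros z Hz. assert (z ^ 2 <= 1) by (simpl; nra). pose proof (pow2_ge_0 z).
    pose proof (bracket_bounds p N Hp Hp' (z ^ 2) (1 - z ^ 2 / 2) ltac:(lra) ltac:(lra) ltac:(lra)).
    nra.
Qed.

Lemma sin_01 x : 0 <= x <= PI / 2 -> 0 <= sin x <= 1.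
Proof.
  intros H. split; [apply sin_ge_0; lra|apply SIN_bound].
Qed.

Lemma speed_mono x y : 0 <= x -> x <= y -> y <= PI / 2 -> speed x <= speed y.
Proof.
  intros H1 H2 H3. pose proof (sin_01 x ltac:(lra)). pose proof (sin_01 y ltac:(lra)).
  unfold speed. apply profile_mono; try lra. apply sin_incr_1; lra.
Qed.

Lemma xcos_le_sin x : 0 <= x <= PI / 2 -> x * cos x <= sin x.
Proof.
  intros Hx.
  assert (0 - 0 * cos 0 <= sin x - x * cos x); [|lra].
  rewrite <- sin_0 at 1.
  apply (mono_of_deriv (fun x => sin x - x * cos x) (fun x => x * sin x)); [lra| |].
  - intros z Hz. auto_derive; auto. ring.
  - intros z Hz. apply Rmult_le_pos; [lra|]. apply sin_ge_0; lra.
Qed.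

Lemma sin_ratio X x : 0 < X -> X <= x -> x <= PI / 2 -> sin x * X <= sin X * x.
Proof.
  intros HX Hx Hx'.
  assert (H : - (sin X / X) <= - (sin x / x)).
  { apply (mono_of_deriv (fun x => - (sin x / x)) (fun x => (sin x - x * cos x) / x ^ 2)); auto.
    - intros z Hz. auto_derive; [lra|]. field. lra.
    - intros z Hz. apply Rmult_le_pos.
      + pose proof (xcos_le_sin z ltac:(lra)). lra.
      + apply Rlt_le, Rinv_0_lt_compat. simpl. nra. }
  apply Rmult_le_compat_r with (r := x * X) in H; [|nra].
  replace (- (sin X / X) * (x * X)) with (- (sin X * x)) in H by (field; lra).
  replace (- (sin x / x) * (x * X)) with (- (sin x * X)) in H by (field; lra). lra.
Qed.

(** The quotient [speed x / x] is nonincreasing, as a product of [sin x / x] and of [SN], which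
    decreases away from the origin. Compared with the rigid contraction of the bump, points beyond
    its centre lag behind and points before it run ahead. *)
Lemma speed_ratio X x : 0 < X -> X <= x -> x <= PI / 2 -> speed x * X <= speed X * x.
Proof.
  intros HX Hx Hx'. unfold speed.
  pose proof (sin_01 X ltac:(lra)) as S2.
  assert (Hs : sin X <= sin x) by (apply sin_incr_1; lra).
  pose proof (sin_ratio X x HX Hx Hx').
  assert (HS : SN p N (1 - sin x ^ 2 / 2) <= SN p N (1 - sin X ^ 2 / 2)).
  { apply SN_mono; auto; [apply axis_range|].
    assert (sin X ^ 2 <= sin x ^ 2) by (apply pow_incr; lra). lra. }
  pose proof (SN_ge1 p Hp Hp' N (1 - sin x ^ 2 / 2) (axis_range x)).
  replace (sin x * SN p N (1 - sin x ^ 2 / 2) * X)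
    with (sin x * X * SN p N (1 - sin x ^ 2 / 2)) by ring.
  replace (sin X * SN p N (1 - sin X ^ 2 / 2) * x)
    with (sin X * x * SN p N (1 - sin X ^ 2 / 2)) by ring.
  apply Rmult_le_compat; try lra. apply Rmult_le_pos; lra.
Qed.

Lemma sin_sq_le y : sin y ^ 2 <= y ^ 2.
Proof.
  rewrite <- (pow2_abs (sin y)), <- (pow2_abs y). apply pow_incr. split; [apply Rabs_pos|].
  pose proof (Rabs_sin_diff y 0) as H. rewrite sin_0, !Rminus_0_r in H. exact H.
Qed.

Lemma one_minus_cos y : 1 - cos y <= y ^ 2 / 2.
Proof.
  replace y with (2 * (y / 2)) at 1 by field. rewrite cos_2a_sin.
  pose proof (sin_sq_le (y / 2)). simpl in *. nra.
Qed.

(** The deficit off the axis is quadratic in [y]. The cosine contributes [1/2]; the decrease of [SN]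
    and the term in [SN1] contribute [3/2 y^2 SN1], and [SN1 <= 2 p / sin x ^ 2 * SN] turns this
    into [3 p / sin x ^ 2]. *)
Lemma speed_gap x y : 0 < x < PI / 2 -> - PI / 2 <= y <= PI / 2 ->
  0 <= speed x - vel p N x y <= speed x * (y ^ 2 * (1 / 2 + 3 * p / sin x ^ 2)).
Proof.
  intros Hx Hy. unfold speed, vel.
  set (v0 := 1 - sin x ^ 2 / 2). set (v := mcos2 x y).
  assert (Hv0 : 0 <= v0) by apply axis_range.
  assert (Hv : 0 <= v) by apply mcos2_bounds.
  assert (Ev : v0 - v = sin y ^ 2 / 2).
  { pose proof (one_minus_mcos2 x y). unfold v, v0. lra. }
  assert (Hsx : 0 < sin x) by (apply sin_gt_0; lra).
  assert (Hsx2 : 0 < sin x ^ 2) by (apply pow_lt; auto).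
  assert (Hcy : 0 <= cos y <= 1) by (split; [apply cos_ge_0; lra|apply COS_bound]).
  pose proof (pow2_ge_0 (sin y)) as Hsy. pose proof (sin_sq_le y) as Hsy'.
  pose proof (one_minus_cos y) as Hcos.
  pose proof (SN_mono p Hp Hp' N v v0 Hv ltac:(lra)) as M0.
  pose proof (SN1_mono p Hp Hp' N v v0 Hv ltac:(lra)) as M1.
  pose proof (SN1_nonneg p Hp Hp' N v Hv) as P1.
  pose proof (SN_ge1 p Hp Hp' N v Hv) as P0.
  pose proof (SN1_le p Hp Hp' N v0 Hv0) as HL.
  assert (HL' : SN1 p N v0 <= 2 * p / sin x ^ 2 * SN p N v0).
  { replace (1 - v0) with (sin x ^ 2 / 2) in HL by (unfold v0; ring).
    apply Rmult_le_reg_r with (sin x ^ 2); auto.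
    replace (2 * p / sin x ^ 2 * SN p N v0 * sin x ^ 2) with (2 * (p * SN p N v0)) by (field; lra).
    lra. }
  assert (Hdiff : SN p N v0 - SN p N v <= SN1 p N v0 * (y ^ 2 / 2)).
  { destruct (Req_dec v v0) as [E|Hne].
    - rewrite E, Rminus_diag. apply Rmult_le_pos; [lra|]. lra.
    - destruct (MVT_cor2 (SN p N) (SN1 p N) v v0) as (z & E & Hz); [lra| |].
      { intros. apply is_derive_Reals, SN_derive. }
      rewrite E, Ev. apply Rmult_le_compat; try lra.
      + apply SN1_nonneg; auto. lra.
      + apply SN1_mono; auto; lra. }
  set (S0 := SN p N v0) in *. set (S1 := SN1 p N v0) in *.
  set (T0 := SN p N v) in *. set (T1 := SN1 p N v) in *.
  replace (sin x * S0 - sin x * cos y * (T0 - sin y ^ 2 * T1))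
    with (sin x * ((S0 - T0) + (1 - cos y) * T0 + cos y * (sin y ^ 2 * T1))) by ring.
  rewrite Rmult_assoc.
  assert (A1 : 0 <= sin y ^ 2 * T1) by (apply Rmult_le_pos; auto).
  assert (A2 : 0 <= cos y * (sin y ^ 2 * T1)) by (apply Rmult_le_pos; tauto).
  assert (A3 : 0 <= (1 - cos y) * T0) by (apply Rmult_le_pos; lra).
  split.
  - apply Rmult_le_pos; lra.
  - apply Rmult_le_compat_l; [lra|].
    assert (B1 : cos y * (sin y ^ 2 * T1) <= y ^ 2 * S1).
    { rewrite <- (Rmult_1_l (y ^ 2 * S1)). apply Rmult_le_compat; try lra.
      apply Rmult_le_compat; lra. }
    assert (B2 : (1 - cos y) * T0 <= y ^ 2 / 2 * S0) by (apply Rmult_le_compat; lra).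
    assert (B3 : S1 * (3 / 2 * y ^ 2) <= 2 * p / sin x ^ 2 * S0 * (3 / 2 * y ^ 2)).
    { apply Rmult_le_compat_r; lra. }
    replace (S0 * (y ^ 2 * (1 / 2 + 3 * p / sin x ^ 2)))
      with (y ^ 2 / 2 * S0 + 2 * p / sin x ^ 2 * S0 * (3 / 2 * y ^ 2)) by (field; lra).
    lra.
Qed.

(** The transverse velocity points away from the axis. Since the bump decreases away from the axis,
    this term has the favourable sign in the subsolution inequality. *)
Lemma vel_sign x y : - PI / 2 <= x <= PI / 2 -> - PI / 2 <= y <= PI / 2 -> 0 <= y * vel p N y x.
Proof.
  intros Hx Hy. unfold vel.
  pose proof (mcos2_bounds y x) as Hv.
  pose proof (sin_sq_le_mcos2 y x) as Hs.
  pose proof (bracket_bounds p N Hp Hp' (sin x ^ 2) (mcos2 y x) ltac:(lra) ltac:(lra) ltac:(lra)) as HB.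
  assert (0 <= SN p N (mcos2 y x) - sin x ^ 2 * SN1 p N (mcos2 y x)) by nra.
  assert (0 <= cos x) by (apply cos_ge_0; lra).
  assert (0 <= y * sin y).
  { destruct (Rle_dec 0 y).
    - apply Rmult_le_pos; auto. apply sin_ge_0; lra.
    - replace (y * sin y) with (- y * sin (- y)) by (rewrite sin_neg; ring).
      apply Rmult_le_pos; [lra|]. apply sin_ge_0; lra. }
  replace (y * _) with (y * sin y * cos x * (SN p N (mcos2 y x) - sin x ^ 2 * SN1 p N (mcos2 y x))) by ring.
  apply Rmult_le_pos; auto. now apply Rmult_le_pos.
Qed.

(** The condition on [N] is imposed at [e] only and passes to all larger [x], because
    [1 - sin x ^ 2 / 2] decreases. *)
Lemma speed_lower e x : 0 < e -> e <= x -> x <= PI / 2 ->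
  (1 + INR N) * (1 - sin e ^ 2 / 2) ^ N <= sin e ^ 2 / 4 ->
  Rpower (sin x) (1 - 2 * p) / 2 <= speed x.
Proof.
  intros He Hx Hx' HN. unfold speed.
  assert (Hse : 0 < sin e) by (apply sin_gt_0; lra).
  assert (Hs : sin e <= sin x) by (apply sin_incr_1; lra).
  assert (Hsq : sin e ^ 2 <= sin x ^ 2) by (apply pow_incr; lra).
  assert (Hsq0 : 0 < sin x ^ 2) by (apply pow_lt; lra).
  pose proof (axis_range x) as Hr.
  assert (H : Rpower (1 - (1 - sin x ^ 2 / 2)) (- p) / 2 <= SN p N (1 - sin x ^ 2 / 2)).
  { apply SN_lower; auto; [lra|].
    apply Rle_trans with ((1 + INR N) * (1 - sin e ^ 2 / 2) ^ N).
    - apply Rmult_le_compat_l; [generalize (pos_INR N); lra|]. apply pow_incr. lra.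
    - lra. }
  replace (1 - (1 - sin x ^ 2 / 2)) with (sin x ^ 2 / 2) in H by ring.
  assert (H2 : Rpower (sin x) (- (2 * p)) <= Rpower (sin x ^ 2 / 2) (- p)).
  { apply Rle_trans with (Rpower (sin x ^ 2) (- p)).
    - right. replace (sin x ^ 2) with (Rpower (sin x) 2).
      + rewrite Rpower_mult. f_equal. ring.
      + rewrite <- (Rpower_pow 2) by lra. reflexivity.
    - apply Rpower_le_neg; lra. }
  replace (1 - 2 * p) with (1 + - (2 * p)) by ring. rewrite Rpower_plus, Rpower_1 by lra.
  unfold Rdiv. rewrite Rmult_assoc. apply Rmult_le_compat_l; lra.
Qed.

Lemma speed_derive x : exists l, is_derive speed x l.
Proof.
  assert (H0 : ex_derive (fun z => SN p N z) (1 - sin x ^ 2 / 2)) by (eexists; apply SN_derive).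
  unfold speed. assert (H : ex_derive (fun x => sin x * SN p N (1 - sin x ^ 2 / 2)) x).
  { auto_derive. auto. }
  destruct H as [l Hl]. now exists l.
Qed.

End Flow.

(** * Moving barrier *)

Lemma wsol_neg s c u theta T M :
  wsol s c u theta T M -> wsol s c u (fun t x => - theta t x) T M.
Proof.
  intros (H1 & H2 & H3). split; [|split].
  - intros q Hq eps He. destruct (H1 q Hq eps He) as (d & Hd & H). exists d. split; auto.
    intros y Hy Hqy. replace (_ - _) with (- (theta (fst y) (snd y) - theta (fst q) (snd q))) by ring.
    rewrite Rabs_Ropp. auto.
  - intros t x Ht. rewrite Rabs_Ropp. auto.
  - intros t x Ht. destruct (H3 t x Ht) as (dt & d1 & d2 & L & D0 & D1 & D2 & HL & E).
    exists (- dt), (- d1), (- d2), (- L). repeat split.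
    + now apply derivable_pt_lim_opp.
    + now apply derivable_pt_lim_opp.
    + now apply derivable_pt_lim_opp.
    + apply pv_ext with (fun y => 0 + -1 * theta t y); [intros; ring|].
      replace (- L) with (0 + -1 * L) by ring. apply pv_lin; auto. apply zero_pv.
    + lra.
Qed.

(** Comparison with a constant and the trivial time change. As [Kc] requires positive bounds, the
    constant is given a profile of size [e] whose cost is below [kap]; dividing by [c + 1] covers
    [c = 0]. *)
Lemma wsol_lower s c u theta M U m t x : 0 < s -> s < 1 / 2 -> 0 <= c ->
  (forall x, Rabs (fst (u x)) <= U /\ Rabs (snd (u x)) <= U) ->
  0 < t -> wsol s c u theta t M -> (forall x, m <= theta 0 x) -> m <= theta t x.
Proof.
  intros Hs Hs' Hc HU Ht Hsol Hm.
  refine (comparison s c U M m 1 t u theta (fun z => z) (fun _ => 1) (fun _ _ => m)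
    Hs Hs' Hc Ht HU eq_refl _ Hsol _ _ Hm _ t x _); try lra.
  - intros z Hz. split; [apply derivable_pt_lim_id|lra].
  - intros z y Hz eps He. exists 1. split; [lra|]. intros. rewrite Rminus_diag, Rabs_R0. auto.
  - intros; lra.
  - intros z y kap Hz Hk _.
    assert (Hk' : 0 < kap / (c + 1)) by (apply Rdiv_lt_0_compat; lra).
    destruct (Kc_small s (kap / (c + 1)) Hs Hs' Hk') as (e & He & HKe).
    exists 0, 0, 0, e, e. repeat split; auto; try apply derivable_pt_lim_const.
    + intros w. rewrite Rminus_diag. apply Rmin_glb; [lra|].
      apply Rmult_le_pos; [lra|apply dist2_nonneg].
    + rewrite !Rmult_0_r, !Rplus_0_l, Rmult_1_l.
      pose proof (Kc_pos s e e Hs Hs' He He).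
      apply Rle_trans with ((c + 1) * (kap / (c + 1))); [|right; field; lra].
      apply Rmult_le_compat; lra.
Qed.

Lemma cont3_const S k : cont3 S (fun _ _ => k).
Proof.
  intros t x Ht eps He. exists 1. split; [lra|]. intros. rewrite Rminus_diag, Rabs_R0. auto.
Qed.

Lemma cont3_comp S (h : R -> R) f : cont3 S f ->
  (forall t x, 0 <= t <= S -> continuity_pt h (f t x)) -> cont3 S (fun t x => h (f t x)).
Proof.
  intros Hf Hh t x Ht eps He.
  destruct (Hh t x Ht eps He) as (d & Hd & H).
  destruct (Hf t x Ht d Hd) as (d' & Hd' & H'). exists d'. split; auto.
  intros t' x' Ht' A1 A2 A3.
  destruct (Req_dec (f t' x') (f t x)) as [->|Hne].
  - rewrite Rminus_diag, Rabs_R0. auto.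
  - apply (H (f t' x')). split; [split; [exact I|auto]|]. simpl. unfold R_dist. auto.
Qed.

(** Polarization reduces products to squares, that is, to composition with a continuous function of
    one variable. *)
Lemma cont3_mult S f g : cont3 S f -> cont3 S g -> cont3 S (fun t x => f t x * g t x).
Proof.
  assert (Sq : forall f, cont3 S f -> cont3 S (fun t x => Rsqr (f t x))).
  { intros h Hh. apply (cont3_comp S Rsqr); auto. intros. apply derivable_continuous_pt.
    apply derivable_pt_Rsqr. }
  intros Hf Hg.
  assert (H : cont3 S (fun t x => / 4 * (Rsqr (f t x + g t x) + - Rsqr (f t x + - g t x)))).
  { apply (cont3_comp S (fun z => / 4 * z)).
    - apply cont3_plus; [|apply cont3_opp]; apply Sq, cont3_plus; auto. now apply cont3_opp.
    - intros. apply derivable_continuous_pt. apply derivable_pt_scal. apply derivable_pt_id. }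
  intros t x Ht eps He. destruct (H t x Ht eps He) as (d & Hd & Hh). exists d. split; auto.
  intros t' x' B0 B1 B2 B3. specialize (Hh t' x' B0 B1 B2 B3). unfold Rsqr in Hh.
  replace (f t' x' * g t' x' - f t x * g t x) with
    (/ 4 * ((f t' x' + g t' x') * (f t' x' + g t' x') + - ((f t' x' + - g t' x') * (f t' x' + - g t' x')))
     - / 4 * ((f t x + g t x) * (f t x + g t x) + - ((f t x + - g t x) * (f t x + - g t x)))) by field.
  exact Hh.
Qed.

Lemma cont3_time S : cont3 S (fun t _ => t).
Proof.
  intros t x Ht eps He. exists eps. auto.
Qed.
Lemma cont3_fst S : cont3 S (fun _ x => fst x).
Proof.
  intros t x Ht eps He. exists eps. auto.
Qed.
Lemma cont3_snd S : cont3 S (fun _ x => snd x).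
Proof.
  intros t x Ht eps He. exists eps. auto.
Qed.

Lemma Rmax0_continuous z : continuity_pt (Rmax 0) z.
Proof.
  apply continuity_pt_filterlim. apply (lip_continuous (Rmax 0) 1). intros y.
  unfold Rmax. repeat destruct Rle_dec; unfold Rabs; repeat destruct Rcase_abs; lra.
Qed.

Lemma Rmax0_derive (q : R -> R) x l : 0 < q x -> derivable_pt_lim q x l ->
  derivable_pt_lim (fun t => Rmax 0 (q t)) x l.
Proof.
  intros Hq Hd eps He.
  assert (Hc : continuity_pt q x) by (apply derivable_continuous_pt; eexists; exact Hd).
  destruct (Hc (q x) Hq) as (d1 & Hd1 & H1).
  destruct (Hd eps He) as [d2 H2].
  assert (Hm : 0 < Rmin d1 d2) by (apply Rmin_pos; auto; apply cond_pos).
  exists (mkposreal _ Hm). simpl. intros h Hh0 Hh.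
  pose proof (Rmin_l d1 d2). pose proof (Rmin_r d1 d2).
  assert (0 < q (x + h)).
  { specialize (H1 (x + h)). simpl in H1. unfold R_dist in H1.
    assert (Rabs (q (x + h) - q x) < q x).
    { apply H1. split.
      - split; [exact I|lra].
      - replace (x + h - x) with h by ring. lra. }
    apply Rabs_def2 in H3. lra. }
  rewrite !Rmax_right by lra. apply H2; auto. lra.
Qed.

Lemma vel_odd p N x y : vel p N (- x) y = - vel p N x y.
Proof. unfold vel, mcos2. rewrite sin_neg, cos_neg. ring. Qed.
Lemma vel_even p N x y : vel p N x (- y) = vel p N x y.
Proof. unfold vel, mcos2. rewrite sin_neg, cos_neg. f_equal. f_equal. ring. Qed.

Lemma sin_half x : 0 < x <= PI / 2 -> x / 2 <= sin x.
Proof.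
  intros Hx. pose proof (sin_ratio x (PI / 2) ltac:(lra) ltac:(lra) ltac:(lra)) as H.
  rewrite sin_PI2 in H. pose proof PI_4. nra.
Qed.

(** A bump of height [eta] and width of order [X] has nonlocal term of order [eta X^(-2s)]; the
    slope [40 eta / X] is the one of [barrier_osc]. *)
Lemma Kc_scale s eta X : 0 < eta -> 0 < X ->
  Kc s eta (40 * eta / X) = eta * Rpower X (- (2 * s)) * Kc s 1 40.
Proof.
  intros He HX. unfold Kc.
  replace (40 * eta / X / eta) with (40 * / X) by (field; lra).
  rewrite <- Rpower_mult_distr by (try apply Rinv_0_lt_compat; lra).
  rewrite <- Rpower_inv_base by auto. replace (40 / 1) with 40 by field. ring.
Qed.

Lemma derivable_pt_lim_eq f x l l' : l = l' -> derivable_pt_lim f x l -> derivable_pt_lim f x l'.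
Proof. now intros ->. Qed.

(** * The bump carried to the origin is a subsolution *)

Section Barrier.
Variables (s alpha c A X0 eps eta e : R) (N : nat) (u : R2 -> R2).
Hypotheses (Hs : 0 < s) (Hs' : s < 1 / 2) (Hal : 0 < alpha) (Hal' : alpha < 1 - 2 * s).
Hypotheses (Hc : 0 <= c) (HA : 0 < A) (Heta : 0 < eta).
Hypotheses (Heps : 0 < eps) (HepsX : eps < X0) (HX0 : X0 <= 1).
Hypothesis He : e = 1 \/ e = -1.

Let p := (1 - alpha) / 2.
(** [gam] is the exponent left after integrating [X^(-2s - alpha)]. [CL] is fixed by equating
    [A / 4 * X^alpha], the lower bound for the speed, times the derivative of [CL X^gam] with the
    dissipation [c X^(-2s) Kc s 1 40]. *)
Let gam := 1 - 2 * s - alpha.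
Let CL := c * Kc s 1 40 / (A / 4 * gam).
Let F x := A * speed p N x.
Let S := X0 - eps.

Hypothesis Hu : forall x y, u (x, y) = (- A * vel p N x y, A * vel p N y x).
Hypothesis HN : (1 + INR N) * (1 - sin eps ^ 2 / 2) ^ N <= sin eps ^ 2 / 4.

Local Lemma p_gt0 : 0 < p. Proof. unfold p; lra. Qed.
Local Lemma p_lt_half : p < 1 / 2. Proof. unfold p; lra. Qed.

Lemma half_PI_gt : 3 / 2 < PI / 2.
Proof. generalize PI2_3_2. lra. Qed.

(** One factor 1/2 comes from [speed_lower], the other from [sin X >= X / 2] and [alpha <= 1]. *)
Lemma F_lower X : eps <= X <= 1 -> A / 4 * Rpower X alpha <= F X.
Proof.
  intros HX. pose proof half_PI_gt.
  pose proof (speed_lower p N p_gt0 p_lt_half eps X Heps ltac:(lra) ltac:(lra) HN) as H1.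
  replace (1 - 2 * p) with alpha in H1 by (unfold p; field).
  pose proof (sin_half X ltac:(lra)) as Hsin.
  assert (H2 : Rpower (X / 2) alpha <= Rpower (sin X) alpha) by (apply Rpower_le_pos; lra).
  assert (H3 : Rpower X alpha / 2 <= Rpower (X / 2) alpha).
  { unfold Rdiv. rewrite <- Rpower_mult_distr by lra.
    apply Rmult_le_compat_l; [apply Rlt_le, exp_pos|].
    rewrite <- Rpower_inv_base, Rpower_Ropp by lra.
    apply Rinv_le_contravar; [apply exp_pos|].
    apply Rle_trans with (Rpower 2 1); [apply Rle_Rpower; lra|rewrite Rpower_1; lra]. }
  unfold F. replace (A / 4 * Rpower X alpha) with (A * (Rpower X alpha / 4)) by field.
  apply Rmult_le_compat_l; lra.
Qed.

Lemma F_pos x : 0 < x < PI -> 0 < F x.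
Proof.
  intros Hx. unfold F, speed. apply Rmult_lt_0_compat; auto.
  pose proof (sin_gt_0 x ltac:(lra) ltac:(lra)).
  pose proof (SN_ge1 p p_gt0 p_lt_half N (1 - sin x ^ 2 / 2) (axis_range x)).
  apply Rmult_lt_0_compat; lra.
Qed.

Let g t := / F (X0 - t).
(* The centre of the barrier is at [X = X0 - t] at the physical time [travel t]. *)
Definition travel (t : R) : R := RInt g 0 t.

(** The range reaches to the left of 0 so that [travel] has a two-sided derivative at 0. *)
Lemma g_continuous t : -1 < t < X0 -> continuous g t.
Proof.
  intros Ht. pose proof half_PI_gt.
  assert (HF : ex_derive F (X0 - t)).
  { destruct (speed_derive p N (X0 - t)) as [l Hl]. exists (A * l).
    apply (is_derive_scal (speed p N)). exact Hl. }
  apply (ex_derive_continuous g). unfold g. auto_derive. split; auto.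
  split; [|auto]. apply Rgt_not_eq, F_pos. lra.
Qed.

Lemma travel_derive t : 0 <= t <= S -> derivable_pt_lim travel t (g t).
Proof.
  intros Ht. unfold S in Ht. apply is_derive_Reals. unfold travel.
  apply (is_derive_RInt (V := R_NormedModule) g (fun t => RInt g 0 t) 0 t).
  - assert (Hd : 0 < Rmin 1 (X0 - t)) by (apply Rmin_pos; lra).
    exists (mkposreal _ Hd). intros y Hy. unfold ball in Hy; simpl in Hy.
    unfold AbsRing_ball, abs, minus, plus, opp in Hy; simpl in Hy. apply Rabs_def2 in Hy.
    pose proof (Rmin_r 1 (X0 - t)).
    apply (RInt_correct (V := R_CompleteNormedModule)).
    apply (ex_RInt_continuous (V := R_CompleteNormedModule)). intros z Hz. apply g_continuous.
    revert Hz. unfold Rmin, Rmax. repeat destruct Rle_dec; lra.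
  - apply g_continuous. lra.
Qed.

Lemma g_bounds t : 0 <= t <= S -> 0 < g t <= / F eps.
Proof.
  intros Ht. unfold S in Ht. pose proof half_PI_gt. unfold g. split.
  - apply Rinv_0_lt_compat, F_pos. lra.
  - apply Rinv_le_contravar; [apply F_pos; lra|]. unfold F.
    apply Rmult_le_compat_l; [lra|]. apply speed_mono; auto using p_gt0, p_lt_half; lra.
Qed.

(** The travel time is at most the integral of [1 / (A / 4 * X^alpha)] over [(0, 1)], finite as
    [alpha < 1]. The bound is free of [eps], [N] and [X0], which allows [T] to be fixed before
    [rho]. *)
Lemma travel_bound : travel S <= / (A / 4 * (1 - alpha)).
Proof.
  unfold S.
  assert (HI : RInt.is_RInt (fun z => Rpower z (1 - alpha - 1)) eps X0
     ((Rpower X0 (1 - alpha) - Rpower eps (1 - alpha)) / (1 - alpha))).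
  { apply RInt_power; lra. }
  apply Rle_trans with (travel 0 + / (A / 4) *
    ((Rpower X0 (1 - alpha) - Rpower (X0 - (X0 - eps)) (1 - alpha)) / (1 - alpha))).
  - assert (Hm : - travel (X0 - eps) + / (A / 4) * ((Rpower X0 (1 - alpha)
       - Rpower (X0 - (X0 - eps)) (1 - alpha)) / (1 - alpha)) >= - travel 0); [|lra].
    apply Rle_ge.
    replace (- travel 0) with (- travel 0 + / (A / 4) * ((Rpower X0 (1 - alpha)
       - Rpower (X0 - 0) (1 - alpha)) / (1 - alpha))) by (rewrite Rminus_0_r; field; lra).
    apply (mono_of_deriv (fun t => - travel t + / (A / 4) * ((Rpower X0 (1 - alpha)
       - Rpower (X0 - t) (1 - alpha)) / (1 - alpha)))
       (fun t => - g t + / (A / 4) * Rpower (X0 - t) (- alpha))); [lra| |].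
    + intros z Hz. apply is_derive_Reals. apply derivable_pt_lim_plus.
      * apply derivable_pt_lim_opp, travel_derive. unfold S. lra.
      * apply derivable_pt_lim_scal. apply is_derive_Reals.
        unfold Rpower. auto_derive; [lra|].
        replace (- alpha * ln (X0 - z)) with ((1 - alpha) * ln (X0 - z) + - ln (X0 - z)) by ring.
        change (X0 + - z) with (X0 - z). rewrite exp_plus, exp_Ropp, exp_ln by lra. field. lra.
    + intros z Hz. unfold g.
      assert (HX : eps <= X0 - z <= 1) by lra.
      pose proof (F_lower (X0 - z) HX) as HF.
      assert (0 < Rpower (X0 - z) alpha) by apply exp_pos.
      assert (/ F (X0 - z) <= / (A / 4 * Rpower (X0 - z) alpha)).
      { apply Rinv_le_contravar; auto. apply Rmult_lt_0_compat; lra. }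
      rewrite Rinv_mult in H0. rewrite <- Rpower_Ropp in H0. lra.
  - unfold travel at 1. rewrite RInt_point. change zero with 0. rewrite Rplus_0_l.
    rewrite Rinv_mult. apply Rmult_le_compat_l; [apply Rlt_le, Rinv_0_lt_compat; lra|].
    rewrite <- (Rmult_1_l (/ (1 - alpha))). apply Rmult_le_compat_r.
    + apply Rlt_le, Rinv_0_lt_compat; lra.
    + assert (Rpower X0 (1 - alpha) <= 1).
      { apply Rle_trans with (Rpower 1 (1 - alpha)).
        - apply Rpower_le_pos; lra.
        - unfold Rpower. rewrite ln_1, Rmult_0_r, exp_0. lra. }
      assert (0 < Rpower (X0 - (X0 - eps)) (1 - alpha)) by apply exp_pos. lra.
Qed.

Lemma travel_pos : 0 < travel S.
Proof.
  assert (HS : 0 < S) by (unfold S; lra).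
  destruct (MVT_cor2 travel g 0 S HS) as (z & E & Hz).
  { intros; now apply travel_derive. }
  assert (E0 : travel 0 = 0) by (unfold travel; rewrite RInt_point; reflexivity).
  rewrite E0 in E. destruct (g_bounds z ltac:(lra)) as [Hg _].
  assert (0 < g z * (S - 0)) by (apply Rmult_lt_0_compat; lra). lra.
Qed.

Let Loss X := CL * (Rpower X0 gam - Rpower X gam).

(* [e] is [1] or [-1]: the two barriers are mirror images of each other. *)
Definition bump (X : R) (x : R2) : R := 1 - (2 * (e * fst x - X) / X) ^ 2 - (8 * snd x / X) ^ 2.
(** Outside the bump the value is at most [- eta / 2], the minimum of the datum. Every solution
    stays above this level, so the subsolution inequality is required only where the bump is
    positive and its positive part is differentiable. *)
Definition barrier (t : R) (x : R2) : R :=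
  eta * (Rmax 0 (bump (X0 - t) x) - Loss (X0 - t)) - eta / 2.

Lemma gam_gt0 : 0 < gam.
Proof. unfold gam; lra. Qed.

Lemma CL_nonneg : 0 <= CL.
Proof.
  unfold CL. pose proof gam_gt0. apply Rmult_le_pos.
  - apply Rmult_le_pos; auto. apply Rlt_le, Kc_pos; lra.
  - apply Rlt_le, Rinv_0_lt_compat. apply Rmult_lt_0_compat; lra.
Qed.

Lemma Loss_nonneg X : 0 < X -> X <= X0 -> 0 <= Loss X.
Proof.
  intros H1 H2. unfold Loss. apply Rmult_le_pos; [apply CL_nonneg|].
  assert (Rpower X gam <= Rpower X0 gam) by (apply Rpower_le_pos; auto; apply Rlt_le, gam_gt0). lra.
Qed.

Lemma bump_le1 X x : bump X x <= 1.
Proof.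
  unfold bump. pose proof (pow2_ge_0 (2 * (e * fst x - X) / X)). pose proof (pow2_ge_0 (8 * snd x / X)). lra.
Qed.

Lemma barrier_cont : cont3 S barrier.
Proof.
  assert (HX : cont3 S (fun t _ => X0 + - t)).
  { apply cont3_plus; [apply cont3_const|apply cont3_opp, cont3_time]. }
  assert (HXi : cont3 S (fun t _ => / (X0 + - t))).
  { apply (cont3_comp S Rinv); auto. intros t x Ht. unfold S in Ht.
    apply (continuity_pt_inv id); [apply derivable_continuous_pt, derivable_pt_id|].
    unfold id. lra. }
  unfold barrier, bump, Loss, Rminus, Rdiv.
  apply cont3_plus; [|apply cont3_const]. apply cont3_mult; [apply cont3_const|].
  apply cont3_plus.
  - apply (cont3_comp S (Rmax 0)); [|intros; apply Rmax0_continuous].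
    apply cont3_plus; [apply cont3_plus; [apply cont3_const|]|].
    + apply cont3_opp. simpl. apply (cont3_comp S (fun z => z * (z * 1))).
      * apply cont3_mult; auto. apply cont3_mult; [apply cont3_const|].
        apply cont3_plus; [|now apply cont3_opp].
        apply cont3_mult; [apply cont3_const|apply cont3_fst].
      * intros. apply derivable_continuous_pt. reg.
    + apply cont3_opp. simpl. apply (cont3_comp S (fun z => z * (z * 1))).
      * apply cont3_mult; auto. apply cont3_mult; [apply cont3_const|apply cont3_snd].
      * intros. apply derivable_continuous_pt. reg.
  - apply cont3_opp, cont3_mult; [apply cont3_const|].
    apply cont3_plus; [apply cont3_const|]. apply cont3_opp.
    apply (cont3_comp S (fun z => Rpower z gam)); auto.
    intros t x Ht. unfold S in Ht. apply derivable_continuous_pt. eexists.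
    apply derivable_pt_lim_power. lra.
Qed.

Lemma barrier_le t x : 0 <= t <= S -> barrier t x <= eta.
Proof.
  intros Ht. unfold S in Ht. unfold barrier.
  pose proof (Loss_nonneg (X0 - t) ltac:(lra) ltac:(lra)).
  assert (Rmax 0 (bump (X0 - t) x) <= 1) by (apply Rmax_lub; [lra|apply bump_le1]).
  assert (eta * (Rmax 0 (bump (X0 - t) x) - Loss (X0 - t)) <= eta * 1) by (apply Rmult_le_compat_l; lra).
  lra.
Qed.

(** With [a] the rescaled displacement from the crest, the phase is [z = PI / 4 * a], and [(1 + cos
    z) / 2 >= 1 - z^2 / 4 >= 1 - a^2] because [PI / 4 <= 1]. *)
Lemma barrier_init x : barrier 0 x <= eta / 2 * sin (PI / 2 / X0 * (e * fst x)).
Proof.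
  unfold barrier. rewrite Rminus_0_r. unfold Loss. rewrite Rminus_diag, Rmult_0_r, Rminus_0_r.
  set (z := PI / 2 / X0 * (e * fst x) - PI / 2).
  replace (PI / 2 / X0 * (e * fst x)) with (PI / 2 + z) by (unfold z; ring).
  rewrite <- cos_sin.
  assert (Rmax 0 (bump X0 x) <= (1 + cos z) / 2).
  { apply Rmax_lub.
    - pose proof (COS_bound z). lra.
    - unfold bump. pose proof (pow2_ge_0 (8 * snd x / X0)).
      assert (E : z = PI / 4 * (2 * (e * fst x - X0) / X0)) by (unfold z; field; lra).
      set (a := 2 * (e * fst x - X0) / X0) in *.
      pose proof (one_minus_cos z) as Hcs. rewrite E in Hcs at 2.
      pose proof PI_4. pose proof PI_RGT_0.
      assert ((PI / 4 * a) ^ 2 <= a ^ 2).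
      { replace ((PI / 4 * a) ^ 2) with ((PI / 4) ^ 2 * a ^ 2) by ring.
        rewrite <- (Rmult_1_l (a ^ 2)) at 2. apply Rmult_le_compat_r; [apply pow2_ge_0|]. simpl; nra. }
      pose proof (pow2_ge_0 a). lra. }
  apply Rmult_le_compat_l with (r := eta) in H; lra.
Qed.

Lemma sq_lt1_abs a : a ^ 2 < 1 -> -1 < a < 1.
Proof. intros H. simpl in H. split; nra. Qed.

(** Displacements of at least [X / 40] are covered by the height of the bump. For smaller ones the
    rescaled increments are at most [2 d] and [8 d], the factors [2 a + da] and [2 b + db] at most
    3, and [3 * 2 + 3 * 8 = 30] is below 40. *)
Lemma barrier_osc t x y : 0 <= t <= S -> 0 < bump (X0 - t) x ->
  barrier t x - barrier t y <= Rmin eta (40 * eta / (X0 - t) * dist2 x y).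
Proof.
  intros Ht Hb. unfold S in Ht. unfold barrier. set (X := X0 - t) in *.
  assert (HX : 0 < X) by (unfold X; lra).
  replace (_ - _ - _) with (eta * (Rmax 0 (bump X x) - Rmax 0 (bump X y))) by ring.
  assert (H1 : Rmax 0 (bump X x) - Rmax 0 (bump X y) <= 1).
  { pose proof (Rmax_l 0 (bump X y)).
    assert (Rmax 0 (bump X x) <= 1) by (apply Rmax_lub; [lra|apply bump_le1]). lra. }
  apply Rmin_glb.
  { rewrite <- (Rmult_1_r eta) at 2. apply Rmult_le_compat_l; lra. }
  replace (40 * eta / X * dist2 x y) with (eta * (40 * (dist2 x y / X))) by (field; lra).
  apply Rmult_le_compat_l; [lra|].
  set (d := dist2 x y / X).
  assert (Hd : 0 <= d).
  { apply Rmult_le_pos; [apply dist2_nonneg|]. apply Rlt_le, Rinv_0_lt_compat; auto. }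
  destruct (Rle_dec 1 (40 * d)) as [|Hsmall]; [lra|].
  rewrite (Rmax_right 0 (bump X x)) by lra.
  pose proof (Rmax_r 0 (bump X y)).
  apply Rle_trans with (bump X x - bump X y); [lra|].
  unfold bump in Hb |- *.
  set (a := 2 * (e * fst x - X) / X) in *. set (b := 8 * snd x / X) in *.
  pose proof (pow2_ge_0 a). pose proof (pow2_ge_0 b).
  pose proof (sq_lt1_abs a ltac:(lra)) as Ha1. pose proof (sq_lt1_abs b ltac:(lra)) as Hb1.
  set (da := 2 * (e * (fst y - fst x)) / X). set (db := 8 * (snd y - snd x) / X).
  replace (2 * (e * fst y - X) / X) with (a + da) by (unfold a, da; field; lra).
  replace (8 * snd y / X) with (b + db) by (unfold b, db; field; lra).
  assert (Hda : - (2 * d) <= da <= 2 * d).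
  { pose proof (fst_le_norm2 (fst x - fst y, snd x - snd y)) as Hn. simpl fst in Hn.
    fold (dist2 x y) in Hn. apply Rabs_le_between in Hn. unfold da, d.
    pose proof (Rinv_0_lt_compat X HX).
    unfold Rdiv. split; nra. }
  assert (Hdb : - (8 * d) <= db <= 8 * d).
  { pose proof (snd_le_norm2 (fst x - fst y, snd x - snd y)) as Hn. simpl snd in Hn.
    fold (dist2 x y) in Hn. apply Rabs_le_between in Hn. unfold db, d.
    pose proof (Rinv_0_lt_compat X HX).
    unfold Rdiv. split; nra. }
  clearbody a b da db d.
  replace (1 - a ^ 2 - b ^ 2 - (1 - (a + da) ^ 2 - (b + db) ^ 2))
    with (da * (2 * a + da) + db * (2 * b + db)) by ring.
  assert (Hprod : forall r q k, 0 <= k -> - k <= r <= k -> -3 <= q <= 3 -> r * q <= 3 * k).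
  { intros r q k Hk Hr Hq. destruct (Rle_dec 0 q); nra. }
  pose proof (Hprod da (2 * a + da) (2 * d) ltac:(lra) ltac:(lra) ltac:(lra)).
  pose proof (Hprod db (2 * b + db) (8 * d) ltac:(lra) ltac:(lra) ltac:(lra)). lra.
Qed.

(* The transport part: [xi] is the first coordinate after reflection; [a] and [b] are the
   rescaled displacements from the moving centre [X]. *)
Lemma transport_sign X xi y : 0 < X <= 1 ->
  let a := 2 * (xi - X) / X in let b := 8 * y / X in a ^ 2 + b ^ 2 < 1 ->
  F X * (- 4 * a * xi / X ^ 2 - 16 * b * y / X ^ 2)
  + (4 * a / X) * (A * vel p N xi y) - 16 * b / X * (A * vel p N y xi) <= 0.
Proof.
  intros HX a b Hab. pose proof half_PI_gt as HPI.
  pose proof (pow2_ge_0 a). pose proof (pow2_ge_0 b).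
  pose proof (sq_lt1_abs a ltac:(lra)) as Ha1. pose proof (sq_lt1_abs b ltac:(lra)) as Hb1.
  assert (Exi : xi = X + a * X / 2) by (unfold a; field; lra).
  assert (Ey : y = b * X / 8) by (unfold b; field; lra).
  assert (Hxi : X / 2 < xi < 3 / 2 * X) by (split; nra).
  assert (Hy : - 1 / 8 < y < 1 / 8) by (split; nra).
  pose proof (vel_sign p N p_gt0 p_lt_half xi y ltac:(lra) ltac:(lra)) as Hsg.
  pose proof (speed_gap p N p_gt0 p_lt_half xi y ltac:(lra) ltac:(lra)) as [Hg0 Hg1].
  assert (HFX : 0 < F X) by (apply F_pos; lra).
  assert (HFxi : 0 < F xi) by (apply F_pos; lra).
  assert (B1 : 16 * b / X * (A * vel p N y xi) >= 0).
  { replace (16 * b / X * (A * vel p N y xi)) with (128 / X ^ 2 * A * (y * vel p N y xi))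
      by (unfold b; field; lra).
    apply Rle_ge, Rmult_le_pos; auto. apply Rmult_le_pos; [|lra].
    apply Rmult_le_pos; [lra|]. apply Rlt_le, Rinv_0_lt_compat, pow_lt; lra. }
  assert (B2 : F X * (16 * b * y / X ^ 2) = 128 * F X * y ^ 2 / X ^ 3) by (unfold b; field; lra).
  set (gap := speed p N xi - vel p N xi y) in *.
  replace (A * vel p N xi y) with (F xi - A * gap) by (unfold F, gap; ring).
  assert (HiX : 0 < / X) by (apply Rinv_0_lt_compat; lra).
  replace (F X * (- 4 * a * xi / X ^ 2 - 16 * b * y / X ^ 2)) with
    (- (4 * / X) * (a * (F X * xi / X)) - F X * (16 * b * y / X ^ 2)) by (field; lra).
  rewrite B2.
  assert (HXpow : 0 < / X ^ 3) by (apply Rinv_0_lt_compat, pow_lt; lra).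
  assert (Hlast : 0 <= 128 * F X * y ^ 2 / X ^ 3).
  { apply Rmult_le_pos; [|lra]. apply Rmult_le_pos; [lra|apply pow2_ge_0]. }
  (* Beyond the centre ([a >= 0]) [speed_ratio] suffices and the velocity deficit [gap] helps.
     Before it ([a < 0]) the deficit has the wrong sign and is absorbed by [128 F X y^2 / X^3],
     which comes from the transverse shrinking of the bump. *)
  destruct (Rle_dec 0 a) as [Ha|Ha].
  - assert (HXx : X <= xi) by nra.
    pose proof (speed_ratio p N p_gt0 p_lt_half X xi ltac:(lra) HXx ltac:(lra)) as Hr.
    assert (HF : F xi <= F X * xi / X).
    { apply Rmult_le_reg_r with X; [lra|].
      replace (F X * xi / X * X) with (F X * xi) by (field; lra).
      unfold F. rewrite !Rmult_assoc. apply Rmult_le_compat_l; lra. }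
    assert (0 <= A * gap) by (apply Rmult_le_pos; lra).
    assert (a * (F xi - A * gap) <= a * (F X * xi / X)) by (apply Rmult_le_compat_l; lra).
    replace (4 * a / X * (F xi - A * gap)) with (4 * / X * (a * (F xi - A * gap))) by (field; lra).
    assert (4 * / X * (a * (F xi - A * gap)) <= 4 * / X * (a * (F X * xi / X)))
      by (apply Rmult_le_compat_l; lra).
    lra.
  - assert (HXx : xi <= X) by nra.
    pose proof (speed_ratio p N p_gt0 p_lt_half xi X ltac:(lra) HXx ltac:(lra)) as Hr.
    assert (HF : F X * xi / X <= F xi).
    { apply Rmult_le_reg_r with X; [lra|].
      replace (F X * xi / X * X) with (F X * xi) by (field; lra).
      unfold F. rewrite !Rmult_assoc. apply Rmult_le_compat_l; lra. }
    assert (a * F xi <= a * (F X * xi / X)) by nra.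
    assert (4 * / X * (a * F xi) <= 4 * / X * (a * (F X * xi / X))) by (apply Rmult_le_compat_l; lra).
    replace (4 * a / X * (F xi - A * gap)) with (4 * / X * (a * F xi) + 4 * / X * (- a * (A * gap)))
      by (field; lra).
    pose proof (speed_mono p N p_gt0 p_lt_half xi X ltac:(lra) HXx ltac:(lra)) as Hmono.
    assert (HFm : F xi <= F X) by (unfold F; apply Rmult_le_compat_l; lra).
    pose proof (sin_half xi ltac:(lra)) as Hsin.
    assert (Hsin2 : X ^ 2 / 16 <= sin xi ^ 2).
    { replace (X ^ 2 / 16) with ((X / 4) ^ 2) by field. apply pow_incr. lra. }
    assert (HX2 : 0 < X ^ 2) by (apply pow_lt; lra).
    (* [sin xi >= X / 4] and [p < 1/2] give 24, and [1/2 <= 1 / X^2] gives the last unit. The final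
       coefficient [4 * 25 = 100] stays below 128; this is where the factor 8 in [8 * snd x / X]
       matters. *)
    assert (Hk : 1 / 2 + 3 * p / sin xi ^ 2 <= 25 / X ^ 2).
    { assert (Hp16 : 3 * p / sin xi ^ 2 <= 3 * (1 / 2) / (X ^ 2 / 16)).
      { unfold Rdiv at 1 2. apply Rmult_le_compat.
        - generalize p_gt0; lra.
        - apply Rlt_le, Rinv_0_lt_compat; lra.
        - generalize p_lt_half; lra.
        - apply Rinv_le_contravar; lra. }
      replace (3 * (1 / 2) / (X ^ 2 / 16)) with (24 / X ^ 2) in Hp16 by (field; lra).
      assert (1 / 2 <= 1 / X ^ 2).
      { apply Rmult_le_reg_r with (X ^ 2); auto.
        replace (1 / X ^ 2 * X ^ 2) with 1 by (field; lra).
        assert (X ^ 2 <= 1) by (simpl; nra). lra. }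
      replace (25 / X ^ 2) with (24 / X ^ 2 + 1 / X ^ 2) by (field; lra). lra. }
    assert (Hgap : A * gap <= F X * (y ^ 2 * (25 / X ^ 2))).
    { apply Rle_trans with (A * (speed p N xi * (y ^ 2 * (1 / 2 + 3 * p / sin xi ^ 2)))).
      - apply Rmult_le_compat_l; lra.
      - rewrite <- Rmult_assoc. fold (F xi).
        assert (0 <= 1 / 2 + 3 * p / sin xi ^ 2).
        { assert (0 <= 3 * p / sin xi ^ 2); [|lra]. apply Rmult_le_pos.
          - generalize p_gt0; lra.
          - apply Rlt_le, Rinv_0_lt_compat; lra. }
        pose proof (pow2_ge_0 y). apply Rmult_le_compat; try lra.
        + apply Rmult_le_pos; lra.
        + apply Rmult_le_compat_l; lra. }
    assert (Hag : - a * (A * gap) <= 1 * (F X * (y ^ 2 * (25 / X ^ 2)))).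
    { apply Rmult_le_compat; try lra. apply Rmult_le_pos; lra. }
    assert (H25 : 4 * / X * (- a * (A * gap)) <= 4 * / X * (1 * (F X * (y ^ 2 * (25 / X ^ 2)))))
      by (apply Rmult_le_compat_l; lra).
    replace (4 * / X * (1 * (F X * (y ^ 2 * (25 / X ^ 2))))) with (100 / 128 * (128 * F X * y ^ 2 / X ^ 3))
      in H25 by (field; lra).
    lra.
Qed.

(** Being above [- eta / 2] forces the bump to be positive, so all derivatives are explicit. After
    multiplication by [F X] the inequality splits into the transport part, settled by
    [transport_sign], and the balance between the imposed loss of height and the dissipation. *)
Lemma barrier_contact t x : 0 < t <= S -> - eta / 2 < barrier t x ->
  exists Wt W1 W2 Aa B,
    derivable_pt_lim (fun t => barrier t x) t Wt /\
    derivable_pt_lim (fun h => barrier t (fst x + h, snd x)) 0 W1 /\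
    derivable_pt_lim (fun h => barrier t (fst x, snd x + h)) 0 W2 /\
    0 < Aa /\ 0 < B /\ (forall y, barrier t x - barrier t y <= Rmin Aa (B * dist2 x y)) /\
    Wt + g t * (fst (u x) * W1 + snd (u x) * W2 + c * Kc s Aa B) <= 0.
Proof.
  intros Ht Hcon. unfold S in Ht. set (X := X0 - t).
  assert (HX : eps <= X < X0) by (unfold X; lra).
  assert (Hb : 0 < bump X x).
  { apply Rnot_le_lt. intros Hle. unfold barrier in Hcon. fold X in Hcon.
    rewrite Rmax_left in Hcon by auto.
    pose proof (Loss_nonneg X ltac:(lra) ltac:(lra)).
    assert (0 <= eta * Loss X) by (apply Rmult_le_pos; lra). lra. }
  pose proof gam_gt0 as Hgam.
  set (xi := e * fst x). set (y := snd x).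
  set (a := 2 * (xi - X) / X). set (b := 8 * y / X).
  exists (eta * ((- 4 * a * xi / X ^ 2 - 16 * b * y / X ^ 2) - CL * gam * Rpower X (gam - 1))),
    (eta * (- 2 * a * (2 * e / X))), (eta * (- 2 * b * (8 / X))), eta, (40 * eta / X).
  split; [|split; [|split; [|split; [|split; [|split]]]]].
  - apply derivable_pt_lim_ext with (fun t => eta * (Rmax 0 (bump (X0 - t) x) - Loss (X0 - t)) + - (eta / 2)).
    { intros z. unfold barrier. ring. }
    apply derivable_pt_lim_eq with (eta * ((- 4 * a * xi / X ^ 2 - 16 * b * y / X ^ 2)
      - CL * gam * Rpower X (gam - 1)) + 0); [ring|].
    apply derivable_pt_lim_plus; [|apply derivable_pt_lim_const].
    apply derivable_pt_lim_scal. apply derivable_pt_lim_minus.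
    + apply (Rmax0_derive (fun t => bump (X0 - t) x)); auto.
      apply is_derive_Reals. unfold bump. auto_derive; [unfold X in HX; lra|].
      unfold a, b, xi, y, X. field. unfold X in HX; lra.
    + unfold Loss. replace (CL * gam * Rpower X (gam - 1)) with
        (CL * (gam * Rpower X (gam - 1))) by ring.
      apply derivable_pt_lim_scal. apply is_derive_Reals.
      unfold Rpower. auto_derive; [unfold X in HX; lra|].
      change (X0 + - t) with X.
      replace ((gam - 1) * ln X) with (gam * ln X + - ln X) by ring.
      rewrite exp_plus, exp_Ropp, exp_ln by lra. field. lra.
  - apply derivable_pt_lim_ext with (fun h => eta * (Rmax 0 (bump X (fst x + h, snd x)) - Loss X) + - (eta / 2)).
    { intros z. unfold barrier, y. fold X. ring. }
    apply derivable_pt_lim_eq with (eta * (- 2 * a * (2 * e / X) - 0) + 0); [ring|].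
    apply derivable_pt_lim_plus; [|apply derivable_pt_lim_const].
    apply derivable_pt_lim_scal. apply derivable_pt_lim_minus; [|apply derivable_pt_lim_const].
    apply (Rmax0_derive (fun h => bump X (fst x + h, snd x))).
    + rewrite Rplus_0_r. destruct x; exact Hb.
    + apply is_derive_Reals. unfold bump; simpl fst; simpl snd. auto_derive; auto.
      unfold a, b, xi, y. rewrite Rplus_0_r. field. lra.
  - apply derivable_pt_lim_ext with (fun h => eta * (Rmax 0 (bump X (fst x, snd x + h)) - Loss X) + - (eta / 2)).
    { intros z. unfold barrier, y. fold X. ring. }
    apply derivable_pt_lim_eq with (eta * (- 2 * b * (8 / X) - 0) + 0); [ring|].
    apply derivable_pt_lim_plus; [|apply derivable_pt_lim_const].
    apply derivable_pt_lim_scal. apply derivable_pt_lim_minus; [|apply derivable_pt_lim_const].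
    apply (Rmax0_derive (fun h => bump X (fst x, snd x + h))).
    + rewrite Rplus_0_r. destruct x; exact Hb.
    + apply is_derive_Reals. unfold bump; simpl fst; simpl snd. auto_derive; auto.
      unfold a, b, xi, y. rewrite Rplus_0_r. field. lra.
  - auto.
  - apply Rdiv_lt_0_compat; lra.
  - intros z. apply barrier_osc; auto. unfold S; lra.
  - pose proof (transport_sign X xi y ltac:(lra)) as HT. cbv zeta in HT. fold a b in HT.
    assert (Hab : a ^ 2 + b ^ 2 < 1).
    { unfold bump in Hb. fold xi y a b in Hb. lra. }
    specialize (HT Hab). pose proof half_PI_gt.
    assert (HF : 0 < F X) by (apply F_pos; lra).
    assert (Hg : g t = / F X) by reflexivity.
    rewrite Kc_scale by lra.
    rewrite Hg.
    apply Rmult_le_reg_l with (F X); auto. rewrite Rmult_0_r.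
    match goal with |- F X * (?P + / F X * ?Q) <= _ =>
      replace (F X * (P + / F X * Q)) with (F X * P + Q) by (field; lra) end.
    assert (E1 : fst (u x) = - A * (e * vel p N xi y)).
    { rewrite (surjective_pairing x), Hu. simpl. unfold xi, y. destruct He as [->| ->].
      - rewrite !Rmult_1_l. ring.
      - replace (-1 * fst x) with (- fst x) by ring. rewrite vel_odd. ring. }
    assert (E2 : snd (u x) = A * vel p N y xi).
    { rewrite (surjective_pairing x), Hu. simpl. unfold xi, y. destruct He as [->| ->].
      - rewrite !Rmult_1_l. ring.
      - replace (-1 * fst x) with (- fst x) by ring. rewrite vel_even. ring. }
    rewrite E1, E2.
    assert (Hee : e * e = 1) by (destruct He as [->| ->]; ring).
    (* The choice of [CL] makes the loss pay for the dissipation, using [F_lower] and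
       [alpha + (gam - 1) = - 2 s]. *)
    assert (Hdiss : c * (Rpower X (- (2 * s)) * Kc s 1 40) <= F X * (CL * gam * Rpower X (gam - 1))).
    { pose proof (F_lower X ltac:(lra)) as HFl.
      assert (HP : Rpower X (- (2 * s)) = Rpower X alpha * Rpower X (gam - 1)).
      { rewrite <- Rpower_plus. f_equal. unfold gam. ring. }
      assert (P0 : 0 < Rpower X (gam - 1)) by apply exp_pos.
      assert (EC : c * Kc s 1 40 = A / 4 * (CL * gam)) by (unfold CL; field; lra).
      replace (c * (Rpower X (- (2 * s)) * Kc s 1 40)) with (c * Kc s 1 40 * Rpower X (- (2 * s))) by ring.
      rewrite EC, HP.
      replace (A / 4 * (CL * gam) * (Rpower X alpha * Rpower X (gam - 1)))
        with (A / 4 * Rpower X alpha * (CL * gam * Rpower X (gam - 1))) by ring.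
      apply Rmult_le_compat_r; auto. pose proof CL_nonneg.
      apply Rmult_le_pos; [apply Rmult_le_pos; lra|lra]. }
    set (DS := c * (Rpower X (- (2 * s)) * Kc s 1 40)) in *.
    replace (F X * (eta * (- 4 * a * xi / X ^ 2 - 16 * b * y / X ^ 2 - CL * gam * Rpower X (gam - 1))) +
      (- A * (e * vel p N xi y) * (eta * (- 2 * a * (2 * e / X))) +
       A * vel p N y xi * (eta * (- 2 * b * (8 / X))) +
       c * (eta * Rpower X (- (2 * s)) * Kc s 1 40)))
    with (eta * ((F X * (- 4 * a * xi / X ^ 2 - 16 * b * y / X ^ 2)
        + e * e * (4 * a / X) * (A * vel p N xi y) - 16 * b / X * (A * vel p N y xi))
        + (DS - F X * (CL * gam * Rpower X (gam - 1))))) by (unfold DS; field; lra).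
    rewrite Hee, Rmult_1_l.
    assert (forall z, z <= 0 -> eta * z <= 0) as Hz by (intros; nra). apply Hz. lra.
Qed.

Lemma barrier_final : eta / 2 - eta * (CL * Rpower X0 gam) <= barrier S (e * eps, 0).
Proof.
  unfold barrier, S. replace (X0 - (X0 - eps)) with eps by ring.
  unfold bump; simpl fst; simpl snd.
  assert (Hee : e * (e * eps) = eps) by (destruct He as [->| ->]; ring). rewrite Hee.
  replace (1 - _ - _) with 1 by (field; lra).
  rewrite Rmax_right by lra. unfold Loss.
  assert (0 < Rpower eps gam) by apply exp_pos. pose proof CL_nonneg.
  assert (eta * (CL * Rpower eps gam) >= 0).
  { apply Rle_ge, Rmult_le_pos; [lra|]. apply Rmult_le_pos; lra. }
  lra.
Qed.

Variables (theta : R -> R2 -> R) (U M : R).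
Hypothesis HU : forall x, Rabs (fst (u x)) <= U /\ Rabs (snd (u x)) <= U.
Hypothesis Hsol : wsol s c u theta (travel S) M.
Hypothesis Hinit : forall x, theta 0 x = eta / 2 * sin (PI / 2 / X0 * (e * fst x)).

Lemma wsol_shorter T : T <= travel S -> wsol s c u theta T M.
Proof.
  intros HT. destruct Hsol as (H1 & H2 & H3). split; [|split]; auto.
  intros; apply H2; lra.
Qed.

Theorem barrier_holds :
  eta / 2 - eta * (CL * Rpower X0 gam) <= theta (travel S) (e * eps, 0).
Proof.
  apply Rle_trans with (1 := barrier_final).
  assert (HS : 0 < S) by (unfold S; lra).
  assert (E0 : travel 0 = 0) by (unfold travel; rewrite RInt_point; reflexivity).
  assert (Hder : forall t, 0 <= t <= S -> derivable_pt_lim travel t (g t) /\ 0 < g t <= / F eps).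
  { intros t Ht. split; [now apply travel_derive|now apply g_bounds]. }
  apply (comparison s c U M eta (/ F eps) S u theta travel g barrier); auto; try lra.
  - exact barrier_cont.
  - intros; now apply barrier_le.
  - intros x. rewrite Hinit. apply barrier_init.
  - intros t x kap Ht Hkap Hlt.
    (* The minimum principle supplies the lower level of the barrier, so [theta < barrier] implies
       the hypothesis of [barrier_contact]. *)
    assert (Hlow : - eta / 2 <= theta (travel t) x).
    { pose proof (tau_incr (/ F eps) S travel g Hder 0 t ltac:(lra) ltac:(lra) ltac:(lra)) as Hpos.
      pose proof (tau_range (/ F eps) S travel g E0 Hder t ltac:(lra)) as Hr.
      rewrite E0 in Hpos.
      apply (wsol_lower s c u theta M U); auto.
      - apply wsol_shorter. apply Hr.
      - intros z. rewrite Hinit. pose proof (SIN_bound (PI / 2 / X0 * (e * fst z))). nra. }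
    destruct (barrier_contact t x Ht ltac:(lra)) as (Wt & W1 & W2 & Aa & B & H1 & H2 & H3 & H4 & H5 & H6 & H7).
    exists Wt, W1, W2, Aa, B. repeat split; auto. lra.
Qed.

End Barrier.

(** * Galerkin approximation *)

Section MatExp.
Context {T : Type}.
Variables (B : list T) (A : T -> T -> R).

Definition mapp (a : T -> R) (k : T) : R := lsum (fun l => A k l * a l) B.

Definition mexp_coef (b : T -> R) (k : T) (n : nat) : R := Nat.iter n mapp b k / INR (fact n).

Definition mexp (b : T -> R) (k : T) (t : R) : R := PSeries (mexp_coef b k) t.

Definition mnorm : R := lsum (fun k => lsum (fun l => Rabs (A k l)) B) B.

Lemma iter_bound (b : T -> R) n : forall k, In k B ->
  Rabs (Nat.iter n mapp b k) <= mnorm ^ n * lsum (fun l => Rabs (b l)) B.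
Proof.
  induction n as [|n IH]; intros k Hk; simpl.
  - rewrite Rmult_1_l. apply (lsum_term (fun l => Rabs (b l))); auto. intros; apply Rabs_pos.
  - unfold mapp at 1. apply Rle_trans with (1 := lsum_abs _ _).
    set (Q := mnorm ^ n * lsum (fun l => Rabs (b l)) B) in *.
    apply Rle_trans with (lsum (fun l => Q * Rabs (A k l)) B).
    + apply lsum_le. intros l Hl. rewrite Rabs_mult, Rmult_comm.
      apply Rmult_le_compat_r; [apply Rabs_pos|]. now apply IH.
    + rewrite lsum_scal.
      assert (HQ : 0 <= Q) by (apply Rle_trans with (2 := IH k Hk); apply Rabs_pos).
      replace (mnorm * mnorm ^ n * lsum (fun l => Rabs (b l)) B) with (Q * mnorm) by (unfold Q; ring).
      apply Rmult_le_compat_l; auto.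
      apply (lsum_term (fun k => lsum (fun l => Rabs (A k l)) B)); auto.
      intros; apply lsum_nonneg; intros; apply Rabs_pos.
Qed.

(** The coefficients are dominated by those of [C exp (mnorm t)], so the series may be
    differentiated termwise at every time. *)
Lemma mexp_radius b k : In k B -> CV_radius (mexp_coef b k) = p_infty.
Proof.
  intros Hk. set (C := lsum (fun l => Rabs (b l)) B).
  assert (Hall : forall r : R, Rbar_le (Rabs r) (CV_radius (mexp_coef b k))).
  { intros r. apply CV_radius_bounded.
    exists (C * exp (mnorm * Rabs r)). intros n. unfold mexp_coef.
    unfold Rdiv. rewrite !Rabs_mult. rewrite (Rabs_pos_eq (/ INR (fact n))).
    2: { apply Rlt_le, Rinv_0_lt_compat, INR_fact_lt_0. }
    rewrite <- RPow_abs, Rabs_Rabsolu.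
    assert (HC : 0 <= C) by (apply lsum_nonneg; intros; apply Rabs_pos).
    assert (Hm : 0 <= mnorm).
    { apply lsum_nonneg; intros; apply lsum_nonneg; intros; apply Rabs_pos. }
    pose proof (Rabs_pos r) as Hr.
    apply Rle_trans with (C * ((mnorm * Rabs r) ^ n / INR (fact n))).
    - rewrite Rpow_mult_distr. unfold Rdiv.
      replace (C * (mnorm ^ n * Rabs r ^ n * / INR (fact n)))
        with (mnorm ^ n * C * / INR (fact n) * Rabs r ^ n) by ring.
      apply Rmult_le_compat_r; [now apply pow_le|].
      apply Rmult_le_compat_r; [apply Rlt_le, Rinv_0_lt_compat, INR_fact_lt_0|].
      now apply iter_bound.
    - apply Rmult_le_compat_l; auto.
      assert (Hz : 0 <= mnorm * Rabs r) by (now apply Rmult_le_pos).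
      apply Rle_trans with (2 := exp_ge_taylor _ n Hz).
      set (z := mnorm * Rabs r) in *.
      assert (Hpos : forall i, 0 <= z ^ i / INR (fact i)).
      { intros i. apply Rmult_le_pos; [now apply pow_le|].
        apply Rlt_le, Rinv_0_lt_compat, INR_fact_lt_0. }
      destruct n as [|n]; [simpl; lra|]. rewrite tech5.
      pose proof (cond_pos_sum (fun i => z ^ i / INR (fact i)) n Hpos). lra. }
  destruct (CV_radius (mexp_coef b k)) as [r| |] eqn:E; auto.
  - specialize (Hall (Rabs r + 1)). simpl in Hall. rewrite Rabs_pos_eq in Hall.
    + pose proof (Rle_abs r). lra.
    + pose proof (Rabs_pos r). lra.
  - specialize (Hall 0). simpl in Hall. tauto.
Qed.

Lemma mexp_derive b k t : In k B -> derivable_pt_lim (mexp b k) t (mexp (mapp b) k t).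
Proof.
  intros Hk. apply is_derive_Reals. unfold mexp.
  replace (PSeries (mexp_coef (mapp b) k) t) with (PSeries (PS_derive (mexp_coef b k)) t).
  - apply is_derive_PSeries. rewrite mexp_radius by auto. exact I.
  - apply PSeries_ext. intros n. unfold PS_derive, mexp_coef.
    rewrite Nat.iter_succ_r, fact_simpl, mult_INR. field.
    split; [apply INR_fact_neq_0|apply not_0_INR; lia].
Qed.

Lemma ex_mexp b k t : In k B -> ex_pseries (mexp_coef b k) t.
Proof. intros. apply CV_radius_inside. now rewrite mexp_radius. Qed.

Lemma mexp_mapp b k t : In k B -> mexp (mapp b) k t = lsum (fun l => A k l * mexp b l t) B.
Proof.
  intros Hk. unfold mexp.
  (* Induction on a sublist [B']: the iterates inside [mexp_coef] still sum over the whole of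
     [B]. *)
  assert (H : forall B', (forall l, In l B' -> In l B) ->
    ex_pseries (fun n => lsum (fun l => A k l * mexp_coef b l n) B') t /\
    PSeries (fun n => lsum (fun l => A k l * mexp_coef b l n) B') t
      = lsum (fun l => A k l * PSeries (mexp_coef b l) t) B').
  { induction B' as [|l B' IH]; intros Hsub; simpl.
    - split.
      + apply (ex_pseries_ext (PS_scal 0 (mexp_coef b k))).
        * intros n. unfold PS_scal, scal; simpl; unfold mult; simpl. ring.
        * apply ex_pseries_scal; [apply Rmult_comm|]. now apply ex_mexp.
      + apply PSeries_const_0.
    - destruct IH as [IH1 IH2]; [intros; apply Hsub; now right|].
      assert (Hl : In l B) by (apply Hsub; now left).
      assert (E1 : ex_pseries (PS_scal (A k l) (mexp_coef b l)) t).
      { apply ex_pseries_scal; [apply Rmult_comm|]. now apply ex_mexp. }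
      split.
      + apply (ex_pseries_plus _ _ _ E1 IH1).
      + rewrite <- IH2, <- PSeries_scal, <- PSeries_plus by auto. reflexivity. }
  rewrite <- (proj2 (H B (fun _ h => h))).
  apply PSeries_ext. intros n. unfold mexp_coef.
  rewrite <- Nat.iter_succ_r. simpl Nat.iter. unfold mapp at 1.
  unfold Rdiv. rewrite Rmult_comm, <- lsum_scal. apply lsum_ext. intros; ring.
Qed.

Lemma mexp_0 b k : mexp b k 0 = b k.
Proof.
  unfold mexp. rewrite PSeries_0. unfold mexp_coef. simpl. field.
Qed.

Lemma mexp_ext b b' k t : In k B -> (forall l, In l B -> b l = b' l) -> mexp b k t = mexp b' k t.
Proof.
  intros Hk H. unfold mexp. apply PSeries_ext. intros n. unfold mexp_coef. f_equal.
  clear t. revert k Hk. induction n as [|n IH]; intros k Hk; simpl; auto.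
  unfold mapp at 1 3. apply lsum_ext. intros l Hl. now rewrite IH.
Qed.

End MatExp.

(** * The lattice of frequencies and the transport matrix *)

Notation idx := (Z * Z)%type.

Definition idx_dec : forall k l : idx, {k = l} + {k <> l}.
Proof. decide equality; apply Z.eq_dec. Qed.

Definition delta (k l : idx) : R := if idx_dec k l then 1 else 0.
Definition zadd (k l : idx) : idx := (fst k + fst l, snd k + snd l)%Z.
Definition zsub (k l : idx) : idx := (fst k - fst l, snd k - snd l)%Z.
Definition wt (k : idx) : R := 1 + Rabs (IZR (fst k)) + Rabs (IZR (snd k)).
(** The stream mode [cos (j . x)] has velocity [(j2, - j1) sin (j . x)]; its product with the
    frequency [k] produces this factor. *)
Definition cross (j k : idx) : R := IZR (snd j) * IZR (fst k) - IZR (fst j) * IZR (snd k).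

Lemma wt_ge1 k : 1 <= wt k.
Proof.
  unfold wt. pose proof (Rabs_pos (IZR (fst k))). pose proof (Rabs_pos (IZR (snd k))). lra.
Qed.

Lemma delta_sum (f : idx -> R) B l : NoDup B -> In l B -> lsum (fun k => delta k l * f k) B = f l.
Proof.
  induction B as [|a B IH]; simpl; [tauto|]. intros HN Hl. inversion HN; subst.
  unfold delta at 1. destruct (idx_dec a l) as [->|Hne].
  - rewrite (lsum_ext _ (fun _ => 0)), lsum_zero; [ring|].
    intros k Hk. unfold delta. destruct (idx_dec k l) as [->|]; [tauto|ring].
  - destruct Hl as [->|Hl]; [tauto|]. rewrite IH; auto. ring.
Qed.

Lemma delta_sum_out (f : idx -> R) B l : ~ In l B -> lsum (fun k => delta k l * f k) B = 0.
Proof.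
  intros Hl. rewrite (lsum_ext _ (fun _ => 0)), lsum_zero; auto.
  intros k Hk. unfold delta. destruct (idx_dec k l) as [->|]; [tauto|ring].
Qed.

Lemma delta_sym k l : delta k l = delta l k.
Proof. unfold delta. destruct (idx_dec k l), (idx_dec l k); congruence. Qed.

Lemma delta_sum_le1 B l : NoDup B -> lsum (fun k => delta k l) B <= 1.
Proof.
  intros HN. rewrite (lsum_ext _ (fun k => delta k l * 1)) by (intros; ring).
  destruct (in_dec idx_dec l B).
  - rewrite (delta_sum (fun _ => 1)); auto. lra.
  - rewrite delta_sum_out; auto. lra.
Qed.

Lemma delta_add_sub k l j : delta k (zadd l j) = delta l (zsub k j).
Proof.
  unfold delta, zadd, zsub. destruct k as [k1 k2], l as [l1 l2], j as [j1 j2]; simpl.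
  destruct (idx_dec _ _) as [E|E], (idx_dec _ _) as [E'|E']; auto; exfalso;
    [apply E'; inversion E|apply E; inversion E']; f_equal; lia.
Qed.

Lemma lsum_nested (f : idx -> R) B B' : NoDup B -> (forall k, 0 <= f k) ->
  (forall k, In k B -> f k <> 0 -> In k B') -> lsum f B <= lsum f B'.
Proof.
  revert B'. induction B as [|a B IH]; intros B' HN Hf Hin; simpl.
  - now apply lsum_nonneg.
  - inversion HN; subst. destruct (Req_dec (f a) 0) as [E|Hne].
    + rewrite E, Rplus_0_l. apply IH; auto. intros; apply Hin; simpl; auto.
    + destruct (in_split a B') as (B1 & B2 & ->); [apply Hin; simpl; auto|].
      rewrite lsum_app. simpl.
      assert (lsum f B <= lsum f (B1 ++ B2)).
      { apply IH; auto. intros k Hk Hk0.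
        assert (Hk' : In k (B1 ++ a :: B2)) by (apply Hin; simpl; auto).
        rewrite in_app_iff in *. destruct Hk' as [|[->|]]; tauto. }
      rewrite lsum_app in H. lra.
Qed.

Lemma lsum_nested_eq (f : idx -> R) B B' : NoDup B -> NoDup B' ->
  (forall k, In k B -> In k B') -> (forall k, In k B' -> ~ In k B -> f k = 0) ->
  lsum f B = lsum f B'.
Proof.
  revert B'. induction B as [|a B IH]; intros B' HN HN' Hsub H0; simpl.
  - rewrite (lsum_ext f (fun _ => 0)), lsum_zero; auto.
  - inversion HN; subst. destruct (in_split a B') as (B1 & B2 & ->); [apply Hsub; simpl; auto|].
    rewrite lsum_app. simpl.
    pose proof (NoDup_remove_1 _ _ _ HN') as N1. pose proof (NoDup_remove_2 _ _ _ HN') as N2.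
    rewrite (IH (B1 ++ B2)); auto.
    + rewrite lsum_app. ring.
    + intros k Hk. assert (Hk' : In k (B1 ++ a :: B2)) by (apply Hsub; simpl; auto).
      rewrite in_app_iff in *. destruct Hk' as [|[->|]]; tauto.
    + intros k Hk Hn. apply H0; [rewrite in_app_iff in *; simpl; tauto|].
      intros [->|]; tauto.
Qed.

Section Hop.
Variable L : list mode.

(* Matrix of [theta -> - u . grad theta] on the coefficients of [sin (k . x)], for
   [u = field L]. *)
Definition hop (k l : idx) : R :=
  lsum (fun e => - (/ 2 * fst e * cross (snd e) l) * (delta k (zadd l (snd e)) - delta k (zsub l (snd e)))) L.
(** A symmetric nonnegative majorant for the couplings: [hop] is at most [reach * wt l] times it,
    its rows and columns sum to at most [mass], and it vanishes unless the two weights differ by at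
    most [reach]. The estimates below are Schur tests on these facts. *)
Definition nb (k l : idx) : R :=
  lsum (fun e => Rabs (fst e) * (delta k (zadd l (snd e)) + delta k (zsub l (snd e)))) L.
Definition reach : R := 1 + lsum (fun e => Rabs (IZR (fst (snd e))) + Rabs (IZR (snd (snd e)))) L.
Definition mass : R := 2 * lsum (fun e => Rabs (fst e)) L.

Lemma reach_ge1 : 1 <= reach.
Proof.
  unfold reach. assert (0 <= lsum (fun e : mode => Rabs (IZR (fst (snd e))) + Rabs (IZR (snd (snd e)))) L); [|lra].
  apply lsum_nonneg. intros. apply Rplus_le_le_0_compat; apply Rabs_pos.
Qed.

Lemma reach_bound e : In e L -> Rabs (IZR (fst (snd e))) + Rabs (IZR (snd (snd e))) <= reach.
Proof.
  intros He. unfold reach.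
  pose proof (lsum_term (fun e : mode => Rabs (IZR (fst (snd e))) + Rabs (IZR (snd (snd e)))) L e) as H.
  specialize (H ltac:(intros; apply Rplus_le_le_0_compat; apply Rabs_pos) He). simpl in H. lra.
Qed.

Lemma mass_nonneg : 0 <= mass.
Proof.
  unfold mass. apply Rmult_le_pos; [lra|]. apply lsum_nonneg; intros; apply Rabs_pos.
Qed.

Lemma cross_sym_shift j l : cross j (zadd l j) = cross j l /\ cross j (zsub l j) = cross j l.
Proof.
  unfold cross, zadd, zsub; simpl. rewrite !plus_IZR, !minus_IZR. split; ring.
Qed.

(** Shifting [l] by [j] or [- j] leaves [cross j l] unchanged, which is incompressibility in Fourier
    variables; the two shifts carry opposite signs and are exchanged by transposition. *)
Lemma hop_antisym k l : hop k l = - hop l k.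
Proof.
  unfold hop.
  replace (- lsum (fun e => - (/ 2 * fst e * cross (snd e) k) * (delta l (zadd k (snd e)) - delta l (zsub k (snd e)))) L)
    with (-1 * lsum (fun e => - (/ 2 * fst e * cross (snd e) k) * (delta l (zadd k (snd e)) - delta l (zsub k (snd e)))) L)
    by ring.
  rewrite <- lsum_scal. apply lsum_ext. intros [p j] _. simpl fst; simpl snd.
  rewrite <- (delta_add_sub k l j).
  assert (E : delta l (zadd k j) = delta k (zsub l j)) by apply delta_add_sub.
  rewrite E. unfold delta.
  destruct (cross_sym_shift j l) as [C1 C2].
  destruct (idx_dec k (zadd l j)) as [->|], (idx_dec _ (zsub l j)) as [E'|];
    try rewrite E'; rewrite ?C1, ?C2; ring.
Qed.

Lemma nb_nonneg k l : 0 <= nb k l.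
Proof.
  apply lsum_nonneg. intros e _. apply Rmult_le_pos; [apply Rabs_pos|].
  unfold delta. repeat destruct (idx_dec _ _); lra.
Qed.

Lemma nb_sym k l : nb k l = nb l k.
Proof.
  apply lsum_ext. intros [p j] _. simpl. f_equal.
  rewrite <- (delta_add_sub k l j). rewrite (delta_add_sub l k j). ring.
Qed.

Lemma nb_row B k : NoDup B -> lsum (fun l => nb l k) B <= mass.
Proof.
  intros HN. unfold nb. rewrite (lsum_exchange (fun l (e : mode) =>
    Rabs (fst e) * (delta l (zadd k (snd e)) + delta l (zsub k (snd e))))).
  unfold mass. rewrite <- lsum_scal. apply lsum_le. intros e _.
  rewrite lsum_scal, lsum_plus.
  pose proof (delta_sum_le1 B (zadd k (snd e)) HN). pose proof (delta_sum_le1 B (zsub k (snd e)) HN).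
  pose proof (Rabs_pos (fst e)). nra.
Qed.

Lemma nb_row' B k : NoDup B -> lsum (fun l => nb k l) B <= mass.
Proof.
  intros HN. rewrite (lsum_ext _ (fun l => nb l k)) by (intros; apply nb_sym). now apply nb_row.
Qed.

Lemma IZR_tri a b : Rabs (IZR (a + b)) <= Rabs (IZR a) + Rabs (IZR b) /\
  Rabs (IZR (a - b)) <= Rabs (IZR a) + Rabs (IZR b).
Proof.
  rewrite plus_IZR, minus_IZR. split; [apply Rabs_triang|].
  unfold Rminus. rewrite <- (Rabs_Ropp (IZR b)). apply Rabs_triang.
Qed.

Lemma nb_close k l : nb k l <> 0 -> Rabs (wt k - wt l) <= reach.
Proof.
  intros H. destruct (Rle_dec (Rabs (wt k - wt l)) reach) as [|Hn]; auto. exfalso. apply H.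
  unfold nb. rewrite (lsum_ext _ (fun _ => 0)), lsum_zero; auto.
  intros e He. pose proof (reach_bound e He) as Hr. destruct e as [p j]; simpl fst in *; simpl snd in *.
  unfold delta. destruct (idx_dec _ _) as [->|_]; [|destruct (idx_dec _ _) as [->|_]; [|ring]]; exfalso; apply Hn.
  - unfold wt, zadd; simpl fst; simpl snd. destruct (IZR_tri (fst l) (fst j)) as [A1 _].
    destruct (IZR_tri (snd l) (snd j)) as [A2 _].
    destruct (IZR_tri (fst l + fst j) (fst j)) as [_ A3].
    destruct (IZR_tri (snd l + snd j) (snd j)) as [_ A4].
    replace (fst l + fst j - fst j)%Z with (fst l) in A3 by ring.
    replace (snd l + snd j - snd j)%Z with (snd l) in A4 by ring.
    apply Rabs_le. lra.
  - unfold wt, zsub; simpl fst; simpl snd. destruct (IZR_tri (fst l) (fst j)) as [_ A1].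
    destruct (IZR_tri (snd l) (snd j)) as [_ A2].
    destruct (IZR_tri (fst l - fst j) (fst j)) as [A3 _].
    destruct (IZR_tri (snd l - snd j) (snd j)) as [A4 _].
    replace (fst l - fst j + fst j)%Z with (fst l) in A3 by ring.
    replace (snd l - snd j + snd j)%Z with (snd l) in A4 by ring.
    apply Rabs_le. lra.
Qed.

Lemma nb_wt k l : nb k l <> 0 -> wt k <= (1 + reach) * wt l.
Proof.
  intros H. pose proof (nb_close k l H) as Hc. apply Rabs_le_between in Hc.
  pose proof (wt_ge1 l). nra.
Qed.

Lemma hop_bound k l : Rabs (hop k l) <= reach * wt l * nb k l.
Proof.
  unfold hop, nb. apply Rle_trans with (1 := lsum_abs _ _). rewrite <- lsum_scal.
  apply lsum_le. intros e He. pose proof (reach_bound e He) as Hr.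
  destruct e as [p j]; simpl fst in *; simpl snd in *.
  rewrite Rabs_mult, Rabs_Ropp, !Rabs_mult, (Rabs_pos_eq (/ 2)) by lra.
  assert (Hc : Rabs (cross j l) <= reach * wt l).
  { unfold cross. apply Rle_trans with (Rabs (IZR (snd j)) * Rabs (IZR (fst l)) + Rabs (IZR (fst j)) * Rabs (IZR (snd l))).
    - rewrite <- !Rabs_mult. unfold Rminus. rewrite <- (Rabs_Ropp (IZR (fst j) * _)). apply Rabs_triang.
    - unfold wt. pose proof (Rabs_pos (IZR (snd j))). pose proof (Rabs_pos (IZR (fst j))).
      pose proof (Rabs_pos (IZR (snd l))). pose proof (Rabs_pos (IZR (fst l))). nra. }
  assert (Hd : Rabs (delta k (zadd l j) - delta k (zsub l j)) <= delta k (zadd l j) + delta k (zsub l j)).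
  { unfold delta. repeat destruct (idx_dec _ _); unfold Rabs; destruct Rcase_abs; lra. }
  pose proof (Rabs_pos p). pose proof (Rabs_pos (cross j l)).
  pose proof (Rabs_pos (delta k (zadd l j) - delta k (zsub l j))).
  pose proof reach_ge1. pose proof (wt_ge1 l).
  apply Rle_trans with (/ 2 * Rabs p * (reach * wt l) * (delta k (zadd l j) + delta k (zsub l j))).
  - apply Rmult_le_compat; auto.
    + repeat apply Rmult_le_pos; auto; lra.
    + apply Rmult_le_compat_l; auto. apply Rmult_le_pos; lra.
  - replace (reach * wt l * (Rabs p * (delta k (zadd l j) + delta k (zsub l j))))
      with (1 * (Rabs p * (reach * wt l) * (delta k (zadd l j) + delta k (zsub l j)))) by ring.
    rewrite !Rmult_assoc. apply Rmult_le_compat_r; [|lra].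
    apply Rmult_le_pos; auto. apply Rmult_le_pos; [lra|]. apply Rmult_le_pos; [lra|].
    lra.
Qed.

(** The mean value bound [m Mx^(m - 1) |x - y|], multiplied by [Mx] so that the exponent [m - 1]
    does not occur at [m = 0]. *)
Lemma pow_diff m x y Mx : 0 <= x <= Mx -> 0 <= y <= Mx ->
  Rabs (x ^ m - y ^ m) * Mx <= INR m * Rabs (x - y) * Mx ^ m.
Proof.
  intros Hx Hy. induction m as [|m IH].
  - simpl. rewrite Rminus_diag, Rabs_R0. lra.
  - rewrite S_INR. simpl pow.
    replace (x * x ^ m - y * y ^ m) with (x * (x ^ m - y ^ m) + y ^ m * (x - y)) by ring.
    assert (P1 : y ^ m <= Mx ^ m) by (apply pow_incr; lra).
    assert (P2 : 0 <= y ^ m) by (apply pow_le; lra).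
    pose proof (Rabs_pos (x ^ m - y ^ m)). pose proof (Rabs_pos (x - y)).
    apply Rle_trans with ((x * Rabs (x ^ m - y ^ m) + y ^ m * Rabs (x - y)) * Mx).
    + apply Rmult_le_compat_r; [lra|]. apply Rle_trans with (1 := Rabs_triang _ _).
      rewrite !Rabs_mult, (Rabs_pos_eq x), (Rabs_pos_eq (y ^ m)) by lra. lra.
    + assert (Q1 : x * (Rabs (x ^ m - y ^ m) * Mx) <= Mx * (INR m * Rabs (x - y) * Mx ^ m)).
      { apply Rmult_le_compat; try lra. apply Rmult_le_pos; lra. }
      assert (Q2 : y ^ m * (Rabs (x - y) * Mx) <= Mx ^ m * (Rabs (x - y) * Mx)).
      { apply Rmult_le_compat_r; auto. apply Rmult_le_pos; lra. }
      lra.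
Qed.

Definition ecst (m : nat) : R := reach * reach * INR m * (1 + reach) ^ m * mass.

Lemma ecst_nonneg m : 0 <= ecst m.
Proof.
  unfold ecst. pose proof reach_ge1. pose proof mass_nonneg. pose proof (pos_INR m).
  assert (0 <= (1 + reach) ^ m) by (apply pow_le; lra).
  apply Rmult_le_pos; [|lra]. apply Rmult_le_pos; [|lra].
  apply Rmult_le_pos; [apply Rmult_le_pos|]; lra.
Qed.

(** Coupled weights differ by at most [reach], so the difference of their [m]-th powers is one order
    lower and compensates the factor [wt l] in [hop_bound]. *)
Lemma hop_commutator m k l :
  Rabs ((wt k ^ m - wt l ^ m) * hop k l)
   <= reach * reach * INR m * (1 + reach) ^ m * nb k l * wt k ^ m.
Proof.
  pose proof (nb_nonneg k l) as Hn. pose proof (wt_ge1 k). pose proof (wt_ge1 l). pose proof reach_ge1.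
  rewrite Rabs_mult. pose proof (hop_bound k l) as Hh.
  destruct (Req_dec (nb k l) 0) as [E|Hne].
  - rewrite E in *. rewrite Rmult_0_r in Hh. pose proof (Rabs_pos (hop k l)).
    replace (Rabs (hop k l)) with 0 by lra. lra.
  - pose proof (nb_close k l Hne) as Hc.
    assert (Hlk : wt l <= (1 + reach) * wt k) by (apply nb_wt; rewrite nb_sym; auto).
    set (Mx := (1 + reach) * wt k).
    assert (HM : wt k <= Mx) by (unfold Mx; nra).
    pose proof (pow_diff m (wt k) (wt l) Mx ltac:(lra) ltac:(unfold Mx; lra)) as Hp.
    pose proof (Rabs_pos (wt k ^ m - wt l ^ m)) as HA.
    apply Rle_trans with (Rabs (wt k ^ m - wt l ^ m) * (reach * Mx * nb k l)).
    + apply Rmult_le_compat_l; auto. apply Rle_trans with (1 := Hh).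
      apply Rmult_le_compat_r; auto. apply Rmult_le_compat_l; [lra|]. exact Hlk.
    + replace (Rabs (wt k ^ m - wt l ^ m) * (reach * Mx * nb k l))
        with (reach * nb k l * (Rabs (wt k ^ m - wt l ^ m) * Mx)) by ring.
      replace (reach * reach * INR m * (1 + reach) ^ m * nb k l * wt k ^ m)
        with (reach * nb k l * (INR m * reach * Mx ^ m)) by (unfold Mx; rewrite Rpow_mult_distr; ring).
      apply Rmult_le_compat_l; [apply Rmult_le_pos; lra|].
      apply Rle_trans with (1 := Hp). apply Rmult_le_compat_r; [apply pow_le; lra|].
      apply Rmult_le_compat_l; [apply pos_INR|auto].
Qed.

(* Antisymmetry of [hop] turns the weighted quadratic form into one with the commutator
   [wt k ^ m - wt l ^ m], which gains the derivative lost by [hop]. *)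
Lemma energy_form m B a : NoDup B ->
  lsum (fun k => wt k ^ m * a k * lsum (fun l => hop k l * a l) B) B
    <= ecst m * lsum (fun k => wt k ^ m * a k ^ 2) B.
Proof.
  intros HN.
  set (Tm := lsum (fun k => wt k ^ m * a k * lsum (fun l => hop k l * a l) B) B).
  assert (E1 : Tm = lsum (fun k => lsum (fun l => wt k ^ m * a k * (hop k l * a l)) B) B).
  { apply lsum_ext. intros k _. now rewrite lsum_scal. }
  assert (E2 : Tm = lsum (fun k => lsum (fun l => - (wt l ^ m * a k * (hop k l * a l))) B) B).
  { rewrite E1, lsum_exchange. apply lsum_ext. intros k _. apply lsum_ext. intros l _.
    rewrite (hop_antisym l k). ring. }
  set (C := reach * reach * INR m * (1 + reach) ^ m).
  assert (HC : 0 <= C).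
  { unfold C. pose proof reach_ge1. pose proof (pos_INR m).
    assert (0 <= (1 + reach) ^ m) by (apply pow_le; lra).
    apply Rmult_le_pos; [|lra]. apply Rmult_le_pos; [apply Rmult_le_pos|]; lra. }
  assert (E3 : 2 * Tm <= lsum (fun k => lsum (fun l => C / 2 * (nb k l * (wt k ^ m * a k ^ 2))
                + C / 2 * (nb k l * (wt l ^ m * a l ^ 2))) B) B).
  { replace (2 * Tm) with (Tm + Tm) by ring. rewrite E1 at 1. rewrite E2, <- lsum_plus.
    apply lsum_le. intros k _. rewrite <- lsum_plus. apply lsum_le. intros l _.
    pose proof (hop_commutator m k l) as H1. pose proof (hop_commutator m l k) as H2.
    replace ((wt l ^ m - wt k ^ m) * hop l k) with ((wt k ^ m - wt l ^ m) * hop k l) in H2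
      by (rewrite (hop_antisym l k); ring).
    rewrite (nb_sym l k) in H2. fold C in H1, H2.
    set (q := (wt k ^ m - wt l ^ m) * hop k l) in *.
    replace (_ + _) with (q * (a k * a l)) by (unfold q; ring).
    pose proof (Rabs_pos q) as Hq.
    apply Rle_trans with (Rabs q * (a k ^ 2 / 2 + a l ^ 2 / 2)).
    - apply Rle_trans with (Rabs (q * (a k * a l))); [apply Rle_abs|]. rewrite Rabs_mult.
      apply Rmult_le_compat_l; auto. apply Rabs_le.
      pose proof (pow2_ge_0 (a k - a l)). pose proof (pow2_ge_0 (a k + a l)). simpl in *. lra.
    - pose proof (pow2_ge_0 (a k)). pose proof (pow2_ge_0 (a l)).
      assert (Rabs q * (a k ^ 2 / 2) <= C * nb k l * wt k ^ m * (a k ^ 2 / 2)) by (apply Rmult_le_compat_r; lra).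
      assert (Rabs q * (a l ^ 2 / 2) <= C * nb k l * wt l ^ m * (a l ^ 2 / 2)) by (apply Rmult_le_compat_r; lra).
      lra. }
  assert (Hw : forall k, 0 <= wt k ^ m * a k ^ 2).
  { intros k. apply Rmult_le_pos; [apply pow_le; pose proof (wt_ge1 k); lra|apply pow2_ge_0]. }
  assert (E4 : lsum (fun k => lsum (fun l => nb k l * (wt k ^ m * a k ^ 2)) B) B
     <= mass * lsum (fun k => wt k ^ m * a k ^ 2) B).
  { rewrite <- lsum_scal. apply lsum_le. intros k _.
    rewrite (lsum_ext _ (fun l => (wt k ^ m * a k ^ 2) * nb k l)) by (intros; ring).
    rewrite lsum_scal, Rmult_comm. apply Rmult_le_compat_r; auto. now apply nb_row'. }
  assert (E5 : lsum (fun k => lsum (fun l => nb k l * (wt l ^ m * a l ^ 2)) B) B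
     <= mass * lsum (fun k => wt k ^ m * a k ^ 2) B).
  { rewrite lsum_exchange. rewrite <- lsum_scal. apply lsum_le. intros k _.
    rewrite (lsum_ext _ (fun l => (wt k ^ m * a k ^ 2) * nb l k)) by (intros; ring).
    rewrite lsum_scal, Rmult_comm. apply Rmult_le_compat_r; auto. now apply nb_row. }
  assert (E6 : lsum (fun k => lsum (fun l => C / 2 * (nb k l * (wt k ^ m * a k ^ 2))
                + C / 2 * (nb k l * (wt l ^ m * a l ^ 2))) B) B
     = C / 2 * lsum (fun k => lsum (fun l => nb k l * (wt k ^ m * a k ^ 2)) B) B
     + C / 2 * lsum (fun k => lsum (fun l => nb k l * (wt l ^ m * a l ^ 2)) B) B).
  { rewrite <- !lsum_scal, <- lsum_plus. apply lsum_ext. intros k _.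
    now rewrite lsum_plus, !lsum_scal. }
  rewrite E6 in E3.
  assert (F1 := Rmult_le_compat_l (C / 2) _ _ ltac:(lra) E4).
  assert (F2 := Rmult_le_compat_l (C / 2) _ _ ltac:(lra) E5).
  unfold ecst. fold C.
  assert (0 <= C * mass * lsum (fun k => wt k ^ m * a k ^ 2) B).
  { apply Rmult_le_pos; [apply Rmult_le_pos; auto using mass_nonneg|]. apply lsum_nonneg; auto. }
  lra.
Qed.

Lemma gronwall (y y' : R -> R) K Q T : 0 <= K -> 0 <= Q ->
  (forall t, 0 <= t <= T -> derivable_pt_lim y t (y' t)) ->
  (forall t, 0 <= t <= T -> y' t <= K * y t + Q) ->
  forall t, 0 <= t <= T -> y t <= (y 0 + Q * t) * exp (K * t).
Proof.
  intros HK HQ Hd Hy t Ht.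
  assert (H : - (exp (- K * 0) * y 0 - Q * 0) <= - (exp (- K * t) * y t - Q * t)).
  { apply (mono_of_deriv (fun t => - (exp (- K * t) * y t - Q * t))
      (fun t => - ((exp (- K * t) * - K) * y t + exp (- K * t) * y' t - Q))); [lra| |].
    - intros z Hz. apply is_derive_Reals. apply derivable_pt_lim_opp.
      apply derivable_pt_lim_minus.
      + apply (derivable_pt_lim_mult (fun t => exp (- K * t)) y); [|apply Hd; lra].
        apply is_derive_Reals. auto_derive; auto. ring.
      + apply is_derive_Reals. auto_derive; auto. ring.
    - intros z Hz. specialize (Hy z ltac:(lra)).
      assert (0 < exp (- K * z)) by apply exp_pos.
      assert (exp (- K * z) <= 1).
      { rewrite <- exp_0. destruct (Req_dec (- K * z) 0) as [->|]; [lra|].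
        apply Rlt_le, exp_increasing. nra. }
      nra. }
  rewrite !Rmult_0_r, exp_0 in H.
  assert (E : exp (- K * t) * exp (K * t) = 1).
  { rewrite <- exp_plus. replace (- K * t + K * t) with 0 by ring. apply exp_0. }
  assert (0 < exp (K * t)) by apply exp_pos.
  apply Rle_trans with (exp (- K * t) * y t * exp (K * t)).
  - right. transitivity (y t * (exp (- K * t) * exp (K * t))); [rewrite E; ring|ring].
  - apply Rmult_le_compat_r; lra.
Qed.

(** The dissipation has the good sign, the transport costs [2 ecst], and Young's inequality for the
    source costs the [+ 1] in the exponent. With zero source this bounds one approximation; with the
    couplings across the edge of a box as source it bounds the difference of two. *)
Lemma energy_gronwall m B nu (a s : R -> idx -> R) T Q : NoDup B -> 0 <= Q ->
  (forall k, 0 <= nu k) ->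
  (forall t k, 0 <= t <= T -> In k B -> derivable_pt_lim (fun t => a t k) t
     (- nu k * a t k + lsum (fun l => hop k l * a t l) B + s t k)) ->
  (forall t, 0 <= t <= T -> lsum (fun k => wt k ^ m * s t k ^ 2) B <= Q) ->
  forall t, 0 <= t <= T ->
    lsum (fun k => wt k ^ m * a t k ^ 2) B <=
      (lsum (fun k => wt k ^ m * a 0 k ^ 2) B + Q * T) * exp ((2 * ecst m + 1) * T).
Proof.
  intros HN HQ Hnu Hd Hs t Ht.
  set (K := 2 * ecst m + 1). assert (HK : 0 <= K) by (unfold K; pose proof (ecst_nonneg m); lra).
  assert (Hw : forall k, 0 <= wt k ^ m) by (intros k; apply pow_le; pose proof (wt_ge1 k); lra).
  assert (Hpos : 0 <= lsum (fun k => wt k ^ m * a 0 k ^ 2) B).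
  { apply lsum_nonneg. intros. apply Rmult_le_pos; auto. apply pow2_ge_0. }
  assert (H : lsum (fun k => wt k ^ m * a t k ^ 2) B <=
     (lsum (fun k => wt k ^ m * a 0 k ^ 2) B + Q * t) * exp (K * t)).
  { apply (gronwall (fun t => lsum (fun k => wt k ^ m * a t k ^ 2) B)
      (fun t => lsum (fun k => wt k ^ m * (2 * a t k *
        (- nu k * a t k + lsum (fun l => hop k l * a t l) B + s t k))) B) K Q T); auto.
    - intros z Hz. apply (lsum_derive (fun k t => wt k ^ m * a t k ^ 2)). intros k Hk.
      apply derivable_pt_lim_scal.
      replace (2 * a z k * _) with (INR 2 * a z k ^ pred 2 *
        (- nu k * a z k + lsum (fun l => hop k l * a z l) B + s z k)) by (simpl; ring).
      apply (derivable_pt_lim_comp (fun t => a t k) (fun x => x ^ 2)); [auto|apply derivable_pt_lim_pow].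
    - intros z Hz. specialize (Hs z Hz).
      pose proof (energy_form m B (a z) HN) as He.
      apply Rle_trans with (2 * lsum (fun k => wt k ^ m * a z k * lsum (fun l => hop k l * a z l) B) B
        + (lsum (fun k => wt k ^ m * a z k ^ 2) B + lsum (fun k => wt k ^ m * s z k ^ 2) B)).
      + rewrite <- lsum_scal, <- !lsum_plus. apply lsum_le. intros k _.
        set (h := lsum (fun l => hop k l * a z l) B).
        specialize (Hw k). specialize (Hnu k).
        assert (0 <= wt k ^ m * (nu k * a z k ^ 2)).
        { apply Rmult_le_pos; auto. apply Rmult_le_pos; auto. apply pow2_ge_0. }
        assert (0 <= wt k ^ m * (a z k - s z k) ^ 2) by (apply Rmult_le_pos; auto; apply pow2_ge_0).
        simpl in *. nra.
      + unfold K. lra. }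
  apply Rle_trans with (1 := H). apply Rmult_le_compat.
  - apply Rplus_le_le_0_compat; auto. apply Rmult_le_pos; lra.
  - apply Rlt_le, exp_pos.
  - assert (Q * t <= Q * T) by (apply Rmult_le_compat_l; lra). lra.
  - destruct (Req_dec t T) as [->|]; [lra|]. destruct (Req_dec K 0) as [->|].
    + rewrite !Rmult_0_l. lra.
    + apply Rlt_le, exp_increasing. apply Rmult_lt_compat_l; lra.
Qed.

End Hop.

(** * Boxes of frequencies and summable weights *)

Fixpoint zrange (M : nat) : list Z :=
  match M with
  | O => 0%Z :: nil
  | S m => Z.of_nat (S m) :: (- Z.of_nat (S m))%Z :: zrange m
  end.

Lemma in_zrange M z : In z (zrange M) <-> (Z.abs z <= Z.of_nat M)%Z.
Proof.
  induction M as [|M IH]; cbn [zrange In].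
  - split; [intros [<-|[]]; reflexivity|]. intros H. left. lia.
  - rewrite IH. lia.
Qed.

Lemma zrange_NoDup M : NoDup (zrange M).
Proof.
  induction M as [|M IH]; cbn [zrange].
  - repeat constructor. simpl; tauto.
  - constructor; [|constructor; auto].
    + cbn [In]. rewrite in_zrange. lia.
    + rewrite in_zrange. lia.
Qed.

Definition box (M : nat) : list idx := list_prod (zrange M) (zrange M).

Lemma in_box M k : In k (box M) <->
  (Z.abs (fst k) <= Z.of_nat M /\ Z.abs (snd k) <= Z.of_nat M)%Z.
Proof.
  destruct k as [k1 k2]. unfold box. rewrite in_prod_iff, !in_zrange. reflexivity.
Qed.

Lemma list_prod_NoDup {X Y} (l : list X) (l' : list Y) : NoDup l -> NoDup l' -> NoDup (list_prod l l').
Proof.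
  intros H H'. induction H as [|a l Ha Hl IH]; simpl; [constructor|].
  apply NoDup_app; auto.
  - apply NoDup_map_NoDup_ForallPairs; auto. intros x y _ _ E. now inversion E.
  - intros [x y] Hx Hy. apply in_map_iff in Hx. destruct Hx as (z & E & _). inversion E; subst.
    apply in_prod_iff in Hy. tauto.
Qed.

Lemma box_NoDup M : NoDup (box M).
Proof. apply list_prod_NoDup; apply zrange_NoDup. Qed.

Lemma box_incl M M' k : (M <= M')%nat -> In k (box M) -> In k (box M').
Proof. rewrite !in_box. lia. Qed.

Lemma lsum_prod {X Y} (f : X -> R) (g : Y -> R) l l' :
  lsum (fun k => f (fst k) * g (snd k)) (list_prod l l') = lsum f l * lsum g l'.
Proof.
  induction l as [|a l IH]; simpl; [ring|].
  rewrite lsum_app, IH, lsum_map. simpl. rewrite (lsum_scal (f a) g). ring.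
Qed.

(** The remainder [2 / (INR M + 1)] telescopes and makes the induction close. *)
Lemma zrange_sum M : lsum (fun z => / (1 + Rabs (IZR z)) ^ 2) (zrange M) <= 3 - 2 / (INR M + 1).
Proof.
  induction M as [|M IH].
  - simpl. rewrite Rabs_R0. lra.
  - cbn [zrange lsum]. rewrite opp_IZR, Rabs_Ropp, <- INR_IZR_INZ, (Rabs_pos_eq (INR (S M))) by apply pos_INR.
    rewrite S_INR. pose proof (pos_INR M).
    assert (/ (1 + (INR M + 1)) ^ 2 + / (1 + (INR M + 1)) ^ 2 <= 2 / (INR M + 1) - 2 / (INR M + 1 + 1)).
    { replace (2 / (INR M + 1) - 2 / (INR M + 1 + 1)) with (2 * / ((INR M + 1) * (INR M + 2))) by (field; lra).
      assert (/ (1 + (INR M + 1)) ^ 2 <= / ((INR M + 1) * (INR M + 2))); [|lra].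
      apply Rinv_le_contravar; nra. }
    lra.
Qed.

Lemma box_sum M : lsum (fun k => / wt k ^ 4) (box M) <= 9.
Proof.
  assert (H3 : 0 <= lsum (fun z => / (1 + Rabs (IZR z)) ^ 2) (zrange M) <= 3).
  { split.
    - apply lsum_nonneg. intros z _. apply Rlt_le, Rinv_0_lt_compat, pow_lt.
      pose proof (Rabs_pos (IZR z)). lra.
    - apply Rle_trans with (1 := zrange_sum M).
      assert (0 < 2 / (INR M + 1)) by (apply Rdiv_lt_0_compat; pose proof (pos_INR M); lra). lra. }
  apply Rle_trans with (lsum (fun k : idx => / (1 + Rabs (IZR (fst k))) ^ 2 * / (1 + Rabs (IZR (snd k))) ^ 2) (box M)).
  - apply lsum_le. intros k _. pose proof (Rabs_pos (IZR (fst k))). pose proof (Rabs_pos (IZR (snd k))).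
    assert (0 < (1 + Rabs (IZR (fst k))) ^ 2) by (apply pow_lt; lra).
    assert (0 < (1 + Rabs (IZR (snd k))) ^ 2) by (apply pow_lt; lra).
    rewrite <- Rinv_mult. apply Rinv_le_contravar; [now apply Rmult_lt_0_compat|].
    replace (wt k ^ 4) with (wt k ^ 2 * wt k ^ 2) by ring. unfold wt.
    apply Rmult_le_compat; try lra; apply pow_incr; lra.
  - unfold box. rewrite (lsum_prod (fun z => / (1 + Rabs (IZR z)) ^ 2) (fun z => / (1 + Rabs (IZR z)) ^ 2)). nra.
Qed.

(** Cauchy-Schwarz in Young form, with [wt^(-4)] summable over [Z^2]. The free [lam] balances the
    two terms: for [lam = 1 / (M + 1)] an energy of order [1 / (M + 1)^2] yields a sum of order
    [1 / (M + 1)]. *)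
Lemma weighted_l1 q M (a : idx -> R) lam E : 0 < lam ->
  lsum (fun k => wt k ^ (2 * q + 4) * a k ^ 2) (box M) <= E ->
  lsum (fun k => Rabs (a k) * wt k ^ q) (box M) <= (9 * lam + E / lam) / 2.
Proof.
  intros Hl HE.
  apply Rle_trans with (lsum (fun k => lam / 2 * / wt k ^ 4 + / (2 * lam) * (wt k ^ (2 * q + 4) * a k ^ 2)) (box M)).
  - apply lsum_le. intros k _. pose proof (wt_ge1 k).
    set (w := wt k ^ q). set (z := wt k ^ 2).
    assert (Hz : 0 < z) by (apply pow_lt; lra).
    replace (wt k ^ (2 * q + 4)) with (w * w * z * z).
    2: { unfold w, z. rewrite <- !pow_add. f_equal. lia. }
    replace (wt k ^ 4) with (z * z) by (unfold z; ring).
    rewrite <- (pow2_abs (a k)).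
    pose proof (pow2_ge_0 (Rabs (a k) * w * z - lam / z)) as Hsq.
    assert (E0 : lam / 2 * / (z * z) + / (2 * lam) * (w * w * z * z * Rabs (a k) ^ 2) - Rabs (a k) * w
      = (Rabs (a k) * w * z - lam / z) ^ 2 * / (2 * lam)) by (field; lra).
    assert (0 <= (Rabs (a k) * w * z - lam / z) ^ 2 * / (2 * lam)).
    { apply Rmult_le_pos; auto. apply Rlt_le, Rinv_0_lt_compat; lra. }
    lra.
  - rewrite lsum_plus, !lsum_scal. pose proof (box_sum M).
    assert (lam / 2 * lsum (fun a => / wt a ^ 4) (box M) <= lam / 2 * 9) by (apply Rmult_le_compat_l; lra).
    assert (/ (2 * lam) * lsum (fun k => wt k ^ (2 * q + 4) * a k ^ 2) (box M) <= / (2 * lam) * E).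
    { apply Rmult_le_compat_l; auto. apply Rlt_le, Rinv_0_lt_compat; lra. }
    replace ((9 * lam + E / lam) / 2) with (lam / 2 * 9 + / (2 * lam) * E) by (field; lra). lra.
Qed.

(** * Uniform bounds and convergence of the truncated systems *)

Section Galerkin.
Variables (L : list mode) (nu : idx -> R).
Hypothesis Hnu : forall k, 0 <= nu k.

(* [nu] is the symbol of the dissipation. *)
Definition gmat (k l : idx) : R := - nu k * delta k l + hop L k l.
Definition gal (M : nat) (b : idx -> R) (k : idx) (t : R) : R := mexp (box M) gmat b k t.

Definition supp (m : nat) (b : idx -> R) : Prop := forall k, b k <> 0 -> In k (box m).

(** It acts on all of [Z^2], independently of the truncation; for data supported in a box it agrees
    there with the truncated matrix. *)
Definition generator (b : idx -> R) (k : idx) : R :=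
  - nu k * b k - lsum (fun e => / 2 * fst e * cross (snd e) k * (b (zsub k (snd e)) - b (zadd k (snd e)))) L.

Lemma hop_apply B b k : NoDup B -> (forall l, b l <> 0 -> In l B) ->
  lsum (fun l => hop L k l * b l) B
  = - lsum (fun e => / 2 * fst e * cross (snd e) k * (b (zsub k (snd e)) - b (zadd k (snd e)))) L.
Proof.
  intros HN Hb.
  rewrite (lsum_ext _ (fun l => lsum (fun e : mode =>
     - (/ 2 * fst e * cross (snd e) l) * (delta k (zadd l (snd e)) - delta k (zsub l (snd e))) * b l) L)).
  2: { intros l _. unfold hop. rewrite Rmult_comm, <- lsum_scal. apply lsum_ext. intros; ring. }
  rewrite lsum_exchange.
  replace (- lsum _ L) with (lsum (fun e : mode => -1 * (/ 2 * fst e * cross (snd e) k * (b (zsub k (snd e)) - b (zadd k (snd e))))) L)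
    by (rewrite lsum_scal; ring).
  apply lsum_ext. intros [p j] _; simpl fst; simpl snd.
  assert (Hdel : forall (f : idx -> R) l0, (f l0 <> 0 -> In l0 B) ->
    lsum (fun l => delta l l0 * f l) B = f l0).
  { intros f l0 Hf. destruct (in_dec idx_dec l0 B).
    - now apply delta_sum.
    - rewrite delta_sum_out by auto. destruct (Req_dec (f l0) 0); [auto|tauto]. }
  rewrite (lsum_ext _ (fun l => delta l (zsub k j) * (- (/ 2 * p * cross j l) * b l)
     + -1 * (delta l (zadd k j) * (- (/ 2 * p * cross j l) * b l)))).
  2: { intros l _. rewrite delta_add_sub.
       assert (E : delta k (zsub l j) = delta l (zadd k j)).
       { rewrite (delta_add_sub l k j). reflexivity. }
       rewrite E. ring. }
  rewrite lsum_plus, lsum_scal.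
  rewrite (Hdel (fun l => - (/ 2 * p * cross j l) * b l) (zsub k j)).
  2: { intros H. apply Hb. intros E. apply H. rewrite E. ring. }
  rewrite (Hdel (fun l => - (/ 2 * p * cross j l) * b l) (zadd k j)).
  2: { intros H. apply Hb. intros E. apply H. rewrite E. ring. }
  destruct (cross_sym_shift j k) as [-> ->]. ring.
Qed.

Lemma mapp_generator M b k : supp M b -> In k (box M) -> mapp (box M) gmat b k = generator b k.
Proof.
  intros Hb Hk. unfold mapp, gmat, generator.
  rewrite (lsum_ext _ (fun l => delta l k * (- nu k * b l) + hop L k l * b l)).
  2: { intros l _. rewrite (delta_sym k l). ring. }
  rewrite lsum_plus, (delta_sum (fun l => - nu k * b l)), (hop_apply (box M)); auto using box_NoDup.
Qed.

Lemma mapp_split M (a : idx -> R) k : In k (box M) ->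
  mapp (box M) gmat a k = - nu k * a k + lsum (fun l => hop L k l * a l) (box M).
Proof.
  intros Hk. unfold mapp, gmat.
  rewrite (lsum_ext _ (fun l => delta l k * (- nu k * a l) + hop L k l * a l)).
  2: { intros l _. rewrite (delta_sym k l). ring. }
  rewrite lsum_plus, (delta_sum (fun l => - nu k * a l)); auto using box_NoDup.
Qed.

Lemma gal_0 M b k : gal M b k 0 = b k.
Proof. apply mexp_0. Qed.

(** A linear flow commutes with its matrix, so the time derivative is again a Galerkin solution,
    with datum [generator b]. *)
Lemma gal_derive M b k t : In k (box M) -> supp M b ->
  derivable_pt_lim (gal M b k) t (gal M (generator b) k t).
Proof.
  intros Hk Hb. unfold gal.
  rewrite <- (mexp_ext (box M) gmat (mapp (box M) gmat b) (generator b)); auto.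
  - now apply mexp_derive.
  - intros l Hl. now apply mapp_generator.
Qed.

Lemma gal_generator M b k t : In k (box M) -> supp M b ->
  gal M (generator b) k t = - nu k * gal M b k t + lsum (fun l => hop L k l * gal M b l t) (box M).
Proof.
  intros Hk Hb. unfold gal.
  rewrite <- (mexp_ext (box M) gmat (mapp (box M) gmat b) (generator b)); auto.
  - rewrite mexp_mapp by auto. apply (mapp_split M (fun l => mexp (box M) gmat b l t)); auto.
  - intros l Hl. now apply mapp_generator.
Qed.

Lemma supp_mono m m' b : (m <= m')%nat -> supp m b -> supp m' b.
Proof. intros Hm Hb k Hk. apply box_incl with m; auto. Qed.

Lemma gal_energy_bound b m T : 0 <= T -> (exists m0, supp m0 b) -> exists C, 0 <= C /\
  forall M t, supp M b -> 0 <= t <= T ->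
    lsum (fun k => wt k ^ m * gal M b k t ^ 2) (box M) <= C.
Proof.
  intros HT [m0 Hb].
  set (E := lsum (fun k => wt k ^ m * b k ^ 2) (box m0)).
  assert (Hw : forall k (z : R), 0 <= wt k ^ m * z ^ 2).
  { intros k z. apply Rmult_le_pos; [apply pow_le; pose proof (wt_ge1 k); lra|apply pow2_ge_0]. }
  assert (HE : 0 <= E) by (apply lsum_nonneg; auto).
  exists (E * exp ((2 * ecst L m + 1) * T)). split.
  { apply Rmult_le_pos; auto. apply Rlt_le, exp_pos. }
  intros M t HbM Ht.
  apply Rle_trans with (1 := energy_gronwall L m (box M) nu (fun t k => gal M b k t) (fun _ _ => 0)
    T 0 (box_NoDup M) (Rle_refl 0) Hnu
    ltac:(intros z k Hz Hk; rewrite Rplus_0_r; cbn beta; rewrite <- gal_generator by auto; now apply gal_derive)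
    ltac:(intros z Hz; rewrite (lsum_ext _ (fun _ => 0)) by (intros; ring); rewrite lsum_zero; lra) t Ht).
  apply Rmult_le_compat_r; [apply Rlt_le, exp_pos|].
  rewrite Rmult_0_l, Rplus_0_r.
  rewrite (lsum_ext _ (fun k => wt k ^ m * b k ^ 2)) by (intros; now rewrite gal_0).
  apply lsum_nested; auto using box_NoDup.
  intros k _ Hk. apply Hb. intros E0. apply Hk. rewrite E0. ring.
Qed.

Definition gal_ext (M : nat) (b : idx -> R) (k : idx) (t : R) : R :=
  if in_dec idx_dec k (box M) then gal M b k t else 0.

Lemma wt_out M k : ~ In k (box M) -> INR M + 1 <= wt k.
Proof.
  rewrite in_box. intros H. unfold wt. rewrite <- !abs_IZR.
  assert (Ha : forall z : Z, (Z.of_nat M + 1 <= z)%Z -> INR M + 1 <= IZR z).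
  { intros z Hz. rewrite INR_IZR_INZ, <- plus_IZR. now apply IZR_le. }
  assert (P1 : 0 <= IZR (Z.abs (fst k))) by (apply IZR_le; lia).
  assert (P2 : 0 <= IZR (Z.abs (snd k))) by (apply IZR_le; lia).
  destruct (Z_le_dec (Z.abs (fst k)) (Z.of_nat M)).
  - specialize (Ha (Z.abs (snd k)) ltac:(lia)). lra.
  - specialize (Ha (Z.abs (fst k)) ltac:(lia)). lra.
Qed.

Lemma lsum_cauchy_schwarz {X} (f g : X -> R) l : (forall a, 0 <= f a) ->
  lsum (fun a => f a * g a) l ^ 2 <= lsum f l * lsum (fun a => f a * g a ^ 2) l.
Proof.
  intros Hf. induction l as [|a l IH]; cbn [lsum]; [simpl; lra|].
  set (x := lsum (fun a => f a * g a) l) in *. set (y := lsum f l) in *.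
  set (z := lsum (fun a => f a * g a ^ 2) l) in *.
  assert (Hy : 0 <= y) by (apply lsum_nonneg; auto).
  assert (Hz : 0 <= z) by (apply lsum_nonneg; intros; apply Rmult_le_pos; auto; apply pow2_ge_0).
  specialize (Hf a).
  assert (Hk : 2 * x * g a <= z + y * g a ^ 2).
  { destruct (Req_dec y 0) as [E|].
    - rewrite E, Rmult_0_l in IH. assert (x = 0) by (simpl in IH; nra). subst x. rewrite H.
      rewrite E. lra.
    - apply Rmult_le_reg_l with y; [lra|].
      pose proof (pow2_ge_0 (x - y * g a)). simpl in *. nra. }
  replace ((f a * g a + x) ^ 2) with (f a * (f a * g a ^ 2) + f a * (2 * x * g a) + x ^ 2) by ring.
  assert (f a * (2 * x * g a) <= f a * (z + y * g a ^ 2)) by (apply Rmult_le_compat_l; auto).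
  lra.
Qed.

(* A mode outside the box is coupled only to modes of frequency comparable with [M] or larger,
   which gives the factor [1 / (M + 1)]. *)
Lemma annulus_bound M (a : idx -> R) k : ~ In k (box M) ->
  Rabs (lsum (fun l => hop L k l * a l) (box M)) <=
    lsum (fun l => nb L k l * (reach L * (1 + reach L) / (INR M + 1) * wt l ^ 2 * Rabs (a l))) (box M).
Proof.
  intros Hk. pose proof (wt_out M k Hk) as Ho. pose proof (reach_ge1 L). pose proof (pos_INR M).
  apply Rle_trans with (1 := lsum_abs _ _). apply lsum_le. intros l _.
  rewrite Rabs_mult. pose proof (hop_bound L k l) as Hh. pose proof (nb_nonneg L k l) as Hn.
  pose proof (wt_ge1 l). pose proof (Rabs_pos (a l)).
  destruct (Req_dec (nb L k l) 0) as [E|Hne].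
  - rewrite E in *. rewrite Rmult_0_r in Hh. pose proof (Rabs_pos (hop L k l)).
    replace (Rabs (hop L k l)) with 0 by lra. lra.
  - pose proof (nb_wt L k l Hne) as Hw.
    replace (nb L k l * (reach L * (1 + reach L) / (INR M + 1) * wt l ^ 2 * Rabs (a l)))
      with (reach L * wt l * nb L k l * ((1 + reach L) * wt l / (INR M + 1)) * Rabs (a l)) by (field; lra).
    apply Rmult_le_compat_r; auto. apply Rle_trans with (1 := Hh).
    rewrite <- (Rmult_1_r (reach L * wt l * nb L k l)) at 1.
    apply Rmult_le_compat_l.
    + apply Rmult_le_pos; auto. apply Rmult_le_pos; lra.
    + apply Rmult_le_reg_r with (INR M + 1); [lra|].
      replace ((1 + reach L) * wt l / (INR M + 1) * (INR M + 1)) with ((1 + reach L) * wt l) by (field; lra).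
      lra.
Qed.

(** Extended by zero, the solution on the small box solves the system on the large one up to the
    couplings leaving the small box. [annulus_bound] trades four extra powers of the weight in the
    energy for the factor [1 / (M + 1)^2], and the initial difference vanishes because the datum is
    supported in the small box. *)
Lemma gal_cauchy_energy b m T : 0 <= T -> (exists m0, supp m0 b) -> exists C, 0 <= C /\
  forall M M' t, supp M b -> (M <= M')%nat -> 0 <= t <= T ->
    lsum (fun k => wt k ^ m * (gal M' b k t - gal_ext M b k t) ^ 2) (box M') <= C / (INR M + 1) ^ 2.
Proof.
  intros HT Hb. destruct (gal_energy_bound b (m + 4) T HT Hb) as (C0 & HC0 & HE).
  set (rr := reach L * (1 + reach L)).
  set (C1 := rr ^ 2 * (1 + reach L) ^ m * (mass L * (mass L * C0))).
  pose proof (reach_ge1 L) as Hr. pose proof (mass_nonneg L) as Hm.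
  assert (HC1 : 0 <= C1).
  { unfold C1. apply Rmult_le_pos.
    - apply Rmult_le_pos; [apply pow2_ge_0|apply pow_le; lra].
    - apply Rmult_le_pos; auto. apply Rmult_le_pos; auto. }
  set (X := exp ((2 * ecst L m + 1) * T)). assert (HX : 0 < X) by apply exp_pos.
  exists (C1 * T * X). split.
  { apply Rmult_le_pos; [apply Rmult_le_pos|]; lra. }
  intros M M' t HbM HM Ht.
  pose proof (pos_INR M) as HMp. assert (HMsq : 0 < (INR M + 1) ^ 2) by (apply pow_lt; lra).
  set (Q := C1 / (INR M + 1) ^ 2).
  assert (HQ : 0 <= Q) by (apply Rmult_le_pos; auto; apply Rlt_le, Rinv_0_lt_compat; auto).
  set (src := fun (t : R) k => if in_dec idx_dec k (box M) then 0 else lsum (fun l => hop L k l * gal M b l t) (box M)).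
  assert (HbM' : supp M' b) by (apply supp_mono with M; auto).
  assert (Hnest : forall k t, lsum (fun l => hop L k l * gal_ext M b l t) (box M')
     = lsum (fun l => hop L k l * gal M b l t) (box M)).
  { intros k z. symmetry.
    rewrite (lsum_ext _ (fun l => hop L k l * gal_ext M b l z)).
    - apply lsum_nested_eq; auto using box_NoDup.
      + intros l Hl. apply box_incl with M; auto.
      + intros l _ Hl. unfold gal_ext. destruct in_dec; [tauto|ring].
    - intros l Hl. unfold gal_ext. destruct in_dec; [ring|tauto]. }
  assert (Hder : forall z k, 0 <= z <= T -> In k (box M') ->
    derivable_pt_lim (fun t => gal M' b k t - gal_ext M b k t) z
      (- nu k * (gal M' b k z - gal_ext M b k z)
       + lsum (fun l => hop L k l * (gal M' b l z - gal_ext M b l z)) (box M') + src z k)).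
  { intros z k Hz Hk.
    rewrite (lsum_ext (fun l => hop L k l * (gal M' b l z - gal_ext M b l z))
      (fun l => hop L k l * gal M' b l z - hop L k l * gal_ext M b l z)) by (intros; ring).
    rewrite lsum_minus, Hnest.
    pose proof (gal_derive M' b k z Hk HbM') as D1. rewrite gal_generator in D1 by auto.
    unfold gal_ext, src. destruct (in_dec idx_dec k (box M)) as [Hi|Ho].
    - pose proof (gal_derive M b k z Hi HbM) as D2. rewrite gal_generator in D2 by auto.
      pose proof (derivable_pt_lim_minus _ _ _ _ _ D1 D2) as D.
      match goal with |- derivable_pt_lim _ _ ?l => match type of D with derivable_pt_lim _ _ ?l' =>
        replace l with l' by ring end end. exact D.
    - pose proof (derivable_pt_lim_minus _ _ _ _ _ D1 (derivable_pt_lim_const 0 z)) as D.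
      match goal with |- derivable_pt_lim _ _ ?l => match type of D with derivable_pt_lim _ _ ?l' =>
        replace l with l' by ring end end. exact D. }
  assert (Hsrc : forall z, 0 <= z <= T -> lsum (fun k => wt k ^ m * src z k ^ 2) (box M') <= Q).
  { intros z Hz. set (a := fun l => gal M b l z).
    set (D := mass L * (rr / (INR M + 1)) ^ 2 * (1 + reach L) ^ m).
    assert (HD : 0 <= D).
    { unfold D. apply Rmult_le_pos; [apply Rmult_le_pos; auto; apply pow2_ge_0|apply pow_le; lra]. }
    assert (Hw : forall l, 0 <= wt l ^ (m + 4) * a l ^ 2).
    { intros l. apply Rmult_le_pos; [apply pow_le; pose proof (wt_ge1 l); lra|apply pow2_ge_0]. }
    apply Rle_trans with (lsum (fun k => lsum (fun l => D * (nb L k l * (wt l ^ (m + 4) * a l ^ 2))) (box M)) (box M')).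
    - apply lsum_le. intros k _. rewrite lsum_scal.
      assert (Hwk : 0 <= wt k ^ m) by (apply pow_le; pose proof (wt_ge1 k); lra).
      unfold src. destruct (in_dec idx_dec k (box M)) as [Hi|Ho].
      + replace (wt k ^ m * 0 ^ 2) with 0 by ring. apply Rmult_le_pos; auto.
        apply lsum_nonneg. intros l _. apply Rmult_le_pos; auto using nb_nonneg.
      + fold (a). pose proof (annulus_bound M a k Ho) as Ha. unfold a in Ha at 1.
        fold rr in Ha.
        apply Rle_trans with (wt k ^ m * (mass L *
          lsum (fun l => nb L k l * (rr / (INR M + 1) * wt l ^ 2 * Rabs (a l)) ^ 2) (box M))).
        * apply Rmult_le_compat_l; auto. rewrite <- pow2_abs.
          apply Rle_trans with (lsum (fun l => nb L k l * (rr / (INR M + 1) * wt l ^ 2 * Rabs (a l))) (box M) ^ 2).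
          -- apply pow_incr. split; [apply Rabs_pos|exact Ha].
          -- apply Rle_trans with (1 := lsum_cauchy_schwarz (nb L k) _ (box M) (nb_nonneg L k)).
             apply Rmult_le_compat_r.
             ++ apply lsum_nonneg. intros l _. apply Rmult_le_pos; auto using nb_nonneg, pow2_ge_0.
             ++ apply nb_row', box_NoDup.
        * unfold D.
          replace (wt k ^ m * (mass L * lsum (fun l => nb L k l * (rr / (INR M + 1) * wt l ^ 2 * Rabs (a l)) ^ 2) (box M)))
            with (mass L * (rr / (INR M + 1)) ^ 2 * lsum (fun l => wt k ^ m * (nb L k l * (wt l ^ 4 * a l ^ 2))) (box M)).
          2: { rewrite lsum_scal.
               rewrite (lsum_ext (fun l => nb L k l * (rr / (INR M + 1) * wt l ^ 2 * Rabs (a l)) ^ 2)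
                 (fun l => (rr / (INR M + 1)) ^ 2 * (nb L k l * (wt l ^ 4 * a l ^ 2)))).
               - rewrite lsum_scal. ring.
               - intros l _. rewrite <- (pow2_abs (a l)). ring. }
          rewrite (Rmult_assoc _ ((1 + reach L) ^ m)), <- (lsum_scal ((1 + reach L) ^ m)).
          apply Rmult_le_compat_l.
          { apply Rmult_le_pos; auto. apply pow2_ge_0. }
          apply lsum_le. intros l _. pose proof (nb_nonneg L k l) as Hn.
          destruct (Req_dec (nb L k l) 0) as [E|Hne]; [rewrite E; lra|].
          pose proof (nb_wt L k l Hne) as Hwkl. pose proof (wt_ge1 k). pose proof (wt_ge1 l).
          assert (Hp : wt k ^ m <= (1 + reach L) ^ m * wt l ^ m).
          { rewrite <- Rpow_mult_distr. apply pow_incr. lra. }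
          rewrite pow_add.
          replace ((1 + reach L) ^ m * (nb L k l * (wt l ^ m * wt l ^ 4 * a l ^ 2)))
            with ((1 + reach L) ^ m * wt l ^ m * (nb L k l * (wt l ^ 4 * a l ^ 2))) by ring.
          apply Rmult_le_compat_r; auto. apply Rmult_le_pos; auto.
          apply Rmult_le_pos; [apply pow_le; lra|apply pow2_ge_0].
    - rewrite lsum_exchange.
      apply Rle_trans with (lsum (fun l => D * mass L * (wt l ^ (m + 4) * a l ^ 2)) (box M)).
      + apply lsum_le. intros l _.
        rewrite (lsum_ext _ (fun k => D * (wt l ^ (m + 4) * a l ^ 2) * nb L k l)) by (intros; ring).
        rewrite lsum_scal.
        replace (D * mass L * (wt l ^ (m + 4) * a l ^ 2)) with (D * (wt l ^ (m + 4) * a l ^ 2) * mass L) by ring.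
        apply Rmult_le_compat_l; [apply Rmult_le_pos; auto|]. apply nb_row, box_NoDup.
      + rewrite lsum_scal. specialize (HE M z HbM Hz).
        apply Rle_trans with (D * mass L * C0).
        * apply Rmult_le_compat_l; auto. apply Rmult_le_pos; auto.
        * right. unfold Q, C1, D. field. lra. }
  apply Rle_trans with (1 := energy_gronwall L m (box M') nu (fun t k => gal M' b k t - gal_ext M b k t) src T Q
    (box_NoDup M') HQ Hnu Hder Hsrc t Ht).
  fold X. rewrite (lsum_ext _ (fun _ => 0)), lsum_zero.
  - right. unfold Q. field. lra.
  - intros k _. unfold gal_ext. rewrite gal_0. destruct (in_dec idx_dec k (box M)) as [Hi|Ho].
    + rewrite gal_0. ring.
    + destruct (Req_dec (b k) 0) as [E|Hne]; [rewrite E; ring|]. elim Ho. now apply HbM.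
Qed.

Theorem gal_bound b q T : 0 <= T -> (exists m0, supp m0 b) -> exists C, 0 <= C /\
  forall M t, supp M b -> 0 <= t <= T ->
    lsum (fun k => Rabs (gal M b k t) * wt k ^ q) (box M) <= C.
Proof.
  intros HT Hb. destruct (gal_energy_bound b (2 * q + 4) T HT Hb) as (C & HC & H).
  exists ((9 * 1 + C / 1) / 2). split; [lra|]. intros M t HM Ht.
  apply weighted_l1; [lra|]. now apply H.
Qed.

Theorem gal_cauchy b q T : 0 <= T -> (exists m0, supp m0 b) -> exists C, 0 <= C /\
  forall M M' t, supp M b -> (M <= M')%nat -> 0 <= t <= T ->
    lsum (fun k => Rabs (gal M' b k t - gal_ext M b k t) * wt k ^ q) (box M') <= C / (INR M + 1).
Proof.
  intros HT Hb. destruct (gal_cauchy_energy b (2 * q + 4) T HT Hb) as (C & HC & H).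
  exists ((9 + C) / 2). split; [lra|]. intros M M' t HM HMM Ht.
  pose proof (pos_INR M).
  apply Rle_trans with (1 := weighted_l1 q M' (fun k => gal M' b k t - gal_ext M b k t) (/ (INR M + 1)) _
    ltac:(apply Rinv_0_lt_compat; lra) (H M M' t HM HMM Ht)).
  right. field. lra.
Qed.

End Galerkin.

(** * Fourier modes are eigenfunctions *)

Lemma ph_lip k x y : Rabs (ph k x - ph k y)
  <= (Rabs (IZR (fst k)) + Rabs (IZR (snd k))) * dist2 x y.
Proof.
  unfold ph.
  replace (_ - _) with (IZR (fst k) * (fst x - fst y) + IZR (snd k) * (snd x - snd y)) by ring.
  apply Rle_trans with (1 := Rabs_triang _ _). rewrite !Rabs_mult, Rmult_plus_distr_r.
  apply Rplus_le_compat; (apply Rmult_le_compat_l; [apply Rabs_pos|]).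
  - apply (fst_le_norm2 (fst x - fst y, snd x - snd y)).
  - apply (snd_le_norm2 (fst x - fst y, snd x - snd y)).
Qed.

Lemma Rabs_cos_diff a b : Rabs (cos a - cos b) <= Rabs (a - b).
Proof.
  rewrite !cos_sin. apply Rle_trans with (1 := Rabs_sin_diff _ _).
  right. f_equal. ring.
Qed.

Definition ang (k : Z * Z) (r phi : R) : R := r * (IZR (fst k) * cos phi + IZR (snd k) * sin phi).

Lemma ph_circ k x r phi : ph k (circ x r phi) = ph k x + ang k r phi.
Proof. unfold ph, circ, ang; simpl. ring. Qed.

Lemma sin_ang_continuous k r phi : continuous (fun phi => sin (ang k r phi)) phi.
Proof.
  apply (ex_derive_continuous (fun phi => sin (ang k r phi))). unfold ang. auto_derive. auto.
Qed.

Lemma ex_sin_ang k r a b : ex_RInt (fun phi => sin (ang k r phi)) a b.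
Proof.
  apply (ex_RInt_continuous (V := R_CompleteNormedModule)). intros; apply sin_ang_continuous.
Qed.

(* [ang k r] changes sign under the half turn [phi -> phi + PI]. *)
Lemma RInt_sin_ang k r : RInt (fun phi => sin (ang k r phi)) 0 (2 * PI) = 0.
Proof.
  assert (E : RInt (fun phi => sin (ang k r phi)) 0 PI + RInt (fun phi => sin (ang k r phi)) PI (2 * PI)
     = RInt (fun phi => sin (ang k r phi)) 0 (2 * PI)).
  { apply (RInt_Chasles (V := R_CompleteNormedModule)); apply ex_sin_ang. }
  rewrite <- E.
  pose proof (RInt_comp_lin (V := R_CompleteNormedModule) (fun phi => sin (ang k r phi)) 1 PI 0 PI) as H.
  replace (1 * 0 + PI) with PI in H by ring. replace (1 * PI + PI) with (2 * PI) in H by ring.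
  rewrite <- H by apply ex_sin_ang.
  rewrite (RInt_ext (fun y => scal 1 (sin (ang k r (1 * y + PI)))) (fun y => -1 * sin (ang k r y))).
  - destruct (RInt_scalR (fun y => sin (ang k r y)) (-1) 0 PI (ex_sin_ang k r 0 PI)) as [_ E2].
    rewrite E2. generalize (RInt (fun y => sin (ang k r y)) 0 PI). intros z. eqR.
    assert (Hz : forall z : R, z + -1 * z = 0) by (intros; ring). apply Hz.
  - intros y _. unfold scal; simpl; unfold mult; simpl. eqR. rewrite Rmult_1_l.
    unfold ang. rewrite Rmult_1_l, neg_cos, neg_sin.
    replace (r * (IZR (fst k) * - cos y + IZR (snd k) * - sin y))
      with (- (r * (IZR (fst k) * cos y + IZR (snd k) * sin y))) by ring.
    rewrite sin_neg. ring.
Qed.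

Section Symbol.
Variables (s : R).
Hypotheses (Hs : 0 < s) (Hs' : s < 1 / 2).

(* Only existence and nonnegativity of the eigenvalue are used, never its value. *)
Lemma symbol_exists k : exists lat, 0 <= lat /\
  forall x, pv_frac_integral s (fun y => sin (ph k y)) x (lat * sin (ph k x)).
Proof.
  destruct (pv_exists s 2 (Rabs (IZR (fst k)) + Rabs (IZR (snd k))) (fun y => cos (ph k y)) (0, 0) Hs Hs')
    as [lat Hsg].
  { intros y. apply Rabs_le. pose proof (COS_bound (ph k (0, 0))). pose proof (COS_bound (ph k y)). lra. }
  { intros y z. apply Rle_trans with (1 := Rabs_cos_diff _ _). apply ph_lip. }
  exists lat. split.
  (* The cosine is maximal at the origin, so its increments there are nonnegative and its principal
     value dominates that of the zero function. *)
  - apply Ropp_le_cancel. rewrite Ropp_0. apply le_epsilon. intros eps He.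
    destruct (Kc_small s eps Hs Hs' He) as (d & Hd & HK).
    assert (0 - lat <= Kc s d d); [|lra].
    apply (pv_compare s (fun _ => 0) (fun y => cos (ph k y)) (0, 0)); auto using zero_pv.
    intros y. assert (0 <= Rmin d (d * dist2 (0, 0) y)).
    { apply Rmin_glb; [lra|]. apply Rmult_le_pos; [lra|apply dist2_nonneg]. }
    unfold ph at 1; simpl. rewrite !Rmult_0_r, Rplus_0_r, cos_0.
    pose proof (COS_bound (ph k y)). lra.
  - intros x. apply pv_iff in Hsg. destruct Hsg as [G [HG HI]]. apply pv_iff.
    exists (fun r => sin (ph k x) * G r). split.
    + intros r Hr. destruct (HG r Hr) as [E1 E2].
      destruct (RInt_scalR _ (sin (ph k x)) _ _ E1) as [S1 S2].
      destruct (RInt_scalR _ (cos (ph k x)) _ _ (ex_sin_ang k r 0 (2 * PI))) as [T1 T2].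
      destruct (RInt_minusR _ _ _ _ S1 T1) as [M1 M2].
      (* By the addition formula the increment of the sine at [x] is [sin (ph k x)] times that of
         the cosine at the origin, minus a term whose angular integral vanishes. Hence one
         eigenvalue serves all [x]. *)
      assert (E : forall phi, sin (ph k x) * (cos (ph k (0, 0)) - cos (ph k (circ (0, 0) r phi)))
        - cos (ph k x) * sin (ang k r phi) = sin (ph k x) - sin (ph k (circ x r phi))).
      { intros phi. rewrite !ph_circ. unfold ph at 2 3; simpl.
        rewrite !Rmult_0_r, !Rplus_0_r, Rplus_0_l, cos_0, sin_plus. ring. }
      split.
      * revert M1. apply ex_RInt_ext. intros phi _. apply E.
      * rewrite <- E2, <- S2.
        rewrite (RInt_ext _ _ _ _ (fun phi _ => eq_sym (E phi))). rewrite M2, T2, RInt_sin_ang.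
        assert (Hz : forall z w : R, z - w * 0 = z) by (intros; ring). apply Hz.
    + intros eta He. set (l := Rabs (sin (ph k x)) + 1).
      assert (Hl : 0 < l) by (unfold l; generalize (Rabs_pos (sin (ph k x))); lra).
      destruct (HI (eta / l)) as (a0 & b0 & Ha0 & Hab); [now apply Rdiv_lt_0_compat|].
      exists a0, b0. split; auto. intros a b H1 H2 H3. destruct (Hab a b H1 H2 H3) as [E1 E2].
      destruct (RInt_scalR _ (sin (ph k x)) _ _ E1) as [S1 S2].
      assert (E : forall r, sin (ph k x) * (G r * kern s r) = sin (ph k x) * G r * kern s r) by (intros; ring).
      split.
      * revert S1. apply ex_RInt_ext. intros; apply E.
      * rewrite (RInt_ext _ _ _ _ (fun r _ => eq_sym (E r))), S2.
        replace (_ - _) with (sin (ph k x) * (RInt (fun r => G r * kern s r) a b - lat)) by ring.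
        rewrite Rabs_mult.
        apply Rle_lt_trans with (l * Rabs (RInt (fun r => G r * kern s r) a b - lat)).
        -- apply Rmult_le_compat_r; [apply Rabs_pos|unfold l; lra].
        -- replace eta with (l * (eta / l)) by (field; lra). now apply Rmult_lt_compat_l.
Qed.

Definition symbol (k : Z * Z) : R := proj1_sig (constructive_indefinite_description _ (symbol_exists k)).

Lemma symbol_nonneg k : 0 <= symbol k.
Proof. unfold symbol. destruct constructive_indefinite_description; simpl; tauto. Qed.

Lemma symbol_pv k x : pv_frac_integral s (fun y => sin (ph k y)) x (symbol k * sin (ph k x)).
Proof. unfold symbol. destruct constructive_indefinite_description as [z [H1 H2]]; simpl; auto. Qed.

Lemma pv_modes (a : Z * Z -> R) B x :
  pv_frac_integral s (fun y => lsum (fun k => a k * sin (ph k y)) B) x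
    (lsum (fun k => a k * (symbol k * sin (ph k x))) B).
Proof.
  induction B as [|k B IH]; simpl.
  - apply zero_pv.
  - apply pv_ext with (fun y => lsum (fun k => a k * sin (ph k y)) B + a k * sin (ph k y)); [intros; ring|].
    rewrite Rplus_comm. apply pv_lin; auto. apply symbol_pv.
Qed.

End Symbol.

(** * Limit of the Galerkin approximations *)

Lemma second_order (f f' f'' : R -> R) a b C :
  (forall z, Rmin a b <= z <= Rmax a b -> derivable_pt_lim f z (f' z)) ->
  (forall z, Rmin a b <= z <= Rmax a b -> derivable_pt_lim f' z (f'' z)) ->
  (forall z, Rmin a b <= z <= Rmax a b -> Rabs (f'' z) <= C) ->
  Rabs (f b - f a - (b - a) * f' a) <= C * (b - a) ^ 2.
Proof.
  intros H1 H2 H3.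
  assert (HC : 0 <= C).
  { apply Rle_trans with (Rabs (f'' a)); [apply Rabs_pos|]. apply H3. split; [apply Rmin_l|apply Rmax_l]. }
  destruct (MVT_abs (fun z => f z - z * f' a) (fun z => f' z - f' a) a b) as (c & E & Hc).
  { intros z Hz. replace (f' z - f' a) with (f' z - 1 * f' a) by ring.
    apply derivable_pt_lim_minus; auto.
    apply is_derive_Reals. auto_derive; auto; ring. }
  replace (f b - f a - (b - a) * f' a) with (f b - b * f' a - (f a - a * f' a)) by ring.
  rewrite E.
  destruct (MVT_abs f' f'' a c) as (d & E2 & Hd).
  { intros z Hz. apply H2. split.
    - apply Rle_trans with (2 := proj1 Hz). unfold Rmin in *. repeat destruct Rle_dec; lra.
    - apply Rle_trans with (1 := proj2 Hz). unfold Rmax in *. repeat destruct Rle_dec; lra. }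
  rewrite E2.
  assert (Hcd : Rabs (c - a) <= Rabs (b - a)).
  { unfold Rmin, Rmax in Hc. destruct Rle_dec; unfold Rabs; repeat destruct Rcase_abs; lra. }
  assert (HCd : Rabs (f'' d) <= C).
  { apply H3. split.
    - apply Rle_trans with (2 := proj1 Hd). unfold Rmin in *. repeat destruct Rle_dec; lra.
    - apply Rle_trans with (1 := proj2 Hd). unfold Rmax in *. repeat destruct Rle_dec; lra. }
  rewrite <- (pow2_abs (b - a)).
  replace (C * Rabs (b - a) ^ 2) with (C * Rabs (b - a) * Rabs (b - a)) by ring.
  apply Rmult_le_compat_r; [apply Rabs_pos|].
  apply Rmult_le_compat; auto using Rabs_pos.
Qed.

Lemma quadratic_derive (F : R -> R) G s0 r C : 0 < r ->
  (forall s, Rabs (s - s0) <= r -> Rabs (F s - F s0 - (s - s0) * G) <= C * (s - s0) ^ 2) ->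
  derivable_pt_lim F s0 G.
Proof.
  intros Hr H eps He. set (k := Rabs C + 1).
  assert (Hk : 0 < k) by (unfold k; generalize (Rabs_pos C); lra).
  assert (Hd : 0 < Rmin r (eps / k)) by (apply Rmin_pos; auto; now apply Rdiv_lt_0_compat).
  exists (mkposreal _ Hd). simpl. intros h Hh0 Hh.
  pose proof (Rmin_l r (eps / k)). pose proof (Rmin_r r (eps / k)).
  specialize (H (s0 + h)). replace (s0 + h - s0) with h in H by ring. specialize (H ltac:(lra)).
  assert (Hha : 0 < Rabs h) by (now apply Rabs_pos_lt).
  replace ((F (s0 + h) - F s0) / h - G) with ((F (s0 + h) - F s0 - h * G) / h) by (field; auto).
  unfold Rdiv. rewrite Rabs_mult, Rabs_inv.
  apply Rmult_lt_reg_r with (Rabs h); auto. rewrite Rmult_assoc, Rinv_l, Rmult_1_r by lra.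
  apply Rle_lt_trans with (1 := H). rewrite <- (pow2_abs h).
  apply Rle_lt_trans with (k * Rabs h * Rabs h).
  - simpl. rewrite Rmult_1_r, <- Rmult_assoc. apply Rmult_le_compat_r; [lra|].
    apply Rmult_le_compat_r; [lra|]. unfold k. generalize (Rle_abs C). lra.
  - apply Rmult_lt_compat_r; auto. replace eps with (k * (eps / k)) by (field; lra).
    apply Rmult_lt_compat_l; lra.
Qed.

Lemma le_of_inv_bound (x C K : R) n0 :
  (forall n, (n0 <= n)%nat -> x <= C + K / (INR n + 1)) -> x <= C.
Proof.
  intros H. apply le_epsilon. intros eps He.
  destruct (INR_unbounded (Rabs K / eps)) as [n Hn].
  set (N := max n n0). assert (HN : INR n <= INR N) by (apply le_INR; unfold N; lia).
  specialize (H N ltac:(unfold N; lia)). pose proof (pos_INR N).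
  assert (K / (INR N + 1) <= eps).
  { apply Rmult_le_reg_r with (INR N + 1); [lra|].
    replace (K / (INR N + 1) * (INR N + 1)) with K by (field; lra).
    pose proof (Rle_abs K). apply Rmult_gt_compat_r with (r := eps) in Hn; auto.
    replace (Rabs K / eps * eps) with (Rabs K) in Hn by (field; lra). nra. }
  lra.
Qed.

(** * Convergence of all derivatives of the approximations *)

Section Family.
Variables (L : list mode) (nu : idx -> R).
Hypothesis Hnu : forall k, 0 <= nu k.

Definition finsupp (b : idx -> R) : Prop := exists m, supp m b.

Lemma supp_generator m b : supp m b -> exists m', supp m' (generator L nu b).
Proof.
  intros Hb.
  set (J := fold_right (fun (e : mode) n => (Z.to_nat (Z.abs (fst (snd e)) + Z.abs (snd (snd e))) + n)%nat) O L).
  assert (HJ : forall e, In e L -> (Z.abs (fst (snd e)) + Z.abs (snd (snd e)) <= Z.of_nat J)%Z).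
  { unfold J. clear. induction L as [|a l IH]; simpl; [tauto|]. intros e [->|He]; [lia|].
    specialize (IH e He). lia. }
  exists (m + J)%nat. intros k Hk. destruct (in_dec idx_dec k (box (m + J))) as [|Hn]; auto.
  exfalso. apply Hk. unfold generator.
  assert (Hz : forall l, ~ In l (box m) -> b l = 0).
  { intros l Hl. destruct (Req_dec (b l) 0); auto. elim Hl. auto. }
  rewrite in_box in Hn.
  rewrite (lsum_ext _ (fun _ => 0)), lsum_zero.
  - rewrite Hz; [ring|]. rewrite in_box. lia.
  - intros e He. specialize (HJ e He). rewrite !Hz; [ring| |]; rewrite in_box;
      unfold zadd, zsub; simpl; lia.
Qed.

Lemma finsupp_generator b : finsupp b -> finsupp (generator L nu b).
Proof. intros [m Hm]. now apply supp_generator with m. Qed.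

(* [PhiM] with exponents [p], [q] and phase [phi] describes all space derivatives, and replacing
   [b] by [generator b] the time derivatives, so the family is closed under differentiation. *)
Definition monom (p q : nat) (k : idx) : R := IZR (fst k) ^ p * IZR (snd k) ^ q.

Definition PhiM (b : idx -> R) (p q : nat) (phi : R) (M : nat) (t : R) (x : R2) : R :=
  lsum (fun k => gal L nu M b k t * monom p q k * sin (ph k x + phi)) (box M).

Lemma monom_bound p q k : Rabs (monom p q k) <= wt k ^ (p + q).
Proof.
  unfold monom. rewrite Rabs_mult, <- !RPow_abs, pow_add.
  pose proof (Rabs_pos (IZR (fst k))). pose proof (Rabs_pos (IZR (snd k))).
  apply Rmult_le_compat; try (apply pow_le; auto); apply pow_incr; unfold wt; lra.
Qed.

Lemma PhiM_bound b p q T : 0 <= T -> finsupp b -> exists C, 0 <= C /\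
  forall phi M t x, supp M b -> 0 <= t <= T -> Rabs (PhiM b p q phi M t x) <= C.
Proof.
  intros HT Hb. destruct (gal_bound L nu Hnu b (p + q) T HT Hb) as (C & HC & H).
  exists C. split; auto. intros phi M t x HM Ht. specialize (H M t HM Ht).
  apply Rle_trans with (2 := H). unfold PhiM.
  apply Rle_trans with (1 := lsum_abs _ _). apply lsum_le. intros k _.
  rewrite !Rabs_mult. pose proof (monom_bound p q k). pose proof (Rabs_sin_le (ph k x + phi)).
  pose proof (Rabs_pos (gal L nu M b k t)). pose proof (Rabs_pos (monom p q k)).
  pose proof (Rabs_pos (sin (ph k x + phi))).
  rewrite <- (Rmult_1_r (Rabs (gal L nu M b k t) * wt k ^ (p + q))).
  apply Rmult_le_compat; auto; [now apply Rmult_le_pos|]. now apply Rmult_le_compat_l.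
Qed.

Lemma PhiM_cauchy b p q T : 0 <= T -> finsupp b -> exists C, 0 <= C /\
  forall phi M M' t x, supp M b -> (M <= M')%nat -> 0 <= t <= T ->
    Rabs (PhiM b p q phi M' t x - PhiM b p q phi M t x) <= C / (INR M + 1).
Proof.
  intros HT Hb. destruct (gal_cauchy L nu Hnu b (p + q) T HT Hb) as (C & HC & H).
  exists C. split; auto. intros phi M M' t x HM HMM Ht. specialize (H M M' t HM HMM Ht).
  apply Rle_trans with (2 := H). unfold PhiM.
  assert (E : lsum (fun k => gal L nu M b k t * monom p q k * sin (ph k x + phi)) (box M)
    = lsum (fun k => gal_ext L nu M b k t * monom p q k * sin (ph k x + phi)) (box M')).
  { rewrite (lsum_ext _ (fun k => gal_ext L nu M b k t * monom p q k * sin (ph k x + phi))).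
    - apply lsum_nested_eq; auto using box_NoDup.
      + intros l Hl. apply box_incl with M; auto.
      + intros l _ Hl. unfold gal_ext. destruct in_dec; [tauto|ring].
    - intros l Hl. unfold gal_ext. destruct in_dec; [ring|tauto]. }
  rewrite E, <- lsum_minus.
  apply Rle_trans with (1 := lsum_abs _ _). apply lsum_le. intros k _.
  replace (_ - _) with ((gal L nu M' b k t - gal_ext L nu M b k t) * monom p q k * sin (ph k x + phi)) by ring.
  set (d := gal L nu M' b k t - gal_ext L nu M b k t).
  rewrite !Rabs_mult. pose proof (monom_bound p q k). pose proof (Rabs_sin_le (ph k x + phi)).
  pose proof (Rabs_pos d). pose proof (Rabs_pos (monom p q k)).
  pose proof (Rabs_pos (sin (ph k x + phi))).
  rewrite <- (Rmult_1_r (Rabs d * wt k ^ (p + q))).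
  apply Rmult_le_compat; auto; [now apply Rmult_le_pos|]. now apply Rmult_le_compat_l.
Qed.

(** [Lim_seq] and [real] are total; for finitely supported data and [t >= 0] the limit exists and is
    finite, with the rate of [Phi_close]. *)
Definition Phi (b : idx -> R) (p q : nat) (phi : R) (t : R) (x : R2) : R :=
  real (Lim_seq (fun M => PhiM b p q phi M t x)).

Lemma Phi_close b p q T : 0 <= T -> finsupp b -> exists C, 0 <= C /\
  forall phi M t x, supp M b -> 0 <= t <= T ->
    Rabs (Phi b p q phi t x - PhiM b p q phi M t x) <= C / (INR M + 1).
Proof.
  intros HT Hb. destruct (PhiM_cauchy b p q T HT Hb) as (C & HC & H).
  exists C. split; auto. intros phi M t x HM Ht. destruct Hb as [m0 Hm0].
  assert (Hex : ex_finite_lim_seq (fun M => PhiM b p q phi M t x)).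
  { apply ex_lim_seq_cauchy_corr. intros eps.
    destruct (INR_unbounded (2 * C / eps)) as [n Hn]. pose proof (cond_pos eps) as He.
    exists (max n m0). intros i j Hi Hj.
    assert (Hsm : forall i j, (max n m0 <= i)%nat -> (i <= j)%nat ->
      Rabs (PhiM b p q phi j t x - PhiM b p q phi i t x) < eps).
    { intros i' j' Hi' Hj'.
      assert (Hs : supp i' b) by (apply supp_mono with m0; auto; lia).
      apply Rle_lt_trans with (1 := H phi i' j' t x Hs Hj' Ht).
      assert (INR n <= INR i') by (apply le_INR; lia). pose proof (pos_INR n).
      apply Rmult_lt_reg_r with (INR i' + 1); [lra|].
      replace (C / (INR i' + 1) * (INR i' + 1)) with C by (field; lra).
      apply Rmult_gt_compat_r with (r := eps) in Hn; auto.
      replace (2 * C / eps * eps) with (2 * C) in Hn by (field; lra). nra. }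
    destruct (Nat.le_ge_cases i j).
    - rewrite Rabs_minus_sym. apply Hsm; auto.
    - apply Hsm; auto. }
  apply Lim_seq_correct' in Hex.
  fold (Phi b p q phi t x) in Hex.
  apply le_epsilon. intros eps He.
  apply is_lim_seq_spec in Hex. destruct (Hex (mkposreal eps He)) as [N HN]. simpl in HN.
  specialize (HN (max N M) ltac:(lia)).
  specialize (H phi M (max N M) t x HM ltac:(lia) Ht).
  replace (_ - _) with ((PhiM b p q phi (max N M) t x - PhiM b p q phi M t x)
    - (PhiM b p q phi (max N M) t x - Phi b p q phi t x)) by ring.
  unfold Rminus at 1. apply Rle_trans with (1 := Rabs_triang _ _). rewrite Rabs_Ropp. lra.
Qed.

Lemma PhiM_d1 b p q phi M t x1 x2 : derivable_pt_lim (fun y => PhiM b p q phi M t (y, x2)) x1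
  (PhiM b (S p) q (phi + PI / 2) M t (x1, x2)).
Proof.
  unfold PhiM. apply (lsum_derive (fun k y => gal L nu M b k t * monom p q k * sin (ph k (y, x2) + phi))).
  intros k _. rewrite <- Rplus_assoc, (Rplus_comm _ (PI / 2)), <- cos_sin.
  apply is_derive_Reals. unfold ph, monom; simpl. auto_derive; auto. ring.
Qed.

Lemma PhiM_d2 b p q phi M t x1 x2 : derivable_pt_lim (fun y => PhiM b p q phi M t (x1, y)) x2
  (PhiM b p (S q) (phi + PI / 2) M t (x1, x2)).
Proof.
  unfold PhiM. apply (lsum_derive (fun k y => gal L nu M b k t * monom p q k * sin (ph k (x1, y) + phi))).
  intros k _. rewrite <- Rplus_assoc, (Rplus_comm _ (PI / 2)), <- cos_sin.
  apply is_derive_Reals. unfold ph, monom; simpl. auto_derive; auto. ring.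
Qed.

Lemma PhiM_dt b p q phi M t x : supp M b -> derivable_pt_lim (fun t => PhiM b p q phi M t x) t
  (PhiM (generator L nu b) p q phi M t x).
Proof.
  intros Hb. unfold PhiM.
  apply (lsum_derive (fun k t => gal L nu M b k t * monom p q k * sin (ph k x + phi))).
  intros k Hk.
  apply derivable_pt_lim_ext with (fun t => (monom p q k * sin (ph k x + phi)) * gal L nu M b k t).
  { intros; ring. }
  replace (gal L nu M (generator L nu b) k t * monom p q k * sin (ph k x + phi))
    with ((monom p q k * sin (ph k x + phi)) * gal L nu M (generator L nu b) k t) by ring.
  apply derivable_pt_lim_scal. now apply gal_derive.
Qed.

(* Passing to the limit in the uniform second-order estimate avoids differentiating a series. *)
Lemma limit_derive (f f' f'' : nat -> R -> R) (F : R -> R) G s0 r C K K' n0 : 0 < r ->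
  (forall n z, (n0 <= n)%nat -> Rabs (z - s0) <= r -> derivable_pt_lim (f n) z (f' n z)) ->
  (forall n z, (n0 <= n)%nat -> Rabs (z - s0) <= r -> derivable_pt_lim (f' n) z (f'' n z)) ->
  (forall n z, (n0 <= n)%nat -> Rabs (z - s0) <= r -> Rabs (f'' n z) <= C) ->
  (forall n z, (n0 <= n)%nat -> Rabs (z - s0) <= r -> Rabs (F z - f n z) <= K / (INR n + 1)) ->
  (forall n, (n0 <= n)%nat -> Rabs (G - f' n s0) <= K' / (INR n + 1)) ->
  derivable_pt_lim F s0 G.
Proof.
  intros Hr H1 H2 H3 H4 H5. apply quadratic_derive with r C; auto. intros s Hs.
  assert (H0 : Rabs (s0 - s0) <= r) by (rewrite Rminus_diag, Rabs_R0; lra).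
  assert (Hseg : forall z, Rmin s0 s <= z <= Rmax s0 s -> Rabs (z - s0) <= r).
  { intros z. unfold Rmin, Rmax, Rabs in *. repeat destruct Rle_dec; repeat destruct Rcase_abs; lra. }
  apply le_of_inv_bound with (K := 2 * K + Rabs (s - s0) * K') (n0 := n0). intros n Hn.
  pose proof (second_order (f n) (f' n) (f'' n) s0 s C
    ltac:(auto) ltac:(auto) ltac:(auto)) as HQ.
  pose proof (H4 n s Hn Hs) as A1. pose proof (H4 n s0 Hn H0) as A2.
  replace (F s - F s0 - (s - s0) * G) with ((f n s - f n s0 - (s - s0) * f' n s0)
    + (F s - f n s) + - (F s0 - f n s0) + - ((s - s0) * (G - f' n s0))) by ring.
  eapply Rle_trans; [apply Rabs_triang|]. rewrite Rabs_Ropp, Rabs_mult.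
  eapply Rle_trans; [apply Rplus_le_compat_r, Rabs_triang|]. rewrite Rabs_Ropp.
  eapply Rle_trans; [apply Rplus_le_compat_r, Rplus_le_compat_r, Rabs_triang|].
  pose proof (pos_INR n).
  replace ((2 * K + Rabs (s - s0) * K') / (INR n + 1))
    with (K / (INR n + 1) + K / (INR n + 1) + Rabs (s - s0) * (K' / (INR n + 1))) by (field; lra).
  assert (Rabs (s - s0) * Rabs (G - f' n s0) <= Rabs (s - s0) * (K' / (INR n + 1)))
    by (apply Rmult_le_compat_l; auto using Rabs_pos).
  lra.
Qed.

Lemma Phi_d1 b p q phi t x1 x2 : finsupp b -> 0 <= t ->
  derivable_pt_lim (fun y => Phi b p q phi t (y, x2)) x1 (Phi b (S p) q (phi + PI / 2) t (x1, x2)).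
Proof.
  intros Hb Ht. pose proof Hb as [m0 Hm].
  destruct (PhiM_bound b (S (S p)) q t Ht Hb) as (C & HC & HB).
  destruct (Phi_close b p q t Ht Hb) as (K & HK & HKc).
  destruct (Phi_close b (S p) q t Ht Hb) as (K' & HK' & HKc').
  assert (Hs : forall n, (m0 <= n)%nat -> supp n b) by (intros; apply supp_mono with m0; auto).
  apply (limit_derive (fun n y => PhiM b p q phi n t (y, x2))
    (fun n y => PhiM b (S p) q (phi + PI / 2) n t (y, x2))
    (fun n y => PhiM b (S (S p)) q (phi + PI / 2 + PI / 2) n t (y, x2)) _ _ _ 1 C K K' m0); [lra|..].
  - intros; apply PhiM_d1.
  - intros; apply PhiM_d1.
  - intros; apply HB; auto; lra.
  - intros; apply HKc; auto; lra.
  - intros; apply HKc'; auto; lra.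
Qed.

Lemma Phi_d2 b p q phi t x1 x2 : finsupp b -> 0 <= t ->
  derivable_pt_lim (fun y => Phi b p q phi t (x1, y)) x2 (Phi b p (S q) (phi + PI / 2) t (x1, x2)).
Proof.
  intros Hb Ht. pose proof Hb as [m0 Hm].
  destruct (PhiM_bound b p (S (S q)) t Ht Hb) as (C & HC & HB).
  destruct (Phi_close b p q t Ht Hb) as (K & HK & HKc).
  destruct (Phi_close b p (S q) t Ht Hb) as (K' & HK' & HKc').
  assert (Hs : forall n, (m0 <= n)%nat -> supp n b) by (intros; apply supp_mono with m0; auto).
  apply (limit_derive (fun n y => PhiM b p q phi n t (x1, y))
    (fun n y => PhiM b p (S q) (phi + PI / 2) n t (x1, y))
    (fun n y => PhiM b p (S (S q)) (phi + PI / 2 + PI / 2) n t (x1, y)) _ _ _ 1 C K K' m0); [lra|..].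
  - intros; apply PhiM_d2.
  - intros; apply PhiM_d2.
  - intros; apply HB; auto; lra.
  - intros; apply HKc; auto; lra.
  - intros; apply HKc'; auto; lra.
Qed.

Lemma Phi_dt b p q phi t x : finsupp b -> 0 < t ->
  derivable_pt_lim (fun t => Phi b p q phi t x) t (Phi (generator L nu b) p q phi t x).
Proof.
  (* The neighbourhood of [t] has radius [t], so it stays in nonnegative times, where the estimates
     on [[0, 2 t]] apply. *)
  intros Hb Ht. assert (HT : 0 <= 2 * t) by lra.
  pose proof (finsupp_generator b Hb) as Hb1. pose proof (finsupp_generator _ Hb1) as Hb2.
  destruct (PhiM_bound _ p q (2 * t) HT Hb2) as (C & HC & HB).
  destruct (Phi_close b p q (2 * t) HT Hb) as (K & HK & HKc).
  destruct (Phi_close _ p q (2 * t) HT Hb1) as (K' & HK' & HKc').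
  destruct Hb as [m0 Hm0]. destruct Hb1 as [m1 Hm1]. destruct Hb2 as [m2 Hm2].
  set (n0 := max m0 (max m1 m2)).
  assert (Hs0 : forall n, (n0 <= n)%nat -> supp n b) by (intros; apply supp_mono with m0; auto; lia).
  assert (Hs1 : forall n, (n0 <= n)%nat -> supp n (generator L nu b)) by (intros; apply supp_mono with m1; auto; lia).
  assert (Hs2 : forall n, (n0 <= n)%nat -> supp n (generator L nu (generator L nu b)))
    by (intros; apply supp_mono with m2; auto; lia).
  assert (Hr : forall z, Rabs (z - t) <= t -> 0 <= z <= 2 * t).
  { intros z Hz. apply Rabs_le_between in Hz. lra. }
  apply (limit_derive (fun n t => PhiM b p q phi n t x)
    (fun n t => PhiM (generator L nu b) p q phi n t x)
    (fun n t => PhiM (generator L nu (generator L nu b)) p q phi n t x) _ _ _ t C K K' n0); auto.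
  - intros; apply PhiM_dt; auto.
  - intros; apply PhiM_dt; auto.
  - intros; apply HKc'; auto; lra.
Qed.

(** Mean values on the approximations, passed to the limit; unlike [Phi_dt] this includes [t = 0]
    and so gives continuity up to the initial time. *)
Lemma Phi_lip b p q T : 0 <= T -> finsupp b -> exists C, 0 <= C /\
  forall phi t t' x x', 0 <= t <= T -> 0 <= t' <= T ->
    Rabs (Phi b p q phi t' x' - Phi b p q phi t x)
      <= C * (Rabs (t' - t) + Rabs (fst x' - fst x) + Rabs (snd x' - snd x)).
Proof.
  intros HT Hb. pose proof (finsupp_generator b Hb) as Hb1.
  destruct (PhiM_bound _ p q T HT Hb1) as (C0 & HC0 & HB0).
  destruct (PhiM_bound _ (S p) q T HT Hb) as (C1 & HC1 & HB1).
  destruct (PhiM_bound _ p (S q) T HT Hb) as (C2 & HC2 & HB2).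
  destruct (Phi_close b p q T HT Hb) as (K & HK & HKc).
  destruct Hb as [m0 Hm0]. destruct Hb1 as [m1 Hm1].
  exists (C0 + C1 + C2). split; [lra|]. intros phi t t' [x1 x2] [y1 y2] Ht Ht'; simpl fst; simpl snd.
  apply le_of_inv_bound with (K := 2 * K) (n0 := max m0 m1). intros n Hn.
  assert (Hs0 : supp n b) by (apply supp_mono with m0; auto; lia).
  assert (Hs1 : supp n (generator L nu b)) by (apply supp_mono with m1; auto; lia).
  pose proof (HKc phi n t' (y1, y2) Hs0 Ht') as A1. pose proof (HKc phi n t (x1, x2) Hs0 Ht) as A2.
  destruct (MVT_abs (fun t => PhiM b p q phi n t (y1, y2)) (fun t => PhiM (generator L nu b) p q phi n t (y1, y2)) t t')
    as (z0 & E0 & Hz0).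
  { intros; now apply PhiM_dt. }
  destruct (MVT_abs (fun y => PhiM b p q phi n t (y, y2)) (fun y => PhiM b (S p) q (phi + PI / 2) n t (y, y2)) x1 y1)
    as (z1 & E1 & _).
  { intros; now apply PhiM_d1. }
  destruct (MVT_abs (fun y => PhiM b p q phi n t (x1, y)) (fun y => PhiM b p (S q) (phi + PI / 2) n t (x1, y)) x2 y2)
    as (z2 & E2 & _).
  { intros; now apply PhiM_d2. }
  assert (Hz : 0 <= z0 <= T).
  { unfold Rmin, Rmax in Hz0. destruct Rle_dec; lra. }
  assert (B0 := Rmult_le_compat_r _ _ _ (Rabs_pos (t' - t)) (HB0 phi n z0 (y1, y2) Hs1 Hz)).
  assert (B1 := Rmult_le_compat_r _ _ _ (Rabs_pos (y1 - x1)) (HB1 (phi + PI / 2) n t (z1, y2) Hs0 Ht)).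
  assert (B2 := Rmult_le_compat_r _ _ _ (Rabs_pos (y2 - x2)) (HB2 (phi + PI / 2) n t (x1, z2) Hs0 Ht)).
  rewrite <- E0 in B0. rewrite <- E1 in B1. rewrite <- E2 in B2.
  replace (Phi b p q phi t' (y1, y2) - Phi b p q phi t (x1, x2)) with
    ((PhiM b p q phi n t' (y1, y2) - PhiM b p q phi n t (y1, y2))
     + (PhiM b p q phi n t (y1, y2) - PhiM b p q phi n t (x1, y2))
     + (PhiM b p q phi n t (x1, y2) - PhiM b p q phi n t (x1, x2))
     + (Phi b p q phi t' (y1, y2) - PhiM b p q phi n t' (y1, y2))
     + - (Phi b p q phi t (x1, x2) - PhiM b p q phi n t (x1, x2))) by ring.
  eapply Rle_trans; [apply Rabs_triang|]. rewrite Rabs_Ropp.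
  eapply Rle_trans; [apply Rplus_le_compat_r, Rabs_triang|].
  eapply Rle_trans; [apply Rplus_le_compat_r, Rplus_le_compat_r, Rabs_triang|].
  eapply Rle_trans; [apply Rplus_le_compat_r, Rplus_le_compat_r, Rplus_le_compat_r, Rabs_triang|].
  pose proof (pos_INR n).
  replace (2 * K / (INR n + 1)) with (K / (INR n + 1) + K / (INR n + 1)) by (field; lra).
  pose proof (Rabs_pos (t' - t)). pose proof (Rabs_pos (y1 - x1)). pose proof (Rabs_pos (y2 - x2)).
  nra.
Qed.

Lemma dist3_ge (P Q : R * R2) : Rabs (fst P - fst Q) <= dist3 P Q /\
  Rabs (fst (snd P) - fst (snd Q)) <= dist3 P Q /\ Rabs (snd (snd P) - snd (snd Q)) <= dist3 P Q.
Proof.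
  unfold dist3.
  pose proof (pow2_ge_0 (fst P - fst Q)). pose proof (pow2_ge_0 (fst (snd P) - fst (snd Q))).
  pose proof (pow2_ge_0 (snd (snd P) - snd (snd Q))).
  repeat split; (apply Rsqr_incr_0_var; [|apply sqrt_pos]);
    rewrite Rsqr_sqrt by lra; rewrite <- Rsqr_abs; unfold Rsqr; simpl in *; lra.
Qed.

Lemma Phi_cont_on b p q phi : finsupp b ->
  cont_on dist3 (fun P => 0 <= fst P) (fun P => Phi b p q phi (fst P) (snd P)).
Proof.
  intros Hb [t x] Ht eps He; simpl in *.
  destruct (Phi_lip b p q (t + 1) ltac:(lra) Hb) as (C & HC & H).
  set (k := C + 1). assert (Hk : 0 < eps / (3 * k)) by (unfold k; apply Rdiv_lt_0_compat; lra).
  exists (Rmin 1 (eps / (3 * k))). split; [apply Rmin_pos; lra|].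
  intros [t' x'] Ht' Hd; simpl in *.
  pose proof (Rmin_l 1 (eps / (3 * k))). pose proof (Rmin_r 1 (eps / (3 * k))).
  destruct (dist3_ge (t, x) (t', x')) as (D0 & D1 & D2); simpl in *.
  assert (t' <= t + 1) by (apply Rabs_le_between in D0; lra).
  specialize (H phi t t' x x' ltac:(lra) ltac:(lra)).
  apply Rle_lt_trans with (1 := H).
  rewrite (Rabs_minus_sym t'), (Rabs_minus_sym (fst x')), (Rabs_minus_sym (snd x')).
  set (A := Rabs (t - t') + Rabs (fst x - fst x') + Rabs (snd x - snd x')).
  assert (HA : A < eps / k).
  { unfold A. replace (eps / k) with (3 * (eps / (3 * k))) by (field; unfold k; lra). lra. }
  assert (0 <= A).
  { unfold A. pose proof (Rabs_pos (t - t')). pose proof (Rabs_pos (fst x - fst x')).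
    pose proof (Rabs_pos (snd x - snd x')). lra. }
  apply Rle_lt_trans with (k * A); [unfold k; nra|].
  replace eps with (k * (eps / k)) by (field; unfold k; lra). apply Rmult_lt_compat_l; unfold k in *; lra.
Qed.

Lemma shift_derive (f : R -> R) x l : derivable_pt_lim f x l -> derivable_pt_lim (fun h => f (x + h)) 0 l.
Proof.
  intros H. rewrite <- (Rmult_1_r l). apply (derivable_pt_lim_comp (fun h => x + h) f).
  - apply is_derive_Reals. auto_derive; auto.
  - now rewrite Rplus_0_r.
Qed.

Lemma Phi_smooth b p q phi : finsupp b ->
  smooth_on dist3 dirs3 (fun P => 0 < fst P) (fun P => Phi b p q phi (fst P) (snd P)).
Proof.
  intros Hb k. revert b p q phi Hb. induction k as [|k IH]; intros b p q phi Hb.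
  - intros P HP eps He. destruct (Phi_cont_on b p q phi Hb P ltac:(simpl in *; lra) eps He) as (d & Hd & H).
    exists d. split; auto. intros Q HQ. apply H. simpl in *; lra.
  - split.
    + intros P HP eps He. destruct (Phi_cont_on b p q phi Hb P ltac:(simpl in *; lra) eps He) as (d & Hd & H).
      exists d. split; auto. intros Q HQ. apply H. simpl in *; lra.
    + repeat constructor.
      * exists (fun P => Phi (generator L nu b) p q phi (fst P) (snd P)). split.
        -- intros [t x] Ht; simpl in *. apply (shift_derive (fun t => Phi b p q phi t x)). now apply Phi_dt.
        -- apply IH. now apply finsupp_generator.
      * exists (fun P => Phi b (S p) q (phi + PI / 2) (fst P) (snd P)). split.
        -- intros [t [x1 x2]] Ht; simpl in *. apply (shift_derive (fun y => Phi b p q phi t (y, x2))).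
           apply Phi_d1; auto. lra.
        -- apply IH; auto.
      * exists (fun P => Phi b p (S q) (phi + PI / 2) (fst P) (snd P)). split.
        -- intros [t [x1 x2]] Ht; simpl in *. apply (shift_derive (fun y => Phi b p q phi t (x1, y))).
           apply Phi_d2; auto. lra.
        -- apply IH; auto.
Qed.

End Family.

Lemma mode_reach (L : list mode) : exists J : nat, forall e, In e L ->
  (Z.abs (fst (snd e)) <= Z.of_nat J /\ Z.abs (snd (snd e)) <= Z.of_nat J)%Z.
Proof.
  exists (fold_right (fun (e : mode) n => (Z.to_nat (Z.abs (fst (snd e)) + Z.abs (snd (snd e))) + n)%nat) O L).
  induction L as [|a l IH]; simpl; [tauto|]. intros e [->|He]; [lia|].
  specialize (IH e He). lia.
Qed.

(** * The limit solves the equation *)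

Section Existence.
Variables (L : list mode) (s c : R) (b : idx -> R).
Hypotheses (Hs : 0 < s) (Hs' : s < 1 / 2) (Hc : 0 <= c) (Hb : finsupp b).

Let nu k := c * symbol s Hs Hs' k.
Local Lemma nu_nonneg k : 0 <= nu k.
Proof. apply Rmult_le_pos; auto. apply symbol_nonneg. Qed.

Let a M t l := gal L nu M b l t.

Lemma field_dot x l : (fst (field L x) * IZR (fst l) + snd (field L x) * IZR (snd l)) * cos (ph l x)
  = lsum (fun e => / 2 * fst e * cross (snd e) l *
      (sin (ph (zadd l (snd e)) x) - sin (ph (zsub l (snd e)) x))) L.
Proof.
  unfold field; simpl fst; simpl snd.
  rewrite (Rmult_comm (lsum _ L)), (Rmult_comm (lsum (fun e : mode => - _ * _) L)).
  rewrite <- !lsum_scal, <- lsum_plus, Rmult_comm, <- lsum_scal.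
  apply lsum_ext. intros [p j] _; simpl fst; simpl snd.
  assert (E1 : ph (zadd l j) x = ph l x + ph j x) by (unfold ph, zadd; simpl; rewrite !plus_IZR; ring).
  assert (E2 : ph (zsub l j) x = ph l x - ph j x) by (unfold ph, zsub; simpl; rewrite !minus_IZR; ring).
  rewrite E1, E2, sin_plus, sin_minus. unfold cross. field.
Qed.

(** The matrix reproduces [- u . grad] on a sine exactly when no neighbour of [l] is cut off, whence
    the sums over a larger box below. *)
Lemma hop_sines M' l x : (forall e, In e L -> In (zadd l (snd e)) (box M') /\ In (zsub l (snd e)) (box M')) ->
  lsum (fun k => hop L k l * sin (ph k x)) (box M')
  = - ((fst (field L x) * IZR (fst l) + snd (field L x) * IZR (snd l)) * cos (ph l x)).
Proof.
  intros Hin. rewrite field_dot.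
  rewrite (lsum_ext _ (fun k => lsum (fun e : mode =>
     - (/ 2 * fst e * cross (snd e) l) * (delta k (zadd l (snd e)) - delta k (zsub l (snd e))) * sin (ph k x)) L)).
  2: { intros k _. unfold hop. rewrite Rmult_comm, <- lsum_scal. apply lsum_ext. intros; ring. }
  rewrite lsum_exchange.
  match goal with |- _ = - ?z => replace (- z) with (-1 * z) by ring end.
  rewrite <- lsum_scal. apply lsum_ext. intros e He. destruct (Hin e He) as [I1 I2].
  rewrite (lsum_ext _ (fun k => - (/ 2 * fst e * cross (snd e) l) *
     (delta k (zadd l (snd e)) * sin (ph k x) - delta k (zsub l (snd e)) * sin (ph k x)))) by (intros; ring).
  rewrite lsum_scal, lsum_minus.
  rewrite (delta_sum (fun k => sin (ph k x))), (delta_sum (fun k => sin (ph k x))) by auto using box_NoDup.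
  ring.
Qed.

Let LM M t x := lsum (fun k => a M t k * (symbol s Hs Hs' k * sin (ph k x))) (box M).

(** The exact transport of an approximation lives in a box larger by the range [J] of the modes. The
    couplings into the added frame are the only error; [annulus_bound] and the bound on the sum
    weighted by [wt^2] make it of order [1 / (M + 1)]. *)
Lemma galerkin_defect T : 0 <= T -> exists C, 0 <= C /\ forall M t x, supp M b -> 0 <= t <= T ->
  Rabs (PhiM L nu (generator L nu b) 0 0 0 M t x
    + fst (field L x) * PhiM L nu b 1 0 (0 + PI / 2) M t x
    + snd (field L x) * PhiM L nu b 0 1 (0 + PI / 2) M t x + c * LM M t x) <= C / (INR M + 1).
Proof.
  intros HT. destruct (gal_bound L nu nu_nonneg b 2 T HT Hb) as (C & HC & HB).
  destruct (mode_reach L) as [J HJ].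
  set (rr := reach L * (1 + reach L)).
  pose proof (reach_ge1 L) as Hr. pose proof (mass_nonneg L) as Hm.
  assert (Hrr : 0 <= rr) by (unfold rr; nra).
  exists (mass L * rr * C). split; [apply Rmult_le_pos; auto; now apply Rmult_le_pos|].
  intros M t x HM Ht. specialize (HB M t HM Ht). pose proof (pos_INR M) as HMp.
  set (M' := (M + J)%nat).
  set (h := fun k => lsum (fun l => hop L k l * a M t l) (box M)).
  assert (S1 : PhiM L nu (generator L nu b) 0 0 0 M t x
    = - (c * LM M t x) + lsum (fun k => h k * sin (ph k x)) (box M)).
  { unfold PhiM, LM.
    match goal with |- _ = - (c * ?z) + _ => replace (- (c * z)) with (- c * z) by ring end.
    rewrite <- lsum_scal, <- lsum_plus. apply lsum_ext. intros k Hk.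
    rewrite gal_generator by auto. unfold monom, h, a, nu. simpl. rewrite Rplus_0_r. ring. }
  assert (S2 : fst (field L x) * PhiM L nu b 1 0 (0 + PI / 2) M t x
      + snd (field L x) * PhiM L nu b 0 1 (0 + PI / 2) M t x
      = - lsum (fun k => h k * sin (ph k x)) (box M')).
  { unfold PhiM. rewrite <- !lsum_scal, <- lsum_plus.
    rewrite (lsum_ext (fun k => h k * sin (ph k x))
      (fun k => lsum (fun l => a M t l * (hop L k l * sin (ph k x))) (box M))).
    2: { intros k _. unfold h. rewrite Rmult_comm, <- lsum_scal. apply lsum_ext. intros; ring. }
    rewrite lsum_exchange.
    match goal with |- _ = - ?z => replace (- z) with (-1 * z) by ring end.
    rewrite <- lsum_scal. apply lsum_ext. intros l Hl.
    rewrite lsum_scal, hop_sines.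
    - unfold monom, a. simpl. rewrite Rplus_0_l, (Rplus_comm (ph l x)), <- cos_sin. ring.
    - intros e He. specialize (HJ e He). rewrite in_box in Hl. rewrite !in_box.
      unfold zadd, zsub, M'; simpl. lia. }
  assert (S3 : lsum (fun k => h k * sin (ph k x)) (box M)
     = lsum (fun k => if in_dec idx_dec k (box M) then h k * sin (ph k x) else 0) (box M')).
  { rewrite (lsum_ext _ (fun k => if in_dec idx_dec k (box M) then h k * sin (ph k x) else 0)).
    - apply lsum_nested_eq; auto using box_NoDup.
      + intros l Hl. apply box_incl with M; auto. unfold M'; lia.
      + intros l _ Hl. destruct in_dec; [tauto|ring].
    - intros l Hl. destruct in_dec; [ring|tauto]. }
  replace (_ + _ + _ + _) with (PhiM L nu (generator L nu b) 0 0 0 M t x + c * LM M t x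
    + (fst (field L x) * PhiM L nu b 1 0 (0 + PI / 2) M t x
      + snd (field L x) * PhiM L nu b 0 1 (0 + PI / 2) M t x)) by ring.
  rewrite S1, S2, S3.
  match goal with |- Rabs (- ?z + ?p + ?z + - ?q) <= _ => replace (- z + p + z + - q) with (p - q) by ring end.
  rewrite <- lsum_minus.
  apply Rle_trans with (1 := lsum_abs _ _).
  set (g := fun k l => nb L k l * (rr / (INR M + 1) * wt l ^ 2 * Rabs (a M t l))).
  assert (Hgl : forall l, 0 <= rr / (INR M + 1) * wt l ^ 2 * Rabs (a M t l)).
  { intros l. apply Rmult_le_pos; [|apply Rabs_pos]. apply Rmult_le_pos; [|apply pow2_ge_0].
    apply Rmult_le_pos; auto. apply Rlt_le, Rinv_0_lt_compat; lra. }
  apply Rle_trans with (lsum (fun k => lsum (g k) (box M)) (box M')).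
  - apply lsum_le. intros k _. destruct (in_dec idx_dec k (box M)) as [Hi|Ho].
    + rewrite Rminus_diag, Rabs_R0. apply lsum_nonneg. intros l _. unfold g.
      apply Rmult_le_pos; auto using nb_nonneg.
    + rewrite Rminus_0_l, Rabs_Ropp, Rabs_mult.
      pose proof (annulus_bound L M (a M t) k Ho) as Ha. fold rr in Ha.
      apply Rle_trans with (2 := Ha). apply Rle_trans with (Rabs (h k) * 1).
      * apply Rmult_le_compat_l; auto using Rabs_pos, Rabs_sin_le.
      * rewrite Rmult_1_r. apply Rle_refl.
  - rewrite lsum_exchange. unfold g.
    apply Rle_trans with (lsum (fun l => mass L * (rr / (INR M + 1)) * (Rabs (a M t l) * wt l ^ 2)) (box M)).
    + apply lsum_le. intros l _.
      rewrite (lsum_ext _ (fun k => rr / (INR M + 1) * wt l ^ 2 * Rabs (a M t l) * nb L k l)) by (intros; ring).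
      rewrite lsum_scal.
      replace (mass L * (rr / (INR M + 1)) * (Rabs (a M t l) * wt l ^ 2))
        with (rr / (INR M + 1) * wt l ^ 2 * Rabs (a M t l) * mass L) by ring.
      apply Rmult_le_compat_l; auto. apply nb_row, box_NoDup.
    + rewrite lsum_scal.
      replace (mass L * rr * C / (INR M + 1)) with (mass L * (rr / (INR M + 1)) * C) by (field; lra).
      apply Rmult_le_compat_l; auto. apply Rmult_le_pos; auto.
      apply Rmult_le_pos; auto. apply Rlt_le, Rinv_0_lt_compat; lra.
Qed.

Definition evol (t : R) (x : R2) : R := Phi L nu b 0 0 0 t x.

Lemma field_bound : exists U, 0 <= U /\ forall x, Rabs (fst (field L x)) <= U /\ Rabs (snd (field L x)) <= U.
Proof.
  exists (lsum (fun e : mode => Rabs (fst e * IZR (snd (snd e)))) L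
     + lsum (fun e : mode => Rabs (- (fst e * IZR (fst (snd e))))) L).
  assert (A1 : 0 <= lsum (fun e : mode => Rabs (fst e * IZR (snd (snd e)))) L)
    by (apply lsum_nonneg; intros; apply Rabs_pos).
  assert (A2 : 0 <= lsum (fun e : mode => Rabs (- (fst e * IZR (fst (snd e))))) L)
    by (apply lsum_nonneg; intros; apply Rabs_pos).
  assert (Hg : forall (f : mode -> R) x, Rabs (lsum (fun e => f e * sin (ph (snd e) x)) L)
     <= lsum (fun e => Rabs (f e)) L).
  { intros f x. apply Rle_trans with (1 := lsum_abs _ _). apply lsum_le. intros e _.
    rewrite Rabs_mult. apply Rle_trans with (Rabs (f e) * 1); [|lra].
    apply Rmult_le_compat_l; [apply Rabs_pos|apply Rabs_sin_le]. }
  split; [lra|]. intros x. unfold field; simpl fst; simpl snd. split.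
  - pose proof (Hg (fun e : mode => fst e * IZR (snd (snd e))) x). simpl in H. lra.
  - pose proof (Hg (fun e : mode => - (fst e * IZR (fst (snd e)))) x). simpl in H. lra.
Qed.

Lemma evol_bound T : 0 <= T -> exists C, 0 <= C /\ forall t x, 0 <= t <= T -> Rabs (evol t x) <= C.
Proof.
  intros HT. destruct (PhiM_bound L nu nu_nonneg b 0 0 T HT Hb) as (C & HC & HB).
  destruct (Phi_close L nu nu_nonneg b 0 0 T HT Hb) as (K & HK & HKc).
  destruct Hb as [m0 Hm0]. exists (C + K). split; [lra|]. intros t x Ht.
  specialize (HB 0 m0 t x Hm0 Ht). specialize (HKc 0 m0 t x Hm0 Ht).
  assert (K / (INR m0 + 1) <= K).
  { pose proof (pos_INR m0). apply Rmult_le_reg_r with (INR m0 + 1); [lra|].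
    replace (K / (INR m0 + 1) * (INR m0 + 1)) with K by (field; lra). nra. }
  unfold evol. replace (Phi L nu b 0 0 0 t x) with
    (PhiM L nu b 0 0 0 m0 t x + (Phi L nu b 0 0 0 t x - PhiM L nu b 0 0 0 m0 t x)) by ring.
  apply Rle_trans with (1 := Rabs_triang _ _). lra.
Qed.

Lemma grad_lip (f f1 f2 : R2 -> R) C :
  (forall x1 x2, derivable_pt_lim (fun y => f (y, x2)) x1 (f1 (x1, x2))) ->
  (forall x1 x2, derivable_pt_lim (fun y => f (x1, y)) x2 (f2 (x1, x2))) ->
  (forall x, Rabs (f1 x) <= C) -> (forall x, Rabs (f2 x) <= C) ->
  forall x y, Rabs (f x - f y) <= 2 * C * dist2 x y.
Proof.
  intros H1 H2 B1 B2 [x1 x2] [y1 y2].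
  destruct (MVT_abs (fun z => f (z, x2)) (fun z => f1 (z, x2)) y1 x1) as (z1 & E1 & _); auto.
  destruct (MVT_abs (fun z => f (y1, z)) (fun z => f2 (y1, z)) y2 x2) as (z2 & E2 & _); auto.
  replace (f (x1, x2) - f (y1, y2)) with ((f (x1, x2) - f (y1, x2)) + (f (y1, x2) - f (y1, y2))) by ring.
  apply Rle_trans with (1 := Rabs_triang _ _). rewrite E1, E2.
  pose proof (fst_le_norm2 (x1 - y1, x2 - y2)) as N1. pose proof (snd_le_norm2 (x1 - y1, x2 - y2)) as N2.
  simpl in N1, N2. change (norm2 (x1 - y1, x2 - y2)) with (dist2 (x1, x2) (y1, y2)) in N1, N2.
  set (d := dist2 (x1, x2) (y1, y2)) in *.
  assert (Rabs (f1 (z1, x2)) * Rabs (x1 - y1) <= C * d) by (apply Rmult_le_compat; auto using Rabs_pos).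
  assert (Rabs (f2 (y1, z2)) * Rabs (x2 - y2) <= C * d) by (apply Rmult_le_compat; auto using Rabs_pos).
  lra.
Qed.

(** The principal value of the limit exists by [pv_exists] and is identified by comparison: the
    difference from the approximation has values and slopes of order [1 / (n + 1)], so by
    [pv_compare] the nonlocal terms differ by as little. Then the defect tends to 0; the [+ 1] in
    [Km] keeps the comparison constant positive. *)
Lemma evol_pde t x : 0 < t -> exists Lx, pv_frac_integral s (evol t) x Lx /\
  Phi L nu (generator L nu b) 0 0 0 t x + fst (field L x) * Phi L nu b 1 0 (0 + PI / 2) t x
   + snd (field L x) * Phi L nu b 0 1 (0 + PI / 2) t x + c * Lx = 0.
Proof.
  intros Ht. assert (HT : 0 <= t) by lra.
  pose proof (finsupp_generator L nu b Hb) as Hb1.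
  destruct (evol_bound t HT) as (CA & HCA & HA).
  destruct (Phi_lip L nu nu_nonneg b 0 0 t HT Hb) as (CL & HCL & HL).
  destruct (pv_exists s (2 * CA) (CL * 2) (evol t) x Hs Hs') as [Lx HLx].
  { intros y. pose proof (HA t x ltac:(lra)) as A1. pose proof (HA t y ltac:(lra)) as A2.
    unfold Rminus. apply Rle_trans with (1 := Rabs_triang _ _). rewrite Rabs_Ropp. lra. }
  { intros y z. specialize (HL 0 t t z y ltac:(lra) ltac:(lra)). apply Rle_trans with (1 := HL).
    rewrite Rminus_diag, Rabs_R0, Rplus_0_l, Rmult_assoc. apply Rmult_le_compat_l; auto.
    pose proof (fst_le_norm2 (fst y - fst z, snd y - snd z)) as N1.
    pose proof (snd_le_norm2 (fst y - fst z, snd y - snd z)) as N2.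
    simpl in N1, N2. fold (dist2 y z) in N1, N2. lra. }
  exists Lx. split; auto.
  destruct field_bound as (U & HU0 & HU). destruct (HU x) as [HU1 HU2].
  destruct (Phi_close L nu nu_nonneg (generator L nu b) 0 0 t HT Hb1) as (K0 & HK0 & E0).
  destruct (Phi_close L nu nu_nonneg b 1 0 t HT Hb) as (K1 & HK1 & E1).
  destruct (Phi_close L nu nu_nonneg b 0 1 t HT Hb) as (K2 & HK2 & E2).
  destruct (Phi_close L nu nu_nonneg b 0 0 t HT Hb) as (K & HK & E).
  destruct (galerkin_defect t HT) as (D & HD & HDf).
  destruct Hb as [m0 Hm0]. destruct Hb1 as [m1 Hm1].
  set (Km := K + K1 + K2 + 1).
  set (K3 := 2 * Km * Kc s 1 1).
  assert (Hle : Rabs (Phi L nu (generator L nu b) 0 0 0 t x + fst (field L x) * Phi L nu b 1 0 (0 + PI / 2) t x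
     + snd (field L x) * Phi L nu b 0 1 (0 + PI / 2) t x + c * Lx) <= 0).
  { apply le_of_inv_bound with (K := D + K0 + U * K1 + U * K2 + c * K3) (n0 := max m0 m1).
    intros n Hn. eapply Rle_trans; [|right; symmetry; apply Rplus_0_l].
    assert (Hs0 : supp n b) by (apply supp_mono with m0; auto; lia).
    assert (Hs1 : supp n (generator L nu b)) by (apply supp_mono with m1; auto; lia).
    pose proof (pos_INR n) as Hn0.
    set (iv := / (INR n + 1)). assert (Hiv : 0 < iv) by (apply Rinv_0_lt_compat; lra).
    assert (HLM : Rabs (Lx - LM n t x) <= K3 * iv).
    { assert (Hpvn : pv_frac_integral s (fun y => PhiM L nu b 0 0 0 n t y) x (LM n t x)).
      { apply pv_ext with (fun y => lsum (fun k => a n t k * sin (ph k y)) (box n)).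
        - intros y. unfold PhiM. apply lsum_ext. intros k _. unfold monom, a. simpl. rewrite Rplus_0_r. ring.
        - apply pv_modes. }
      assert (Hlip : forall y z, Rabs ((evol t y - PhiM L nu b 0 0 0 n t y) - (evol t z - PhiM L nu b 0 0 0 n t z))
         <= 2 * (Km * iv) * dist2 y z).
      { apply (grad_lip (fun y => evol t y - PhiM L nu b 0 0 0 n t y)
          (fun y => Phi L nu b 1 0 (0 + PI / 2) t y - PhiM L nu b 1 0 (0 + PI / 2) n t y)
          (fun y => Phi L nu b 0 1 (0 + PI / 2) t y - PhiM L nu b 0 1 (0 + PI / 2) n t y)).
        - intros x1 x2. apply derivable_pt_lim_minus; [|apply PhiM_d1].
          apply (Phi_d1 L nu nu_nonneg b 0 0 0); auto.
        - intros x1 x2. apply derivable_pt_lim_minus; [|apply PhiM_d2].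
          apply (Phi_d2 L nu nu_nonneg b 0 0 0); auto.
        - intros y. apply Rle_trans with (1 := E1 _ n t y Hs0 ltac:(lra)).
          unfold Rdiv. fold iv. apply Rmult_le_compat_r; unfold Km; lra.
        - intros y. apply Rle_trans with (1 := E2 _ n t y Hs0 ltac:(lra)).
          unfold Rdiv. fold iv. apply Rmult_le_compat_r; unfold Km; lra. }
      assert (Hsup : forall y, Rabs (evol t y - PhiM L nu b 0 0 0 n t y) <= Km * iv).
      { intros y. apply Rle_trans with (1 := E _ n t y Hs0 ltac:(lra)).
        unfold Rdiv. fold iv. apply Rmult_le_compat_r; unfold Km; lra. }
      set (A := 2 * (Km * iv)).
      assert (HApos : 0 < A).
      { unfold A. apply Rmult_lt_0_compat; [lra|]. apply Rmult_lt_0_compat; auto. unfold Km; lra. }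
      assert (EK : Kc s A A = K3 * iv) by (rewrite Kc_diag by auto; unfold A, K3; ring).
      rewrite <- EK.
      assert (Hmin : forall y, Rabs ((evol t x - PhiM L nu b 0 0 0 n t x) - (evol t y - PhiM L nu b 0 0 0 n t y))
         <= Rmin A (A * dist2 x y)).
      { intros y. apply Rmin_glb; [|apply Hlip].
        pose proof (Hsup x). pose proof (Hsup y).
        eapply Rle_trans; [apply (Rabs_triang _ (- (evol t y - PhiM L nu b 0 0 0 n t y)))|].
        rewrite Rabs_Ropp. unfold A. lra. }
      assert (P1 : Lx - LM n t x <= Kc s A A).
      { apply (pv_compare s (evol t) (fun y => PhiM L nu b 0 0 0 n t y) x); auto.
        intros y. apply Rle_trans with (2 := Hmin y).
        apply Rle_trans with (2 := Rle_abs _). lra. }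
      assert (P2 : LM n t x - Lx <= Kc s A A).
      { apply (pv_compare s (fun y => PhiM L nu b 0 0 0 n t y) (evol t) x); auto.
        intros y. apply Rle_trans with (2 := Hmin y). rewrite <- Rabs_Ropp.
        apply Rle_trans with (2 := Rle_abs _). lra. }
      apply Rabs_le. lra. }
    specialize (HDf n t x Hs0 ltac:(lra)).
    pose proof (E0 0 n t x Hs1 ltac:(lra)) as F0. pose proof (E1 (0 + PI / 2) n t x Hs0 ltac:(lra)) as F1.
    pose proof (E2 (0 + PI / 2) n t x Hs0 ltac:(lra)) as F2.
    unfold Rdiv in HDf, F0, F1, F2 |- *. fold iv in HDf, F0, F1, F2 |- *.
    change (PI * / 2) with (PI / 2) in *.
    set (P0 := Phi L nu (generator L nu b) 0 0 0 t x) in *. set (Q0 := PhiM L nu (generator L nu b) 0 0 0 n t x) in *.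
    set (P1 := Phi L nu b 1 0 (0 + PI / 2) t x) in *. set (Q1 := PhiM L nu b 1 0 (0 + PI / 2) n t x) in *.
    set (P2 := Phi L nu b 0 1 (0 + PI / 2) t x) in *. set (Q2 := PhiM L nu b 0 1 (0 + PI / 2) n t x) in *.
    set (u1 := fst (field L x)) in *. set (u2 := snd (field L x)) in *.
    set (LL := LM n t x) in *. clearbody P0 P1 P2 Q0 Q1 Q2 u1 u2 LL.
    replace (P0 + u1 * P1 + u2 * P2 + c * Lx) with ((Q0 + u1 * Q1 + u2 * Q2 + c * LL)
      + (P0 - Q0) + u1 * (P1 - Q1) + u2 * (P2 - Q2) + c * (Lx - LL)) by ring.
    eapply Rle_trans; [apply Rabs_triang|].
    eapply Rle_trans; [apply Rplus_le_compat_r, Rabs_triang|].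
    eapply Rle_trans; [apply Rplus_le_compat_r, Rplus_le_compat_r, Rabs_triang|].
    eapply Rle_trans; [apply Rplus_le_compat_r, Rplus_le_compat_r, Rplus_le_compat_r, Rabs_triang|].
    rewrite !Rabs_mult, (Rabs_pos_eq c) by auto.
    assert (G1 : Rabs u1 * Rabs (P1 - Q1) <= U * (K1 * iv)) by (apply Rmult_le_compat; auto using Rabs_pos).
    assert (G2 : Rabs u2 * Rabs (P2 - Q2) <= U * (K2 * iv)) by (apply Rmult_le_compat; auto using Rabs_pos).
    assert (G3 : c * Rabs (Lx - LL) <= c * (K3 * iv)) by (apply Rmult_le_compat_l; auto).
    lra. }
  match type of Hle with Rabs ?z <= 0 => destruct (Req_dec z 0) as [|Hne]; auto;
    pose proof (Rabs_pos_lt z Hne); lra end.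
Qed.

Lemma evol_0 (m : nat) : supp m b -> forall x, evol 0 x = lsum (fun k => b k * sin (ph k x)) (box m).
Proof.
  intros Hm x. destruct (Phi_close L nu nu_nonneg b 0 0 0 (Rle_refl 0) Hb) as (K & HK & HKc).
  set (v := lsum (fun k => b k * sin (ph k x)) (box m)).
  assert (Hle : Rabs (evol 0 x - v) <= 0).
  { apply le_of_inv_bound with (K := K) (n0 := m). intros n Hn. rewrite Rplus_0_l.
    assert (Hs0 : supp n b) by (apply supp_mono with m; auto).
    specialize (HKc 0 n 0 x Hs0 ltac:(lra)).
    replace v with (PhiM L nu b 0 0 0 n 0 x); [exact HKc|].
    unfold PhiM, v. symmetry.
    rewrite (lsum_ext (fun k => gal L nu n b k 0 * monom 0 0 k * sin (ph k x + 0)) (fun k => b k * sin (ph k x))).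
    - apply lsum_nested_eq; auto using box_NoDup.
      + intros l Hl. apply box_incl with m; auto.
      + intros l _ Hl. destruct (Req_dec (b l) 0) as [->|Hne]; [ring|]. elim Hl. auto.
    - intros k _. rewrite gal_0. unfold monom. simpl. rewrite Rplus_0_r. ring. }
  destruct (Req_dec (evol 0 x - v) 0) as [|Hne]; [lra|]. pose proof (Rabs_pos_lt _ Hne). lra.
Qed.

Lemma evol_wsol T : 0 <= T -> exists C, wsol s c (field L) evol T C.
Proof.
  intros HT. destruct (evol_bound T HT) as (C & HC & HB). exists C. split; [|split]; auto.
  - apply (Phi_cont_on L nu nu_nonneg b 0 0 0 Hb).
  - intros t x Ht. destruct (evol_pde t x Ht) as (Lx & H1 & H2).
    exists (Phi L nu (generator L nu b) 0 0 0 t x), (Phi L nu b 1 0 (0 + PI / 2) t x),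
      (Phi L nu b 0 1 (0 + PI / 2) t x), Lx.
    repeat split; auto.
    + now apply (Phi_dt L nu nu_nonneg b 0 0 0).
    + destruct x as [x1 x2]; simpl. apply (shift_derive (fun y => evol t (y, x2))).
      apply (Phi_d1 L nu nu_nonneg b 0 0 0); auto. lra.
    + destruct x as [x1 x2]; simpl. apply (shift_derive (fun y => evol t (x1, y))).
      apply (Phi_d2 L nu nu_nonneg b 0 0 0); auto. lra.
Qed.

(* The energy bounds grow in time; the global bound comes from the maximum principle. *)
Theorem evol_solution theta0 m : supp m b ->
  (forall x, theta0 x = lsum (fun k => b k * sin (ph k x)) (box m)) ->
  is_solution s c (field L) theta0 evol.
Proof.
  intros Hm H0.
  destruct field_bound as (U & HU0 & HU).
  set (B := lsum (fun k => Rabs (b k)) (box m)).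
  assert (HB0 : forall x, Rabs (evol 0 x) <= B).
  { intros x. rewrite (evol_0 m Hm). apply Rle_trans with (1 := lsum_abs _ _). apply lsum_le.
    intros k _. rewrite Rabs_mult.
    apply Rle_trans with (Rabs (b k) * 1); [|lra].
    apply Rmult_le_compat_l; [apply Rabs_pos|apply Rabs_sin_le]. }
  split; [|split; [|split; [|split]]].
  - exact (Phi_smooth L nu nu_nonneg b 0 0 0 Hb).
  - exact (Phi_cont_on L nu nu_nonneg b 0 0 0 Hb).
  - exists B. intros t x Ht. destruct (Req_dec t 0) as [->|Hne]; [apply HB0|].
    destruct (evol_wsol t Ht) as [C HC].
    assert (H1 : - B <= evol t x).
    { apply (wsol_lower s c (field L) evol C U (- B) t x); auto; [lra|].
      intros y. specialize (HB0 y). apply Rabs_le_between in HB0. lra. }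
    assert (H2 : - B <= - evol t x).
    { apply (wsol_lower s c (field L) (fun t x => - evol t x) C U (- B) t x); auto; [lra| |].
      - now apply wsol_neg.
      - intros y. specialize (HB0 y). apply Rabs_le_between in HB0. lra. }
    apply Rabs_le. lra.
  - intros x. rewrite H0. now apply evol_0.
  - intros t x Ht. destruct (evol_wsol t ltac:(lra)) as (C & _ & _ & H). now apply H.
Qed.

End Existence.

(** * Conclusion *)

Lemma Gamma_nonneg z v : is_Gamma z v -> 0 <= v.
Proof.
  intros H. apply Rnot_lt_le. intros Hv. unfold is_Gamma in H. rewrite improper_iff in H.
  destruct (H (- v)) as (a0 & b0 & Ha0 & Hab); [lra|].
  pose proof (Rmax_l b0 a0) as R1. pose proof (Rmax_r b0 a0) as R2.
  destruct (Hab (a0 / 2) (Rmax b0 a0 + 1) ltac:(lra) ltac:(lra) ltac:(lra)) as [E1 E2].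
  assert (0 <= RInt (fun t => Rpower t (z - 1) * exp (- t)) (a0 / 2) (Rmax b0 a0 + 1)).
  { apply RInt_ge_0; auto; [lra|]. intros x _.
    apply Rmult_le_pos; apply Rlt_le, exp_pos. }
  apply Rabs_def2 in E2. lra.
Qed.

Lemma frac_const_nonneg s g1 g2 : 0 < s -> 0 <= g1 -> 0 <= g2 -> 0 <= frac_const s g1 g2.
Proof.
  intros Hs H1 H2. unfold frac_const. pose proof PI_RGT_0.
  apply Rmult_le_pos.
  - apply Rmult_le_pos; [apply Rmult_le_pos; auto; apply Rlt_le, exp_pos|lra].
  - destruct H2 as [H2|<-].
    + apply Rlt_le, Rinv_0_lt_compat. now apply Rmult_lt_0_compat.
    (* For [g2 = 0] the quotient is 0 by the convention [/ 0 = 0], so nonnegativity of [g2]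
       suffices. *)
    + rewrite Rmult_0_r, Rinv_0. lra.
Qed.

Section Wave.
Variables (eta K : R).
Definition wave (x : R2) : R := eta / 2 * sin (K * fst x).

Lemma wave_tsum x : tsum ((eta / 2, (K, 0)) :: nil) 0 x = wave x.
Proof.
  unfold tsum, wave; simpl. replace (K * fst x + 0 * snd x + 0) with (K * fst x) by ring. ring.
Qed.

Lemma wave_smooth : smooth2 wave.
Proof. intros k. apply Ck_ext with (1 := wave_tsum). apply tsum_smooth. Qed.

Lemma wave_C2 : 0 < eta -> 0 <= K -> eta * (1 + K + K ^ 2) <= 1 -> C2_norm_le1 wave.
Proof.
  intros He HK H.
  exists (fun x => eta / 2 * (K * cos (K * fst x))), (fun _ => 0),
    (fun x => eta / 2 * (K * (- (K * sin (K * fst x))))), (fun _ => 0), (fun _ => 0).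
  split; [|split; [|split; [|split; [|split]]]].
  - intros x. unfold wave; simpl. apply is_derive_Reals. auto_derive; auto. rewrite Rplus_0_r. ring.
  - intros x. unfold wave; simpl. apply derivable_pt_lim_const.
  - intros x. simpl. apply is_derive_Reals. auto_derive; auto. rewrite Rplus_0_r. ring.
  - intros x. simpl. apply derivable_pt_lim_const.
  - intros x. apply derivable_pt_lim_const.
  - exists (eta / 2), (eta / 2 * K), 0, (eta / 2 * K ^ 2), 0, 0.
    assert (Hz : sup_le (fun _ => 0) 0) by (intros x; rewrite Rabs_R0; lra).
    assert (HK2 : 0 <= K * K) by nra.
    repeat split; auto.
    + intros x. unfold wave. rewrite Rabs_mult, (Rabs_pos_eq (eta / 2)) by lra.
      pose proof (Rabs_sin_le (K * fst x)). nra.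
    + intros x. rewrite Rabs_mult, Rabs_mult, (Rabs_pos_eq (eta / 2)), (Rabs_pos_eq K) by lra.
      apply Rmult_le_compat_l; [lra|]. pose proof (Rabs_cos_le (K * fst x)). nra.
    + intros x. replace (K * - (K * sin (K * fst x))) with (- (K * K * sin (K * fst x))) by ring.
      rewrite Rabs_mult, Rabs_Ropp, Rabs_mult, (Rabs_pos_eq (eta / 2)), (Rabs_pos_eq (K * K)) by lra.
      apply Rmult_le_compat_l; [lra|]. pose proof (Rabs_sin_le (K * fst x)). simpl. nra.
    + lra.
Qed.

End Wave.

(** The amplitude [1/32] normalises the norm: two components bounded by 2 give [4/32], two Holder
    constants 14 give [28/32], and the sum is 1. *)
Lemma field_Calpha p N u : 0 < p -> p < 1 / 2 ->
  (forall x y, u (x, y) = (- (1 / 32) * vel p N x y, 1 / 32 * vel p N y x)) ->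
  Calpha_norm_le1 (1 - 2 * p) u.
Proof.
  intros Hp Hp' Hu. exists (1 / 8), (28 / 32). split; [|split; [|lra]].
  - intros [x y]. rewrite Hu. apply Rle_trans with (1 := norm2_le_sum _). simpl fst; simpl snd.
    rewrite !Rabs_mult, Rabs_Ropp, (Rabs_pos_eq (1 / 32)) by lra.
    pose proof (vel_le2 p N Hp Hp' x y). pose proof (vel_le2 p N Hp Hp' y x). lra.
  - intros [x1 x2] [y1 y2] Hne. rewrite !Hu. unfold dist2 at 1.
    apply Rle_trans with (1 := norm2_le_sum _). simpl fst; simpl snd.
    replace (- (1 / 32) * vel p N x1 x2 - - (1 / 32) * vel p N y1 y2)
      with (- (1 / 32 * (vel p N x1 x2 - vel p N y1 y2))) by ring.
    rewrite <- Rmult_minus_distr_l, Rabs_Ropp, !Rabs_mult, (Rabs_pos_eq (1 / 32)) by lra.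
    pose proof (vel_holder p N Hp Hp' (x1, x2) (y1, y2) Hne) as H1.
    assert (Hne' : (x2, x1) <> (y2, y1)) by (intros E; apply Hne; congruence).
    pose proof (vel_holder p N Hp Hp' (x2, x1) (y2, y1) Hne') as H2. simpl fst in *; simpl snd in *.
    assert (E : dist2 (x2, x1) (y2, y1) = dist2 (x1, x2) (y1, y2)).
    { unfold dist2, norm2. f_equal. simpl. ring. }
    rewrite E in H2. lra.
Qed.

Lemma is_solution_wsol s c u theta0 theta T : is_solution s c u theta0 theta ->
  exists M, wsol s c u theta T M.
Proof.
  intros (_ & H1 & [M H2] & _ & H4). exists M. split; [|split]; auto.
  intros t x Ht. apply H2. lra.
Qed.

Theorem theorem1p1 :
  forall (s alpha : R), 0 < s -> s < 1 / 2 -> 0 < alpha -> alpha < 1 - 2 * s ->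
  forall g1 g2 : R, is_Gamma (1 + s) g1 -> is_Gamma (1 - s) g2 ->
  exists (T : R) (theta0 : R2 -> R),
    0 < T /\ smooth2 theta0 /\ C2_norm_le1 theta0 /\
    forall rho : R -> R, modulus rho ->
      exists u : R2 -> R2,
        smooth_field u /\ div_free u /\ Calpha_norm_le1 alpha u /\
        (exists theta, is_solution s (frac_const s g1 g2) u theta0 theta) /\
        (forall theta, is_solution s (frac_const s g1 g2) u theta0 theta ->
           exists t, 0 <= t /\ t <= T /\ breaks_at theta rho t).
Proof.
  intros s alpha Hs Hs' Hal Hal' g1 g2 Hg1 Hg2.
  set (c := frac_const s g1 g2).
  assert (Hc : 0 <= c) by (apply frac_const_nonneg; eauto using Gamma_nonneg).
  set (p := (1 - alpha) / 2). assert (Hp : 0 < p) by (unfold p; lra).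
  assert (Hp' : p < 1 / 2) by (unfold p; lra).
  assert (Halp : 1 - 2 * p = alpha) by (unfold p; field).
  set (A := 1 / 32). assert (HA : 0 < A) by (unfold A; lra).
  set (gam := 1 - 2 * s - alpha). assert (Hgam : 0 < gam) by (unfold gam; lra).
  set (CL := c * Kc s 1 40 / (A / 4 * gam)).
  assert (HCL : 0 <= CL).
  { apply Rmult_le_pos.
    - apply Rmult_le_pos; auto. apply Rlt_le, Kc_pos; lra.
    - apply Rlt_le, Rinv_0_lt_compat. apply Rmult_lt_0_compat; lra. }
  pose proof PI_RGT_0 as HPI. pose proof PI_4 as HPI4.
  (* Below [d] the total relative loss [CL * X0^gam] is at most 1/4; the barrier starts with height
     1/2 above 0, so half of it survives. *)
  destruct (Rpower_small gam (/ (4 * (CL + 1))) Hgam) as (d & Hd & Hsmall).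
  { apply Rinv_0_lt_compat; lra. }
  (* The frequency is an integer, so that the datum is a single mode on [Z^2]. [K > PI / d] puts the
     crest [X0] below [d], and [K >= 2] puts it below 1. *)
  destruct (INR_unbounded (PI / d)) as [n Hn].
  set (Kn := max n 2). set (K := INR Kn).
  assert (HnK : INR n <= K) by (apply le_INR; unfold Kn; lia).
  assert (HK2 : 2 <= K) by (apply (le_INR 2); unfold Kn; lia).
  set (X0 := PI / (2 * K)).
  assert (HX0 : 0 < X0) by (apply Rdiv_lt_0_compat; lra).
  assert (HX01 : X0 <= 1).
  { apply Rmult_le_reg_r with (2 * K); [lra|]. unfold X0.
    replace (PI / (2 * K) * (2 * K)) with PI by (field; lra). lra. }
  assert (HX0d : X0 < d).
  { apply Rmult_lt_reg_r with (2 * K); [lra|]. unfold X0.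
    replace (PI / (2 * K) * (2 * K)) with PI by (field; lra).
    apply Rmult_gt_compat_r with (r := d) in Hn; auto.
    replace (PI / d * d) with PI in Hn by (field; lra). nra. }
  assert (Hloss : CL * Rpower X0 gam <= 1 / 4).
  { specialize (Hsmall X0 HX0 HX0d). apply Rle_trans with ((CL + 1) * / (4 * (CL + 1))).
    - apply Rmult_le_compat; try lra. apply Rlt_le, exp_pos.
    - right. field. lra. }
  set (eta := / (1 + K + K ^ 2)).
  assert (HKK : 0 < 1 + K + K ^ 2) by (simpl; nra).
  assert (Heta : 0 < eta) by (now apply Rinv_0_lt_compat).
  exists (/ (A / 4 * (1 - alpha))), (wave eta K).
  split; [|split; [apply wave_smooth|split]].
  { apply Rinv_0_lt_compat. apply Rmult_lt_0_compat; lra. }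
  { apply wave_C2; auto; [lra|]. unfold eta. rewrite Rinv_l; lra. }
  intros rho (_ & _ & Hrho & Hrho0).
  (* The two barriers will separate the values at [(eps, 0)] and [(- eps, 0)] by at least
     [2 (eta / 2 - eta / 4) = eta / 2]. Since [2 eps <= dl / 2], continuity at 0 gives
     [rho (2 eps) < eta / 2]. *)
  destruct (Hrho 0 (Rle_refl 0) (eta / 2) ltac:(lra)) as (dl & Hdl & Hmod).
  set (eps := Rmin (X0 / 2) (dl / 4)).
  assert (Heps : 0 < eps) by (apply Rmin_pos; lra).
  assert (Heps1 : eps <= X0 / 2) by apply Rmin_l.
  assert (Heps2 : eps <= dl / 4) by apply Rmin_r.
  assert (HepsPI : eps < PI) by (pose proof half_PI_gt; lra).
  assert (Hsin : 0 < sin eps) by (apply sin_gt_0; auto).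
  assert (Hsin2 : 0 < sin eps ^ 2) by (apply pow_lt; auto).
  assert (Hsin1 : sin eps ^ 2 <= 1) by (pose proof (pow2_ge_0 (cos eps)); rewrite sin_sq; lra).
  (* The truncation is taken fine enough for the inflow to keep its singular lower bound down to
     distance [eps]. *)
  destruct (pow_linear_small (1 - sin eps ^ 2 / 2) (sin eps ^ 2 / 4)) as [N HN]; try lra.
  destruct (field_stream A p N) as [L HL].
  exists (field L).
  pose proof (field_Calpha p N (field L) Hp Hp' HL) as HCa.
  rewrite Halp in HCa.
  split; [apply field_smooth|split; [apply field_div_free|split; [exact HCa|]]].
  set (k0 := (Z.of_nat Kn, 0%Z)).
  set (b := fun k => delta k k0 * (eta / 2)).
  assert (Hb : supp Kn b).
  { intros k Hk. unfold b, delta in Hk. destruct (idx_dec k k0) as [->|]; [|lra].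
    rewrite in_box. unfold k0; simpl. lia. }
  split.
  { exists (evol L s c b Hs Hs'). apply evol_solution with Kn; auto; [now exists Kn|].
    intros x. unfold b.
    rewrite (lsum_ext _ (fun k => delta k k0 * (eta / 2 * sin (ph k x)))) by (intros; ring).
    rewrite (delta_sum (fun k => eta / 2 * sin (ph k x))); auto using box_NoDup.
    - unfold wave, ph, k0, K; simpl. rewrite <- INR_IZR_INZ. do 2 f_equal. ring.
    - rewrite in_box. unfold k0; simpl. lia. }
  intros theta Hsol.
  set (tt := travel alpha A X0 N (X0 - eps)).
  assert (HepsX : eps < X0) by lra.
  assert (HUb : forall x, Rabs (fst (field L x)) <= 1 /\ Rabs (snd (field L x)) <= 1).
  { destruct HCa as (M & H & B1 & B2 & B3). intros x.
    assert (HM1 : norm2 (field L x) <= 1).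
    (* The Holder constant [H] is nonnegative, as one pair of distinct points shows, so the supremum
       bound is at most 1. *)
    { specialize (B1 x). assert (0 <= H); [|lra].
      assert (Hne : (1, 0) <> (0, 0) :> R2) by (intros E; inversion E; lra).
      specialize (B2 (1, 0) (0, 0) Hne). pose proof (dist2_nonneg (field L (1, 0)) (field L (0, 0))).
      assert (0 < Rpower (dist2 (1, 0) (0, 0)) alpha) by apply exp_pos. nra. }
    pose proof (fst_le_norm2 (field L x)). pose proof (snd_le_norm2 (field L x)). lra. }
  destruct (is_solution_wsol _ _ _ _ _ tt Hsol) as [M HM].
  pose proof Hsol as (_ & _ & _ & Hinit & _).
  assert (HKX : PI / 2 / X0 = K) by (unfold X0; field; lra).
  pose proof (barrier_holds s alpha c A X0 eps eta 1 N (field L) Hs Hs' Hal Hal' Hc HA Heta Heps HepsX HX01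
    (or_introl eq_refl) HL HN theta 1 M HUb HM
    ltac:(intros x; rewrite Hinit, HKX; unfold wave; rewrite Rmult_1_l; reflexivity)) as Bplus.
  pose proof (barrier_holds s alpha c A X0 eps eta (-1) N (field L) Hs Hs' Hal Hal' Hc HA Heta Heps HepsX HX01
    (or_intror eq_refl) HL HN (fun t x => - theta t x) 1 M HUb (wsol_neg _ _ _ _ _ _ HM)
    ltac:(intros x; cbn beta; rewrite Hinit, HKX; unfold wave;
          replace (K * (-1 * fst x)) with (- (K * fst x)) by ring; rewrite sin_neg; ring)) as Bminus.
  cbn beta in Bminus. fold p gam CL tt in Bplus, Bminus.
  exists tt. split; [|split].
  - apply Rlt_le. apply (travel_pos s alpha A X0 eps N); auto.
  - apply (travel_bound s alpha A X0 eps N); auto.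
  - exists (1 * eps, 0), (-1 * eps, 0).
    assert (Ed : dist2 (1 * eps, 0) (-1 * eps, 0) = 2 * eps).
    { unfold dist2, norm2; simpl fst; simpl snd.
      replace ((1 * eps - -1 * eps) ^ 2 + (0 - 0) ^ 2) with (2 * eps * (2 * eps)) by ring.
      apply sqrt_square. lra. }
    rewrite Ed. specialize (Hmod (2 * eps) ltac:(lra)).
    rewrite Rminus_0_r, (Rabs_pos_eq (2 * eps)) in Hmod by lra. specialize (Hmod ltac:(lra)).
    rewrite Hrho0, Rminus_0_r in Hmod. apply Rabs_def2 in Hmod.
    assert (eta * (CL * Rpower X0 gam) <= eta * (1 / 4)) by (apply Rmult_le_compat_l; lra).
    apply Rlt_gt. apply Rlt_le_trans with (2 := Rle_abs _). lra.
Qed.
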